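(* Let $\mu=2(9+\sqrt{11})/35$. Let $\xi\in\mathbb{R}$ be such that $1,\xi,\xi^3$ are linearly independent over $\mathbb{Q}$ and let $\tau<1+1/\mu\cong 2.421$. Then there exist infinitely many algebraic integers $\alpha$ which are roots of polynomials of the form $T^4+aT^3+bT+c$ in $\mathbb{Z}[T]$ and satisfy $|\xi-\alpha|\le H(\alpha)^{-\tau}$.
   Context: The height $H(\alpha)$ of an algebraic number $\alpha$ is the largest absolute value of the coefficients of its irreducible polynomial in $\mathbb{Z}[T]$. *)

(* Defs.v *)
From HB Require Import structures.
From mathcomp Require Import all_boot all_order all_algebra.
From mathcomp Require Import all_classical all_reals all_analysis.
From mathcomp Require Import complex.

Set Implicit Arguments.
Unset Strict Implicit.
Unset Printing Implicit Defensive.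

Import Order.TTheory GRing.Theory Num.Theory.
Local Open Scope classical_set_scope.
Local Open Scope ring_scope.

Definition lin_indep_rat (R : realType) (s : seq R) : Prop :=
  forall q : 'I_(size s) -> rat,
    \sum_(i < size s) ratr (q i) * s`_i = 0 -> forall i, q i = 0.

(* [irreducible_poly] is irreducibility up to nonzero constants, so it would
   accept 2 * 'X in {poly int}; the height needs primitive polynomials. *)
Definition irreducible_elt (A : idomainType) (p : A) : Prop :=
  [/\ p != 0, p \isn't a GRing.unit &
      forall q r : A, p = q * r -> q \is a GRing.unit \/ r \is a GRing.unit].

Definition intpoly_root (R : realType) (p : {poly int}) (alpha : R[i]) : Prop :=
  root (map_poly (intr : int -> R[i]) p) alpha.

Definition poly_height (p : {poly int}) : nat :=
  (\max_(i < size p) `|(p`_i)%R|)%N.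

(* For algebraic [alpha] the irreducible polynomial in Z[T] is unique up to
   sign, so the choice made by [xget] does not affect the height;
   the height is 0 for transcendental [alpha]. *)
Definition height (R : realType) (alpha : R[i]) : nat :=
  poly_height (xget 0 [set p : {poly int} |
    irreducible_elt p /\ intpoly_root p alpha]).

(* Main.v *)
(* Following Davenport and Schmidt, it suffices to show that the minimal points
   x_i of (1, xi, xi^3), with first coordinates X_i and approximation errors
   L_i, satisfy X_{i+1} > L_i^(-p) for infinitely many i, whenever
   p < 1/mu = (9 - sqrt 11)/4: rounding the values of a linear form at x_i,
   x_{i+1} and a third vector completing them to a basis of Z^3 then gives an
   Eisenstein quartic T^4 + 4 u2 T^3 + 4 u1 T + 4 u0 + 2 of height O(1/L_i),
   taking a value O(1/X_{i+1}) at xi where its derivative is at least of order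
   1/L_i, hence a real root at distance O(L_i/X_{i+1}) from xi.

   Assume on the contrary that X_{i+1} <= L_i^(-p) for all large i.  On the
   plane spanned by x = x_i and z = x_{i+1}, the form
   cub w = w0^2 w2 - w1^3 is a binary cubic with coefficients
   a, b', c', d'.  Let y = s x + t z be the last minimal point in this plane;
   then t is large, while a, D = a^2 cub(y), b = t b' + 3 s a and the partial
   discriminant G = b^2 - 4 a c of the cubic in the coordinates x, y are small.
   Since 3 G = - b^2 and 27 D = b^3 modulo t^2, some polynomials in b, G, D are
   divisible by t^2, t^3 or t^6 and, being small, they vanish or force lower
   bounds on the ratio log(1/L_i)/log X_i.  If
   G = 0 the cubic form has a double root and a short lattice vector
   contradicts the trivial lower bound for L; this cannot happen twice in a
   row.  If G^3 + 27 D^2 = 0, the rational cusp parameter r gives a nonzero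
   lattice vector 3 (b x - 2 a y - r x)/t which is too short.  Otherwise the
   combination of order 6 makes log(1/L)/log X increase by a fixed amount at
   every step when 8 p^2 - 36 p + 35 > 0, although its limsup is at most 2. *)
Require Import Defs.
From HB Require Import structures.
From mathcomp Require Import all_boot all_order all_algebra.
From mathcomp Require Import all_classical all_reals all_analysis.
From mathcomp Require Import complex.
From mathcomp Require Import ring lra zify.

Set Implicit Arguments.
Unset Strict Implicit.
Unset Printing Implicit Defensive.

Import Order.TTheory GRing.Theory Num.Theory.
Local Open Scope ring_scope.

(** * Binary cubic forms *)

Record pt := Pt { p0 : int; p1 : int; p2 : int }.

Definition lin (s : int) (x : pt) (t : int) (y : pt) : pt :=
  Pt (s * p0 x + t * p0 y) (s * p1 x + t * p1 y) (s * p2 x + t * p2 y).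

(** This form vanishes on the cone over the curve (1, T, T^3), so it is small at good approximations
    to (1, xi, xi^3). *)
Definition cub (x : pt) : int := p0 x ^+ 2 * p2 x - p1 x ^+ 3.

(** The derivative of [cub] at [x] in the direction [y], hence a mixed coefficient of [cub] in the
    coordinates [x], [y]. *)
Definition pol (x y : pt) : int :=
  p0 x ^+ 2 * p2 y + 2 * p0 x * p2 x * p0 y - 3 * p1 x ^+ 2 * p1 y.

Lemma cub_lin s x t z : cub (lin s x t z) =
  cub x * s ^+ 3 + pol x z * s ^+ 2 * t + pol z x * s * t ^+ 2 + cub z * t ^+ 3.
Proof. rewrite /cub /pol /=; ring. Qed.

Lemma pol_linr s x t z : pol x (lin s x t z) = t * pol x z + 3 * s * cub x.
Proof. rewrite /cub /pol /=; ring. Qed.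

Lemma pol_linl s x t z : pol (lin s x t z) x =
  t ^+ 2 * pol z x + 2 * t * s * pol x z + 3 * s ^+ 2 * cub x.
Proof. rewrite /cub /pol /=; ring. Qed.

Section BinaryCubic.
Variables a b' c' d' s t : int.
Let b := t * b' + 3 * s * a.
Let c := t ^+ 2 * c' + 2 * t * s * b' + 3 * s ^+ 2 * a.
Let d := a * s ^+ 3 + b' * s ^+ 2 * t + c' * s * t ^+ 2 + d' * t ^+ 3.
Let G := b ^+ 2 - 4 * a * c.
Let D := a ^+ 2 * d.
(** Up to normalization, [h] and [J] are the leading coefficients of the Hessian and of the cubic
    covariant in the coordinates [x], [z]. Passing to [x], [y] multiplies them by [t ^+ 2] and
    [t ^+ 3], whence the next two identities. *)
Let h := b' ^+ 2 - 3 * a * c'.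
Let J := 2 * b' ^+ 3 - 9 * a * b' * c' + 27 * a ^+ 2 * d'.

Lemma seminvG : 3 * G = 4 * (h * t ^+ 2) - b ^+ 2.
Proof. rewrite /G /h /c /b; ring. Qed.

Lemma seminvD : 27 * D = J * t ^+ 3 - 3 * b * (h * t ^+ 2) + b ^+ 3.
Proof. rewrite /D /h /J /d /b; ring. Qed.

(** Give [b], [G], [D] the weights 1, 2, 3. A homogeneous combination becomes a polynomial in [b],
    [h * t ^+ 2], [J * t ^+ 3], and its order in [t] is governed by linear conditions on the
    coefficients. Here the terms b^6 cancel. *)
Lemma dvd_order2 : exists e, 27 * (G ^+ 3 + 27 * D ^+ 2) = t ^+ 2 * e.
Proof.
exists (64 * h ^+ 3 * t ^+ 4 - 39 * b ^+ 2 * h ^+ 2 * t ^+ 2 + 6 * b ^+ 4 * h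
  + J ^+ 2 * t ^+ 4 + 2 * b ^+ 3 * J * t - 6 * b * h * J * t ^+ 3).
transitivity ((3 * G) ^+ 3 + (27 * D) ^+ 2); first ring.
rewrite seminvG seminvD; ring.
Qed.

Lemma dvd_order2b : exists e, 9 * (G ^+ 2 - 3 * b * D) = t ^+ 2 * e.
Proof.
exists (16 * h ^+ 2 * t ^+ 2 - 5 * b ^+ 2 * h - b * J * t).
transitivity ((3 * G) ^+ 2 - b * (27 * D)); first ring.
rewrite seminvG seminvD; ring.
Qed.

(** The coefficients 1, -6, -5 of (3 G)^3, b (3 G)(27 D), (27 D)^2 cancel both b^6 and b^4 h t^2. *)
Lemma dvd_order3 :
  exists e, 27 * (G ^+ 3 - 18 * b * G * D - 135 * D ^+ 2) = t ^+ 3 * e.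
Proof.
exists (64 * h ^+ 3 * t ^+ 3 - 6 * b * (4 * h * (J * t ^+ 2 - 3 * b * h * t))
  - 4 * b ^+ 3 * J - 5 * (J ^+ 2 * t ^+ 3 - 6 * b * h * J * t ^+ 2
   + 9 * b ^+ 2 * h ^+ 2 * t) - 48 * h ^+ 2 * b ^+ 2 * t).
transitivity ((3 * G) ^+ 3 - 6 * b * (3 * G) * (27 * D) - 5 * (27 * D) ^+ 2);
  first ring.
rewrite seminvG seminvD; ring.
Qed.

(** All terms have weight 9. Cancelling the parts in 1, h t^2, J t^3, h^2 t^4 and h J t^5 imposes
    five linear conditions on the coefficients of six monomials. *)
Lemma dvd_order6 : exists e, 729 * (b ^+ 3 * D ^+ 2 + 11 * b ^+ 2 * G ^+ 2 * D
  - b * G ^+ 4 + 180 * b * G * D ^+ 2 - 10 * G ^+ 3 * D + 675 * D ^+ 3)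
  = t ^+ 6 * e.
Proof.
exists (16 * b ^+ 3 * J ^+ 2 + 243 * b ^+ 2 * h ^+ 2 * J * t
  + 125 * b ^+ 3 * h ^+ 3 - 384 * b * h ^+ 4 * t ^+ 2
  + 15 * b * h * J ^+ 2 * t ^+ 2 - 640 * h ^+ 3 * J * t ^+ 3
  + 25 * J ^+ 3 * t ^+ 3).
transitivity (b ^+ 3 * (27 * D) ^+ 2 + 33 * b ^+ 2 * (3 * G) ^+ 2 * (27 * D)
  - 9 * b * (3 * G) ^+ 4 + 60 * b * (3 * G) * (27 * D) ^+ 2
  - 10 * (3 * G) ^+ 3 * (27 * D) + 25 * (27 * D) ^+ 3); first ring.
rewrite seminvG seminvD; ring.
Qed.

(** The quotient m / t is a rational root of a monic integral quartic, hence an integer. *)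
Lemma dvd_monic_quartic (m u v w : int) :
  m ^+ 4 = t ^+ 2 * u * m ^+ 2 + t ^+ 3 * v * m + t ^+ 4 * w -> (t %| m)%Z.
Proof.
move=> E.
have [g0|g0] := eqVneq (gcdz m t) 0.
  by move/eqP: g0; rewrite gcdz_eq0 => /andP[/eqP-> _]; rewrite dvdz0.
set g := gcdz m t in g0 *.
have /dvdzP[m1 Em] : (g %| m)%Z := dvdz_gcdl _ _.
have /dvdzP[t1 Et] : (g %| t)%Z := dvdz_gcdr _ _.
have cop : coprimez t1 m1.
  rewrite coprimez_sym /coprimez; apply/eqP; apply: (mulIf g0).
  have := mulz_gcdl m1 t1 g.
  by rewrite -Em -Et -/g mul1r abszE ger0_norm.
have H : m1 ^+ 4 = t1 * (t1 * u * m1 ^+ 2 + t1 ^+ 2 * v * m1 + t1 ^+ 3 * w).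
  have g4 : g ^+ 4 != 0 by rewrite expf_neq0.
  apply: (mulIf g4); rewrite -exprMn -Em E Em Et; ring.
have : (t1 %| m1 ^+ 4)%Z by rewrite H dvdz_mulr.
have : coprimez t1 (m1 ^+ 4) by rewrite coprimezXr.
move=> c4 d4; have : (t1 %| 1)%Z by rewrite -(Gauss_dvdzl _ c4) mul1r.
by move=> d1; rewrite Em Et dvdz_mul // (dvdz_trans d1) // dvd1z.
Qed.
End BinaryCubic.

Lemma coprime_decomp (m n : int) : n != 0 -> exists g m1 n1,
  [/\ g != 0, m = g * m1, n = g * n1 & coprimez m1 n1].
Proof.
move=> n0; set g := gcdz m n.
have g0 : g != 0 by rewrite gcdz_eq0 (negPf n0) andbF.
have /dvdzP[m1 Em] : (g %| m)%Z := dvdz_gcdl _ _.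
have /dvdzP[n1 En] : (g %| n)%Z := dvdz_gcdr _ _.
exists g, m1, n1; split; rewrite // 1?mulrC //.
rewrite /coprimez; apply/eqP; apply: (mulIf g0).
have := mulz_gcdl m1 n1 g.
by rewrite -Em -En -/g mul1r abszE ger0_norm.
Qed.

(** Here - G / 3 is an integer whose cube is D^2, and r is D divided by it. *)
Lemma cuspidal_param (G D : int) : D != 0 -> G ^+ 3 + 27 * D ^+ 2 = 0 ->
  exists r, G = - 3 * r ^+ 2 /\ D = r ^+ 3.
Proof.
move=> D0 E.
have p3 : prime 3 by [].
have /dvdzP[n En] : (3%R %| G)%Z.
  have : (3%R %| G ^+ 3)%Z.
    by apply/dvdzP; exists (- 9 * D ^+ 2); lra.
  by rewrite !dvdzE abszX Euclid_dvdX // => /andP[].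
have En3 : (- n) ^+ 3 = D ^+ 2.
  have : 27 * ((- n) ^+ 3 - D ^+ 2) = 0 by rewrite -oppr0 -E En; ring.
  by move/eqP; rewrite mulf_eq0 /= subr_eq0 => /eqP.
have n0 : - n != 0.
  by apply: contraNneq D0 => n0; move: En3; rewrite n0 expr0n /= => /esym/eqP; rewrite sqrf_eq0.
have /dvdzP[r Er] : (- n %| D)%Z.
  by rewrite -(@dvdz_pexp2r _ _ 2) // -En3; apply/dvdzP; exists (- n); rewrite -exprS.
have Er2 : - n = r ^+ 2.
  by apply: (mulIf (expf_neq0 2 n0)); rewrite -exprS En3 Er exprMn.
exists r; split; last by rewrite Er Er2 exprS.
by rewrite En -[n]opprK Er2; ring.
Qed.

(** In terms of m = b - 3 r, 4 h t^2 is m (m + 6 r) and 4 J t^3 is - m (m^2 + 9 m r + 54 r^2).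
    Eliminating r gives a monic quartic for m / t. *)
Lemma dvd_cuspidal (a b' c' d' s t r : int) :
  let b := t * b' + 3 * s * a in
  let c := t ^+ 2 * c' + 2 * t * s * b' + 3 * s ^+ 2 * a in
  let d := a * s ^+ 3 + b' * s ^+ 2 * t + c' * s * t ^+ 2 + d' * t ^+ 3 in
  b ^+ 2 - 4 * a * c = - 3 * r ^+ 2 -> a ^+ 2 * d = r ^+ 3 ->
  (t %| (3 * (s * a - r))%R)%Z.
Proof.
move=> b c d EG ED.
have G' := seminvG a b' c' s t; have D' := seminvD a b' c' d' s t.
rewrite -/b -/c EG in G'; rewrite -/b -/d ED in D'.
set h := b' ^+ 2 - 3 * a * c' in G' D'.
set J := 2 * b' ^+ 3 - 9 * a * b' * c' + 27 * a ^+ 2 * d' in D'.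
have : (t %| (b - 3 * r)%R)%Z.
  apply: (@dvd_monic_quartic _ _ (6 * h) (- 4 * J) (- 24 * h ^+ 2)).
  have Eh : 4 * (h * t ^+ 2) = b ^+ 2 - 9 * r ^+ 2 by lra.
  have EJ : 4 * (J * t ^+ 3) =
    108 * r ^+ 3 - 4 * b ^+ 3 + 3 * b * (4 * (h * t ^+ 2)) by lra.
  rewrite Eh in EJ.
  apply: (@mulfI _ 2) => //.
  transitivity (3 * (4 * (h * t ^+ 2)) * (b - 3 * r) ^+ 2
    - 2 * (4 * (J * t ^+ 3)) * (b - 3 * r) - 3 * (4 * (h * t ^+ 2)) ^+ 2);
    last by ring.
  by rewrite EJ Eh; ring.
have -> : 3 * (s * a - r) = (b - 3 * r) - t * b' by rewrite /b; ring.
by move=> H; rewrite rpredB // dvdz_mulr.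
Qed.

(** The quadratic form a S^2 + b S T + c T^2 has discriminant zero, so it is g (p S + q T)^2. The
    divisibilities of b - 3 s a by t and of c - 2 s b + 3 s^2 a by t^2 then restrict g. *)
Lemma dvd_double_root (a b' c' s t : int) :
  let b := t * b' + 3 * s * a in
  let c := t ^+ 2 * c' + 2 * t * s * b' + 3 * s ^+ 2 * a in
  a != 0 -> t != 0 -> coprimez s t -> b ^+ 2 = 4 * a * c ->
  exists g p q, [/\ a = g * p ^+ 2, b = 2 * g * p * q & (t %| (3 * g)%R)%Z].
Proof.
move=> b c a0 t0 cst E.
have /dvdzP[b1 Eb] : (2%R %| b)%Z.
  have : (2%R %| b ^+ 2)%Z by apply/dvdzP; exists (2 * a * c); rewrite E; ring.
  by rewrite !dvdzE abszX Euclid_dvdX // => /andP[].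
have Eb1 : b1 ^+ 2 = a * c by apply: (@mulfI _ 4) => //; move: E; rewrite Eb; lra.
have [g0 [q [p [g00 Eq Ep cqp]]]] := coprime_decomp b1 a0.
have Epc : p * c = g0 * q ^+ 2.
  by apply: (mulfI g00); move: Eb1; rewrite Eq Ep; lra.
have /dvdzP[g Eg] : (p %| g0)%Z.
  have c2 : coprimez p (q ^+ 2) by rewrite coprimezXr // coprimez_sym.
  by rewrite -(Gauss_dvdzl _ c2) -Epc dvdz_mulr.
have Ea : a = g * p ^+ 2 by rewrite Ep Eg; ring.
have Eb' : b = 2 * g * p * q by rewrite Eb Eq Eg; ring.
have Ec : c = g * q ^+ 2.
  have p_neq0 : p != 0 by apply: contraNneq a0 => p0; rewrite Ep p0 mulr0.
  by apply: (mulfI p_neq0); rewrite Epc Eg; ring.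
exists g, p, q; split=> //.
(* After removal of the common factor u of g and t, it remains to see that the cofactor D of t
   divides 3. It is coprime to p and s, and it will divide 3 s^2 p^2. *)
have [u [g' [D [u0 Eg' Et cgD]]]] := coprime_decomp g t0.
have cDg : coprimez D g' by rewrite coprimez_sym.
set M := q ^+ 2 - 4 * s * p * q + 3 * s ^+ 2 * p ^+ 2.
have DM : (D %| M)%Z.
  have : (D %| M * g')%Z.
    apply/dvdzP; exists (u * c' * D); apply: (mulfI u0).
    have : g * M = t ^+ 2 * c'.
      by transitivity (c - 2 * s * b + 3 * s ^+ 2 * a);
        [rewrite Ea Eb' Ec /M; ring|rewrite /c /b; ring].
    by rewrite Eg' Et; lra.
  by rewrite Gauss_dvdzl.
have DL : (D %| (p * (2 * q - 3 * s * p))%R)%Z.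
  have : (D %| (p * (2 * q - 3 * s * p) * g')%R)%Z.
    apply/dvdzP; exists b'; apply: (mulfI u0).
    have : g * p * (2 * q - 3 * s * p) = t * b'.
      by transitivity (b - 3 * s * a);
        [rewrite Ea Eb'; ring|rewrite /b; ring].
    by rewrite Eg' Et; lra.
  by rewrite Gauss_dvdzl.
have cDp : coprimez D p.
  rewrite /coprimez; set e := gcdz D p.
  have eD : (e %| D)%Z := dvdz_gcdl _ _; have ep : (e %| p)%Z := dvdz_gcdr _ _.
  have eq2 : (e %| q ^+ 2)%Z.
    have -> : q ^+ 2 = M + p * (4 * s * q - 3 * s ^+ 2 * p) by rewrite /M; ring.
    by rewrite rpredD ?dvdz_mulr // (dvdz_trans eD).
  have cpq : coprimez p (q ^+ 2) by rewrite coprimezXr // coprimez_sym.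
  have : (e %| gcdz p (q ^+ 2))%Z by rewrite dvdz_gcd ep eq2.
  rewrite (eqP cpq) dvdz1; have : 0 <= e by [].
  by move=> e0 /eqP h; apply/eqP; rewrite -(gez0_abs e0) h.
have cDs : coprimez D s.
  by move: cst; rewrite coprimez_sym Et coprimezMl => /andP[].
have D2 : (D %| (2 * q - 3 * s * p)%R)%Z by rewrite -(Gauss_dvdzr _ cDp).
have : (D %| (3 * (s ^+ 2 * p ^+ 2))%R)%Z.
  have -> : 3 * (s ^+ 2 * p ^+ 2) =
    (2 * q - 3 * s * p) * (2 * q - 5 * s * p) - 4 * M by rewrite /M; ring.
  by rewrite rpredB //; [exact: dvdz_mulr|exact: dvdz_mull].
rewrite Gauss_dvdzl; last by rewrite coprimezMr !coprimezXr.
by move=> D3; rewrite Et Eg' mulrCA dvdz_mul // dvdz_mulr.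
Qed.

(** * Minimal points *)

Definition nz (w : pt) : bool := [|| p0 w != 0, p1 w != 0 | p2 w != 0].

Definition negp (w : pt) : pt := Pt (- p0 w) (- p1 w) (- p2 w).

Section Err.
Variables (R : realType) (xi : R).

Definition d1 (x : pt) : R := (p1 x)%:~R - xi * (p0 x)%:~R.
Definition d2 (x : pt) : R := (p2 x)%:~R - xi ^+ 3 * (p0 x)%:~R.
Definition err (x : pt) : R := Num.max `|d1 x| `|d2 x|.

Lemma err_ge0 x : 0 <= err x.
Proof. by rewrite /err le_max normr_ge0. Qed.

Lemma d1_le x : `|d1 x| <= err x.
Proof. by rewrite /err le_max lexx. Qed.

Lemma d2_le x : `|d2 x| <= err x.
Proof. by rewrite /err le_max lexx orbT. Qed.

Lemma err_le x c : `|d1 x| <= c -> `|d2 x| <= c -> err x <= c.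
Proof. by move=> h1 h2; rewrite /err ge_max h1. Qed.

Lemma err_lt x c : `|d1 x| < c -> `|d2 x| < c -> err x < c.
Proof. by move=> h1 h2; rewrite /err gt_max h1. Qed.

Lemma d1_lin s x t y : d1 (lin s x t y) = s%:~R * d1 x + t%:~R * d1 y.
Proof. by rewrite /d1 /= !rmorphD !rmorphM /=; ring. Qed.

Lemma d2_lin s x t y : d2 (lin s x t y) = s%:~R * d2 x + t%:~R * d2 y.
Proof. by rewrite /d2 /= !rmorphD !rmorphM /=; ring. Qed.

Lemma err_opp w : err (negp w) = err w.
Proof.
by rewrite /err /d1 /d2 /= !rmorphN /= !mulrN -!opprD !normrN.
Qed.

Lemma err_p0_eq0 w : p0 w = 0 -> nz w -> 1 <= err w.
Proof.
rewrite /nz => w0; rewrite w0 eqxx /= => /orP[h|h].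
  apply: le_trans (d1_le w); rewrite /d1 w0 mulr0 subr0 -intr_norm ler1z.
  by rewrite -gtz0_ge1 normr_gt0.
apply: le_trans (d2_le w); rewrite /d2 w0 mulr0 subr0 -intr_norm ler1z.
by rewrite -gtz0_ge1 normr_gt0.
Qed.

Lemma near_int (r : R) : exists m : int, `|m%:~R - r| <= 1 / 2.
Proof.
exists (Num.floor (r + 1 / 2)).
have := floor_le (r + 1/2); have := floorD1_gt (r + 1/2).
rewrite intrD => h1 h2; rewrite ler_norml; apply/andP; split; lra.
Qed.

Lemma near_int_min (r : R) (m m' : int) :
  `|m%:~R - r| <= 1 / 2 -> `|m%:~R - r| <= `|m'%:~R - r|.
Proof.
move=> h; have [->//|ne] := eqVneq m' m.
have : 1 <= `|(m' - m)%:~R : R|.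
  by rewrite -intr_norm ler1z -gtz0_ge1 normr_gt0 subr_eq0.
have -> : (m' - m)%:~R = (m'%:~R - r) - (m%:~R - r) by rewrite rmorphB /=; ring.
move=> h'; have := ler_normB (m'%:~R - r) (m%:~R - r); lra.
Qed.

Lemma round_pt (n : int) : exists w, [/\ p0 w = n, err w <= 1 / 2 &
  forall w', p0 w' = n -> err w <= err w'].
Proof.
have [m1 h1] := near_int (xi * n%:~R); have [m2 h2] := near_int (xi ^+ 3 * n%:~R).
exists (Pt n m1 m2); split => //; first exact: err_le.
move=> w' w'n; apply: err_le; rewrite /d1 /d2 /=.
  apply: le_trans (d1_le w'); rewrite /d1 w'n; exact: near_int_min.
apply: le_trans (d2_le w'); rewrite /d2 w'n; exact: near_int_min.
Qed.

(** Pigeonhole: the pairs of fractional parts of q xi and q xi^3, for the M^2 + 1 values of q from 0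
    to M^2, fall into M^2 boxes of side 1 / M. *)
Lemma dirichlet (M : nat) : (0 < M)%N -> exists w,
  [/\ 0 < p0 w, p0 w <= (M ^ 2)%N & err w < M%:R^-1].
Proof.
move=> M0; pose fr (r : R) := r - (Num.floor r)%:~R.
have M0' : 0 < M%:R :> R by rewrite ltr0n.
have fr0 r : 0 <= fr r by have := floor_le r; rewrite /fr; lra.
have fr1 r : fr r < 1.
  by have := floorD1_gt r; rewrite /fr intrD; lra.
have bP r : (`|Num.floor (M%:R * fr r)| < M)%N.
  have f0 : 0 <= Num.floor (M%:R * fr r) by rewrite floor_ge0 mulr_ge0 // ltW.
  have : Num.floor (M%:R * fr r) < M%:Z.
    by rewrite floor_lt_int -[ltRHS]mulr1 ltr_pM2l.
  by lia.
pose b r := Ordinal (bP r).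
have bE r r' : b r = b r' -> `|fr r - fr r'| < M%:R^-1.
  move=> /(congr1 val) /= E.
  have f0 s : 0 <= Num.floor (M%:R * fr s).
    by rewrite floor_ge0 mulr_ge0 // ltW.
  have {}E : Num.floor (M%:R * fr r) = Num.floor (M%:R * fr r').
    by have := f0 r; have := f0 r'; lia.
  have h1 := floor_le (M%:R * fr r); have h2 := floorD1_gt (M%:R * fr r).
  have h3 := floor_le (M%:R * fr r'); have h4 := floorD1_gt (M%:R * fr r').
  rewrite -E !intrD in h1 h2 h3 h4.
  rewrite -(ltr_pM2l M0') mulfV ?gt_eqF // -[X in X * `|_|]gtr0_norm // -normrM.
  rewrite mulrBr ltr_norml; apply/andP; split; lra.
pose f (q : 'I_(M ^ 2).+1) := (b (xi * q%:R), b (xi ^+ 3 * q%:R)).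
have /injectivePn[q [q' qq' Ef]] : ~~ injectiveb f.
  apply/negP => /injectiveP /leq_card.
  by rewrite card_prod !card_ord -mulnn ltnn.
wlog lt_q : q q' qq' Ef / (q' < q)%N.
  move=> wl; have [|] := ltnP q' q; first exact: wl.
  rewrite leq_eqVlt => /orP[/eqP/val_inj E|]; first by rewrite E eqxx in qq'.
  by move=> lt; apply: (wl q' q); rewrite // eq_sym.
have [E1 E2] : b (xi * q%:R) = b (xi * q'%:R) /\
  b (xi ^+ 3 * q%:R) = b (xi ^+ 3 * q'%:R) by split; case: Ef => ? ?; apply/val_inj.
exists (Pt (q%:Z - q'%:Z) (Num.floor (xi * q%:R) - Num.floor (xi * q'%:R))
  (Num.floor (xi ^+ 3 * q%:R) - Num.floor (xi ^+ 3 * q'%:R))); split => /=.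
- by rewrite subr_gt0 ltz_nat.
- by have := ltn_ord q; lia.
- have q1 := bE _ _ E1; have q2 := bE _ _ E2; rewrite /fr in q1 q2.
  apply: err_lt; rewrite /d1 /d2 /= !rmorphB /= -!pmulrn.
    by rewrite distrC -[X in _ < X]/(_) ; congr (`|_| < _) : q1; ring.
  by rewrite distrC; congr (`|_| < _) : q2; ring.
Qed.
End Err.

(** * Existence and growth of the minimal points *)

Section Best.
Variables (R : realType) (xi : R).
Hypothesis irr : forall n0 n1 n2 : int,
  n0%:~R + n1%:~R * xi + n2%:~R * xi ^+ 3 = 0 -> [/\ n0 = 0, n1 = 0 & n2 = 0].
Local Notation err := (err xi).
Local Notation d1 := (d1 xi).
Local Notation d2 := (d2 xi).

Lemma err_gt0 x : nz x -> 0 < err x.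
Proof.
move=> nx; rewrite lt0r err_ge0 andbT; apply: contraTneq nx => e0.
have : d1 x = 0 by apply/eqP; rewrite -normr_le0 -e0 d1_le.
rewrite /d1 => h1; have [|q1 q2 _] := @irr (p1 x) (- p0 x) 0.
  by rewrite rmorphN /=; lra.
have : d2 x = 0 by apply/eqP; rewrite -normr_le0 -e0 d2_le.
move/eqP: q2; rewrite oppr_eq0 /d2 => /eqP q2; rewrite q2 mulr0 subr0 => /eqP.
by rewrite intr_eq0 => /eqP q3; rewrite /nz q1 q2 q3 eqxx.
Qed.

Definition best (x : pt) := 0 < p0 x /\
  forall w, nz w -> `|p0 w| <= p0 x -> err x <= err w.

Definition next_best (x z : pt) := [/\ p0 x < p0 z, err z < err x &
  forall w, nz w -> `|p0 w| < p0 z -> err x <= err w].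

Lemma nz_p0 w : 0 < p0 w -> nz w.
Proof. by move=> h; rewrite /nz gt_eqF. Qed.

Lemma best_half x : best x -> err x <= 1 / 2.
Proof.
move=> [x0 xb]; have [w [wn wh _]] := round_pt xi (p0 x).
apply: le_trans wh; apply: xb; first by rewrite nz_p0 ?wn.
by rewrite wn gtr0_norm.
Qed.

Lemma best_first : exists x, best x.
Proof.
have [w [wn wh wm]] := round_pt xi 1; exists w; split; first by rewrite wn.
move=> w' nw'; rewrite wn => w'1.
have [w'0|w'0] := eqVneq (p0 w') 0.
  by apply: le_trans (err_p0_eq0 xi w'0 nw'); lra.
have [w'p|w'n] := ltP 0 (p0 w'); first by refine (wm _ _); lia.
by rewrite -(err_opp xi w'); refine (wm _ _) => /=; lia.
Qed.

(** The next point is the rounding at the least first coordinate where some point beats [x];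
    [dirichlet] shows that such a coordinate exists. *)
Lemma best_next x : best x -> exists z, best z /\ next_best x z.
Proof.
move=> bx; have [x0 xb] := bx; have xh := best_half bx.
have ex0 : 0 < err x by rewrite err_gt0 // nz_p0.
pose P n := `[< exists2 w, p0 w = n%:Z /\ 0 < p0 w & err w < err x >].
have exP : exists n, P n.
  have [w [w0 _ we]] := @dirichlet R xi (Num.truncn (err x)^-1).+1 isT.
  exists `|p0 w|%N; apply/asboolP; exists w; first by split=> //; lia.
  apply: lt_trans we _; rewrite invf_plt ?posrE ?ltr0n //.
  exact: truncnS_gt.
case: (ex_minnP exP) => n /asboolP[w [wn w0] we] nmin.
have [z [zn zh zm]] := round_pt xi n%:Z.
have ze : err z < err x by apply: le_lt_trans (zm _ wn) we.
have z0 : 0 < p0 z by rewrite zn -wn.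
have zx w' : nz w' -> `|p0 w'| < p0 z -> err x <= err w'.
  move=> nw' lt; rewrite leNgt; apply/negP => lt'.
  have [w'0|w'0] := eqVneq (p0 w') 0.
    by have := err_p0_eq0 xi w'0 nw'; lra.
  have : P `|p0 w'|%N.
    apply/asboolP; have [w'p|w'n] := ltP 0 (p0 w').
      by exists w' => //; split=> //; lia.
    by exists (negp w'); [split => /=; lia|rewrite err_opp].
  by move/nmin; move: lt; rewrite zn; lia.
have xz : p0 x < p0 z.
  rewrite ltNge; apply/negP => le; have := xb z (nz_p0 z0).
  by rewrite gtr0_norm // => /(_ le); rewrite leNgt ze.
exists z; split; last by split.
split=> // w' nw'; rewrite le_eqVlt => /orP[/eqP E|lt]; last first.
  by apply: le_trans (ltW ze) _; apply: zx.
have [w'p|w'n] := ltP 0 (p0 w'); first by refine (zm _ _); lia.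
by rewrite -(err_opp xi w'); refine (zm _ _) => /=; lia.
Qed.

(** [dirichlet] with M just above 1 / L yields a point better than [x] with first coordinate at most
    M^2, and M is at most 2 / L because L is at most 1/2. *)
Lemma best_dirichlet x z : best x -> next_best x z ->
  (p0 z)%:~R * err x ^+ 2 <= 4.
Proof.
move=> bx [xz zx zm]; have xh := best_half bx.
have ex0 : 0 < err x by case: bx => x0 _; rewrite err_gt0 // nz_p0.
set M := (Num.truncn (err x)^-1).+1.
have [w [w0 wM we]] := @dirichlet R xi M isT.
have zM : p0 z <= (M ^ 2)%N.
  apply: le_trans wM; rewrite leNgt; apply/negP => lt.
  have := zm w (nz_p0 w0); rewrite gtr0_norm // => /(_ lt); apply/negP.
  rewrite -ltNge; apply: lt_trans we _; rewrite invf_plt ?posrE ?ltr0n //.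
  exact: truncnS_gt.
have M2 : M%:R <= 2 / err x.
  have : (Num.truncn (err x)^-1)%:R <= (err x)^-1 by rewrite truncn_le invr_ge0 ltW.
  have : 1 <= (err x)^-1 by rewrite invf_ge1 //; lra.
  by rewrite /M -natr1; lra.
have zM' : (p0 z)%:~R <= M%:R ^+ 2 :> R.
  by rewrite -natrX -[(M ^ 2)%:R]/(((M ^ 2)%N : int)%:~R) ler_int.
have : (p0 z)%:~R <= (2 / err x) ^+ 2.
  by apply: le_trans zM' _; rewrite lerXn2r // nnegrE // divr_ge0 // ltW.
rewrite expr_div_n ler_pdivlMr ?exprn_gt0 //; lra.
Qed.

Lemma best_sequence : exists X : nat -> pt,
  (forall i, best (X i)) /\ (forall i, next_best (X i) (X i.+1)).
Proof.
have [x bx] := best_first.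
pose f (s : {x | best x}) : {x | best x} :=
  let e := cid (best_next (svalP s)) in exist _ (sval e) (svalP e).1.
exists (fun i => sval (iter i f (exist _ x bx))); split => i; first exact: svalP.
rewrite iterS; set s := iter i f _.
exact: (svalP (cid (best_next (svalP s)))).2.
Qed.
End Best.

Definition det3 (x y v : pt) : int :=
  p0 x * (p1 y * p2 v - p2 y * p1 v) - p1 x * (p0 y * p2 v - p2 y * p0 v)
  + p2 x * (p0 y * p1 v - p1 y * p0 v).

Section NormBounds.
Variable R : numDomainType.
Implicit Types a b A B : R.

Lemma norm_mul_le a b A B : `|a| <= A -> `|b| <= B -> `|a * b| <= A * B.
Proof. by move=> h1 h2; rewrite normrM ler_pM. Qed.

Lemma norm_add_le a b A B : `|a| <= A -> `|b| <= B -> `|a + b| <= A + B.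
Proof. by move=> h1 h2; apply: le_trans (ler_normD _ _) _; rewrite lerD. Qed.

Lemma norm_sub_le a b A B : `|a| <= A -> `|b| <= B -> `|a - b| <= A + B.
Proof. by move=> h1 h2; apply: le_trans (ler_normB _ _) _; rewrite lerD. Qed.

Lemma norm_nat_le (n : nat) : `|n%:R : R| <= n%:R.
Proof. by rewrite normr_nat. Qed.
End NormBounds.

(** * Size of the cubic form and its partial discriminant *)

Section Estimates.
Variables (R : realType) (xi : R) (x y : pt).
Local Notation L := (err xi x).
Local Notation L' := (err xi y).
Local Notation X := ((p0 x)%:~R : R).
Local Notation Y := ((p0 y)%:~R : R).
Let K : R := (1 + `|xi|) ^+ 2.
Hypotheses (X1 : 1 <= X) (XY : X <= Y) (L1 : L <= 1) (LL : L' <= L).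

Let K1 : 1 <= K.
Proof. by rewrite /K; have := normr_ge0 xi; nra. Qed.
Let xiK : `|xi| <= K.
Proof. by rewrite /K; have := normr_ge0 xi; nra. Qed.
Let xi2K : `|xi ^+ 2| <= K.
Proof. by rewrite normrX /K; have := normr_ge0 xi; nra. Qed.
Let L0 : 0 <= L. Proof. exact: err_ge0. Qed.
Let L'0 : 0 <= L'. Proof. exact: err_ge0. Qed.
Let X0 : 0 <= X. Proof. exact: le_trans ler01 X1. Qed.
Let Y0 : 0 <= Y. Proof. exact: le_trans X0 XY. Qed.
Let hX : `|X| <= X. Proof. by rewrite ger0_norm. Qed.
Let hY : `|Y| <= Y. Proof. by rewrite ger0_norm. Qed.
Let hd := d1_le xi x.
Let he := d1_le xi y.
Let hd1 : `|d1 xi x| <= 1. Proof. exact: le_trans hd L1. Qed.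
Let he1 : `|d1 xi y| <= 1. Proof. by apply: le_trans he (le_trans LL L1). Qed.
Let hdX : `|d1 xi x| <= X. Proof. exact: le_trans hd1 X1. Qed.
Let h1 : `|1 : R| <= K. Proof. by rewrite normr1. Qed.

(** X^2 times this quantity is the linear term of [cub x] in the errors of [x], the gradient at (1,
    xi, xi^3) being (2 xi^3, -3 xi^2, 1). *)
Local Notation D := (d2 xi x - 3 * (xi ^+ 2 * d1 xi x)).
Local Notation E := (d2 xi y - 3 * (xi ^+ 2 * d1 xi y)).

Let hD : `|D| <= 4 * (K * L).
Proof.
have := norm_sub_le (norm_mul_le h1 (d2_le xi x)) (norm_mul_le (norm_nat_le R 3) (norm_mul_le xi2K hd)).
by rewrite mul1r; lra.
Qed.

Let hE : `|E| <= 4 * (K * L').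
Proof.
have := norm_sub_le (norm_mul_le h1 (d2_le xi y)) (norm_mul_le (norm_nat_le R 3) (norm_mul_le xi2K he)).
by rewrite mul1r; lra.
Qed.

Lemma cub_bound : `|(cub x)%:~R : R| <= 8 * K * (X ^+ 2 * L).
Proof.
have -> : (cub x)%:~R = X * (X * D) - (3 * (xi * (X * (d1 xi x * d1 xi x)))
  + 1 * (d1 xi x * (d1 xi x * d1 xi x))) :> R.
  by rewrite /cub /d1 /d2 !(rmorphB, rmorphM, rmorphXn) /=; ring.
have := norm_sub_le (norm_mul_le hX (norm_mul_le hX hD)) (norm_add_le (norm_mul_le (norm_nat_le R 3) (norm_mul_le xiK (norm_mul_le hX (norm_mul_le hd hdX))))
  (norm_mul_le h1 (norm_mul_le hd (norm_mul_le hdX hdX)))).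
lra.
Qed.

(** The coefficients (b, - 2 a) are the zero of the derivative 2 a S + b T of a S^2 + b S T + c T^2.
    With this choice the main terms 2 X^2 Y D cancel in the first coordinate. *)
Definition wpt : pt := lin (pol x y) x (- 2 * cub x) y.

Lemma wpt_p0 : `|(p0 wpt)%:~R : R| <= 13 * K * (X ^+ 3 * L' + X * Y * L ^+ 2).
Proof.
have -> : (p0 wpt)%:~R = X * (X * (X * E)) - 6 * (xi * (X * (X * (d1 xi x * d1 xi y))))
  - 3 * (1 * (X * (d1 xi x * (d1 xi x * d1 xi y))))
  + 3 * (xi * (X * (Y * (d1 xi x * d1 xi x))))
  + 2 * (1 * (Y * (d1 xi x * (d1 xi x * d1 xi x)))) :> R.
  rewrite /wpt /lin /pol /cub /d1 /d2 /= !(rmorphD, rmorphB, rmorphM, rmorphXn, rmorphN) /=.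
  ring.
have := norm_add_le (norm_add_le (norm_sub_le (norm_sub_le (norm_mul_le hX (norm_mul_le hX (norm_mul_le hX hE)))
  (norm_mul_le (norm_nat_le R 6) (norm_mul_le xiK (norm_mul_le hX (norm_mul_le hX (norm_mul_le hdX he))))))
  (norm_mul_le (norm_nat_le R 3) (norm_mul_le h1 (norm_mul_le hX (norm_mul_le hdX (norm_mul_le hdX he))))))
  (norm_mul_le (norm_nat_le R 3) (norm_mul_le xiK (norm_mul_le hX (norm_mul_le hY (norm_mul_le hd hd))))))
  (norm_mul_le (norm_nat_le R 2) (norm_mul_le h1 (norm_mul_le hY (norm_mul_le hdX (norm_mul_le hd hd))))).
have : 0 <= K * (X * Y * L ^+ 2).
  by rewrite !mulr_ge0 // ?exprn_ge0 // (le_trans ler01 K1).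
lra.
Qed.

Lemma wpt_err : err xi wpt <=
  `|(pol x y)%:~R : R| * L + 2 * `|(cub x)%:~R : R| * L'.
Proof.
have h i j : `|i| <= L -> `|j| <= L' -> `|(pol x y)%:~R * i + (- 2 * cub x)%:~R * j| <=
  `|(pol x y)%:~R : R| * L + 2 * `|(cub x)%:~R : R| * L'.
  move=> hi hj; apply: norm_add_le; apply: norm_mul_le => //.
  by rewrite rmorphM /= normrM rmorphN normrN normr_nat.
apply: err_le; rewrite /wpt ?d1_lin ?d2_lin; apply: h; rewrite ?d1_le ?d2_le //.
Qed.

(** [pol x y] is [b0 + b1], where [b0] involves the errors of [x] only; [c1] is the part of
    [pol y x] involving the errors of [y], the rest being Y^2 D. *)
Let b0 : R := 2 * (X * (Y * D)) - 3 * (xi * (Y * (d1 xi x * d1 xi x))).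
Let b1 : R := X * (X * E) - 6 * (xi * (X * (d1 xi x * d1 xi y)))
  - 3 * (1 * (d1 xi x * (d1 xi x * d1 xi y))).
Let c1 : R := 2 * (X * (Y * E)) - 6 * (xi * (Y * (d1 xi x * d1 xi y)))
  - 3 * (xi * (X * (d1 xi y * d1 xi y))) - 3 * (1 * (d1 xi x * (d1 xi y * d1 xi y))).

Let b0_le : `|b0| <= 11 * K * (X * Y * L).
Proof.
have := norm_sub_le (norm_mul_le (norm_nat_le R 2) (norm_mul_le hX (norm_mul_le hY hD)))
  (norm_mul_le (norm_nat_le R 3) (norm_mul_le xiK (norm_mul_le hY (norm_mul_le hd hdX)))).
by rewrite -/b0; lra.
Qed.

Let b1_le : `|b1| <= 13 * K * (X ^+ 2 * L').
Proof.
have := norm_sub_le (norm_sub_le (norm_mul_le hX (norm_mul_le hX hE)) (norm_mul_le (norm_nat_le R 6) (norm_mul_le xiK (norm_mul_le hX (norm_mul_le hdX he)))))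
  (norm_mul_le (norm_nat_le R 3) (norm_mul_le h1 (norm_mul_le hdX (norm_mul_le hdX he)))).
by rewrite -/b1; lra.
Qed.

Let c1_le : `|c1| <= 20 * K * (X * Y * L').
Proof.
have hey : `|d1 xi y| <= Y by exact: le_trans he1 (le_trans X1 XY).
have := norm_sub_le (norm_sub_le (norm_sub_le (norm_mul_le (norm_nat_le R 2) (norm_mul_le hX (norm_mul_le hY hE)))
    (norm_mul_le (norm_nat_le R 6) (norm_mul_le xiK (norm_mul_le hY (norm_mul_le hdX he)))))
    (norm_mul_le (norm_nat_le R 3) (norm_mul_le xiK (norm_mul_le hX (norm_mul_le hey he)))))
  (norm_mul_le (norm_nat_le R 3) (norm_mul_le h1 (norm_mul_le hdX (norm_mul_le hey he)))).
by rewrite -/c1; lra.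
Qed.

(** In b0^2 - 4 a Y^2 D the terms 4 X^2 Y^2 D^2 and 12 xi X Y^2 D d1^2 cancel, leaving Y^2 d1^3 (9
    xi^2 d1 + 4 D), of order Y^2 L^4. The other terms contain the smaller error L'. *)
Lemma disc_bound : `|(pol x y ^+ 2 - 4 * cub x * pol y x)%:~R : R| <=
  1000 * K ^+ 2 * (Y ^+ 2 * L ^+ 4 + X ^+ 3 * Y * (L * L') + X ^+ 4 * L' ^+ 2).
Proof.
have -> : (pol x y ^+ 2 - 4 * cub x * pol y x)%:~R =
  Y * (Y * (d1 xi x * (d1 xi x * (d1 xi x * (9 * (xi ^+ 2 * d1 xi x) + 4 * D)))))
  + 2 * (b0 * b1) + b1 * b1 - 4 * ((cub x)%:~R * c1) :> R.
  rewrite /b0 /b1 /c1 /pol /cub /d1 /d2 !(rmorphD, rmorphB, rmorphM, rmorphXn, rmorphN) /=.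
  ring.
have := norm_sub_le (norm_add_le (norm_add_le (norm_mul_le hY (norm_mul_le hY (norm_mul_le hd (norm_mul_le hd (norm_mul_le hd
    (norm_add_le (norm_mul_le (norm_nat_le R 9) (norm_mul_le xi2K hd)) (norm_mul_le (norm_nat_le R 4) hD)))))))
    (norm_mul_le (norm_nat_le R 2) (norm_mul_le b0_le b1_le))) (norm_mul_le b1_le b1_le))
  (norm_mul_le (norm_nat_le R 4) (norm_mul_le cub_bound c1_le)).
have K0 : 0 <= K := le_trans ler01 K1.
have KK : K <= K ^+ 2 by rewrite expr2 ler_peMl.
have q0 : 0 <= Y ^+ 2 * L ^+ 4 by rewrite mulr_ge0 ?exprn_ge0.
have q1 : 0 <= K ^+ 2 * (X ^+ 3 * Y * (L * L')).
  by rewrite !mulr_ge0 // ?exprn_ge0 // mulr_ge0.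
have q2 : 0 <= K ^+ 2 * (X ^+ 4 * L' ^+ 2).
  by rewrite !mulr_ge0 // ?exprn_ge0 // mulr_ge0.
have q3 := ler_wpM2r q0 KK.
have q4 : 0 <= K ^+ 2 * (Y ^+ 2 * L ^+ 4).
  by rewrite !mulr_ge0 // ?exprn_ge0 // mulr_ge0.
lra.
Qed.
End Estimates.

Lemma det3_bound (R : realType) (xi : R) (x y v : pt) :
  `|(det3 x y v)%:~R : R| <= 2 * (`|(p0 v)%:~R| * (err xi x * err xi y)
   + `|(p0 y)%:~R| * (err xi x * err xi v) + `|(p0 x)%:~R| * (err xi y * err xi v)).
Proof.
have -> : (det3 x y v)%:~R =
  (p0 x)%:~R * (d1 xi y * d2 xi v - d2 xi y * d1 xi v)
  + (p0 v)%:~R * (d1 xi x * d2 xi y - d2 xi x * d1 xi y)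
  - (p0 y)%:~R * (d1 xi x * d2 xi v - d2 xi x * d1 xi v) :> R.
  rewrite /det3 /d1 /d2 !(rmorphD, rmorphB, rmorphM) /=; ring.
have m u u' : `|d1 xi u * d2 xi u' - d2 xi u * d1 xi u'|
  <= err xi u * err xi u' + err xi u * err xi u'.
  by apply: norm_sub_le; apply: norm_mul_le; rewrite ?d1_le ?d2_le.
have := norm_sub_le (norm_add_le (norm_mul_le (lexx `|(p0 x)%:~R|) (m y v)) (norm_mul_le (lexx `|(p0 v)%:~R|) (m x y)))
  (norm_mul_le (lexx `|(p0 y)%:~R|) (m x v)).
lra.
Qed.

(** * Inequalities between logarithms *)

Section Logs.
Variable R : realFieldType.
Implicit Types C A lB k Y tau al de be ga : R.

(* For the minimal points x_i, x_(i+1) and the last minimal point x_j in the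
   plane they span: A = log X_i, lB = log X_(i+1), k = - log L_i, Y = log X_j,
   lB' = log X_(j+1), k' = - log L_j, and tau = log |t| where t is the
   coordinate of x_j on x_(i+1); C absorbs all constants.  Below, al, de, be and
   ga are the logarithms of |cub x_i|, |cub x_j|, |b| and |G|. *)
Record base C A lB k Y (lB' k' : R) tau : Prop := Base {
  base_tau : Y - lB - C <= tau;
  base_det : Y <= (lB - k) + (lB' - k') + C;
  base_p : lB <= 1421 / 1000 * k;
  base_p' : lB' <= 1421 / 1000 * k';
  base_AB : A <= lB;
  base_BY : lB <= Y;
  base_YB : Y <= lB';
  base_low : 703 / 1000 * A - C <= lB - k;
  base_C : 1 <= C;
  base_big : 100 * (100 * C) <= A }.

Lemma base_sqrX_errY C A lB k Y (lB' k' : R) tau : base C A lB k Y lB' k' tau ->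
  2 * A - k' <= Y - 2 * k.
Proof. by case=> *; lra. Qed.

Lemma base_mixed_terms C A lB k Y (lB' k' : R) tau : base C A lB k Y lB' k' tau ->
  3 * A + Y - k - k' <= - 10 * C /\ 4 * A - 2 * k' <= - 10 * C.
Proof. by case=> *; split; lra. Qed.

Lemma base_X_sqr_err C A lB k Y (lB' k' : R) tau : base C A lB k Y lB' k' tau ->
  10 * C + A <= 2 * k /\ 2 * A + C <= lB.
Proof. by case=> *; split; lra. Qed.

(* The double-root alternative confines k / A to at most 1.727. *)
Lemma next_not_double_root C A lB k Y (lB' k' : R) tau : base C A lB k Y lB' k' tau ->
  2 * k - 10 * C <= Y -> Y + lB' - 2 * k' < - 10 * C.
Proof. by case=> *; lra. Qed.

(** As lB - k is at most 0.421 k, hence about 0.2105 Y, [base_det] leaves 0.7895 Y for lB' - k',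
    itself at most 0.421 k'. Constants are absorbed through [base_big]. *)
Lemma next_ratio_ge187 C A lB k Y (lB' k' : R) tau : base C A lB k Y lB' k' tau ->
  2 * k - 10 * C <= Y -> 187 / 100 * Y <= k'.
Proof. by case=> *; lra. Qed.

(** Up to constants, the second condition bounds k' by 1.728 Y, so that [base_det] forces k to be at
    least 0.648 Y. The first, with [base_low], gives 1.559 k <= Y, and 1.559 * 0.648 exceeds 1. *)
Lemma no_two_double_roots C A lB k Y (lB' k' : R) tau : base C A lB k Y lB' k' tau ->
  5 * k - 2 * lB - A - 10 * C <= Y -> - 10 * C <= Y + lB' - 2 * k' -> False.
Proof. by case=> *; lra. Qed.

Lemma next_ratio_ge193 C A lB k Y (lB' k' : R) tau : base C A lB k Y lB' k' tau ->
  228 / 100 * k <= Y -> 193 / 100 * Y <= k'.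
Proof. by case=> *; lra. Qed.

Section F.
Variables C A lB k Y lB' k' tau al de : R.
Hypothesis b : base C A lB k Y lB' k' tau.
Hypotheses (al_le : al <= 2 * A - k + C) (de_le : de <= 2 * Y - k' + C).
Hypothesis F : 2 * k - 10 * C <= Y.
Hypothesis k_ge1 : 187 / 100 * A <= k.

(** Since log |t| is at least about Y - lB, this makes X_i X_j L_i^2 negligible against |t|. *)
Lemma base_cusp_small : A + lB - 2 * k <= - 10 * C.
Proof. have h1 := al_le; have h2 := de_le; have h3 := F; have h4 := k_ge1.
by case: b => *; lra. Qed.

Lemma base_disc_part_small : 2 * al + de + 10 * C <= tau.
Proof. have h1 := al_le; have h2 := de_le; have h3 := F; have h4 := k_ge1.
by case: b => *; lra. Qed.

Variable ga : R.
Hypothesis ga_le : ga <= 2 * Y - 4 * k + C.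

(** Inserting the bounds for tau and ga gives 12 k - 2 lB <= 4 Y up to constants, and lB is at most
    1.421 k. *)
Lemma base_order2 : 2 * tau <= 3 * ga + 10 * C -> 228 / 100 * k <= Y.
Proof. have h1 := al_le; have h2 := de_le; have h3 := F; have h4 := k_ge1; have h5 := ga_le.
by case: b => *; lra. Qed.

Hypothesis k_ge2 : 193 / 100 * A <= k.
Hypothesis F2 : 228 / 100 * k <= Y.
Variable be : R.
Hypothesis be_le : be <= al + Y - A + C.

Lemma base_order3 : be + ga + (2 * al + de) + 10 * C <= 3 * tau.
Proof. have h1 := al_le; have h2 := de_le; have h3 := F; have h4 := k_ge1; have h5 := ga_le; have h6 := k_ge2; have h7 := F2; have h8 := be_le.
by case: b => *; lra. Qed.

Hypothesis F_ga : tau <= ga + 10 * C.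

Lemma base_order6_small : be + (2 * al + de) + 40 * C <= 2 * tau.
Proof. have h1 := al_le; have h2 := de_le; have h3 := F; have h4 := k_ge1; have h5 := ga_le; have h6 := k_ge2; have h7 := F2; have h8 := be_le; have h9 := F_ga.
by case: b => *; lra. Qed.

(** The main inequality between consecutive states: 6 (Y - lB) <= (A - k + Y) + 4 (2 Y - 4 k) up to
    constants. *)
Lemma base_order6 : 6 * tau <= be + 4 * ga + 10 * C ->
  17 * k - 6 * lB - A - 30 * C <= 3 * Y.
Proof. have h1 := al_le; have h2 := de_le; have h3 := F; have h4 := k_ge1; have h5 := ga_le; have h6 := k_ge2; have h7 := F2; have h8 := be_le; have h9 := F_ga.
by case: b => *; lra. Qed.
End F.
End Logs.

(** * Lattices spanned by consecutive minimal points *)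

Lemma pt_eq (x y : pt) : p0 x = p0 y -> p1 x = p1 y -> p2 x = p2 y -> x = y.
Proof. by case: x y => [? ? ?] [? ? ?] /= -> -> ->. Qed.

Lemma nzPn w : ~~ nz w -> [/\ p0 w = 0, p1 w = 0 & p2 w = 0].
Proof. by rewrite /nz !negb_or !negbK => /and3P[/eqP ? /eqP ? /eqP ?]. Qed.

Section Lattice.
Variables (R : realType) (xi : R).
Local Notation err := (err xi).
Local Notation d1 := (d1 xi).
Local Notation d2 := (d2 xi).
Local Notation best := (best xi).
Local Notation next_best := (next_best xi).

Lemma err_scale (x y : pt) (r : R) : (p0 y)%:~R = r * (p0 x)%:~R ->
  (p1 y)%:~R = r * (p1 x)%:~R -> (p2 y)%:~R = r * (p2 x)%:~R ->
  err y = `|r| * err x.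
Proof.
move=> e0 e1 e2; rewrite /err maxr_pMr // -!normrM.
have -> : d1 y = r * d1 x by rewrite /d1 e0 e1; ring.
by have -> : d2 y = r * d2 x by rewrite /d2 e0 e2; ring.
Qed.

(** Otherwise [z] is a multiple of [x] by a factor above 1, and its error is not smaller. *)
Lemma next_minor (x z : pt) : best x -> next_best x z ->
  (p0 x * p1 z - p1 x * p0 z != 0) || (p0 x * p2 z - p2 x * p0 z != 0).
Proof.
move=> [x0 xb] [xz zx zm]; apply/negPn; rewrite negb_or !negbK.
apply/negP => /andP[/eqP n2 /eqP n1].
have x0' : (p0 x)%:~R != 0 :> R by rewrite intr_eq0 gt_eqF.
have E : err z = `|(p0 z)%:~R / (p0 x)%:~R| * err x.
  apply: err_scale; first by rewrite divfK.
    apply: (mulIf x0'); rewrite mulrAC divfK //.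
    by rewrite -!rmorphM /=; congr (_%:~R); lia.
  apply: (mulIf x0'); rewrite mulrAC divfK //.
  by rewrite -!rmorphM /=; congr (_%:~R); lia.
have : err x <= err z.
  rewrite E ler_peMl ?err_ge0 // ger0_norm ?divr_ge0 ?ler0z; try by lia.
  by rewrite ler_pdivlMr ?ltr0z // mul1r ler_int ltW.
by rewrite leNgt zx.
Qed.

(** Subtracting the nearest integral combination of [x] and [z] leaves a point with first coordinate
    at most (X + B) / 2 < B and error at most the mean of the errors of [x] and [z]. By the choice
    of [z] it vanishes. *)
Lemma lattice_round (x z w : pt) (a b : R) : best x -> next_best x z ->
  (p0 w)%:~R = a * (p0 x)%:~R + b * (p0 z)%:~R ->
  (p1 w)%:~R = a * (p1 x)%:~R + b * (p1 z)%:~R ->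
  (p2 w)%:~R = a * (p2 x)%:~R + b * (p2 z)%:~R ->
  exists s t, w = lin s x t z.
Proof.
move=> [x0 xb] [xz zx zm] e0 e1 e2.
have [s hs] := near_int a; have [t ht] := near_int b.
exists s, t; pose v := lin 1 w (-1) (lin s x t z).
have xz' : (p0 x)%:~R < (p0 z)%:~R :> R by rewrite ltr_int.
have x0' : 0 < (p0 x)%:~R :> R by rewrite ltr0z.
have key (f : pt -> R) c c' : `|f x| <= c -> `|f z| <= c' ->
    f v = (a - s%:~R) * f x + (b - t%:~R) * f z -> `|f v| <= (c + c') / 2.
  move=> h h' ->; rewrite distrC in hs; rewrite distrC in ht.
  have := norm_add_le (norm_mul_le hs h) (norm_mul_le ht h'); lra.
have v0 : `|p0 v| < p0 z.
  rewrite -(ltr_int R) intr_norm.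
  have nx : `|(p0 x)%:~R : R| <= (p0 x)%:~R by rewrite gtr0_norm.
  have nz' : `|(p0 z)%:~R : R| <= (p0 z)%:~R.
    by rewrite gtr0_norm // (lt_trans x0').
  have := key (fun u => (p0 u)%:~R) _ _ nx nz'.
  rewrite /v /= !(rmorphD, rmorphM, rmorphN) /= e0 => h.
  apply: le_lt_trans (h _) _; last by lra.
  by ring.
have ve : err v < err x.
  apply: (@le_lt_trans _ _ ((err x + err z) / 2)); last by lra.
  apply: err_le.
    apply: key; rewrite ?d1_le // /v !d1_lin !(rmorph1, rmorphN) /d1 e0 e1.
    ring.
  apply: key; rewrite ?d2_le // /v !d2_lin !(rmorph1, rmorphN) /d2 e0 e2.
  ring.
have [nv|/nzPn[q0 q1 q2]] := boolP (nz v).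
  by have := zm v nv v0; rewrite leNgt ve.
move: q0 q1 q2; rewrite /v /= => q0 q1 q2.
by apply: pt_eq => /=; lia.
Qed.

Lemma lattice_basis (x z w : pt) : best x -> next_best x z ->
  det3 x z w = 0 -> exists s t, w = lin s x t z.
Proof.
have comb (N A B u v : R) : N != 0 -> (A / N * u + B / N * v) * N = A * u + B * v.
  by move=> N0; field.
move=> bx bz dw; have := next_minor bx bz.
have dw' : (det3 x z w)%:~R = 0 :> R by rewrite dw.
move: dw'; rewrite /det3 !(rmorphD, rmorphB, rmorphM) /= => dw'.
case/orP => n; rewrite -(intr_eq0 R) !(rmorphB, rmorphM) /= in n.
  set N := (X in X != 0) in n.
  apply: (lattice_round (a := ((p0 w)%:~R * (p1 z)%:~R - (p1 w)%:~R * (p0 z)%:~R) / N)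
    (b := ((p0 x)%:~R * (p1 w)%:~R - (p1 x)%:~R * (p0 w)%:~R) / N) bx bz);
    apply: (mulIf n); rewrite comb // /N; lra.
set N := (X in X != 0) in n.
apply: (lattice_round (a := ((p0 w)%:~R * (p2 z)%:~R - (p2 w)%:~R * (p0 z)%:~R) / N)
  (b := ((p0 x)%:~R * (p2 w)%:~R - (p2 x)%:~R * (p0 w)%:~R) / N) bx bz);
  apply: (mulIf n); rewrite comb // /N; lra.
Qed.
End Lattice.

(** * Coordinates of a later minimal point, and nonvanishing of the cubic form *)

Section State.
Variables (R : realType) (xi : R).
Local Notation err := (err xi).
Local Notation d1 := (d1 xi).
Local Notation d2 := (d2 xi).
Local Notation best := (best xi).
Local Notation next_best := (next_best xi).

(** A common factor of the coordinates could be divided out of [y], giving a better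
    approximation. *)
Lemma coprime_coords (x y z : pt) s t : best y -> 0 < err y ->
  y = lin s x t z -> coprimez s t.
Proof.
move=> [y0 yb] ey E.
have [s0|t0] : s = 0 /\ t = 0 \/ (s != 0) || (t != 0).
  by case: eqVneq; case: eqVneq; auto.
  by case: s0 => s0 t0; move: y0; rewrite E /= s0 t0 !mul0r addr0 ltxx.
have : gcdz s t != 0 by rewrite gcdz_eq0 negb_and.
have /dvdzP[s1 Es] := dvdz_gcdl s t; have /dvdzP[t1 Et] := dvdz_gcdr s t.
have g_ge0 : 0 <= gcdz s t by [].
move: g_ge0 Es Et; rewrite /coprimez; set g := gcdz s t => g_ge0 Es Et g0.
have [//|g1] := eqVneq g 1.
have g2 : 2 <= g by lia.
pose v := lin s1 x t1 z.
have Ev0 : p0 y = g * p0 v by rewrite E /v /= Es Et; ring.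
have Ev1 : p1 y = g * p1 v by rewrite E /v /= Es Et; ring.
have Ev2 : p2 y = g * p2 v by rewrite E /v /= Es Et; ring.
have v0 : 0 < p0 v by move: y0; rewrite Ev0 pmulr_rgt0 //; lia.
have : err y <= err v.
  by apply: yb; [exact: nz_p0|rewrite gtr0_norm // Ev0 ler_peMl; lia].
have Ev : err y = `|g%:~R| * err v.
  by apply: err_scale; rewrite ?Ev0 ?Ev1 ?Ev2 rmorphM.
rewrite gtr0_norm ?ltr0z in Ev; last by lia.
have g2' : 2 <= g%:~R :> R by rewrite -[2]/(2%:~R) ler_int.
move: ey; rewrite Ev => ey; have := err_ge0 xi v.
by nra.
Qed.

(** The minor of [x] and [y] is t times that of [x] and [z]. In the coordinate where [x] attains its
    error L, the former is compared with Y L, while the latter is at most 2 B L. *)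
Lemma coord_lower (x y z : pt) s t : next_best x z -> best x ->
  y = lin s x t z -> 0 < err x -> err y <= err x ->
  t != 0 -> p0 z <= p0 y ->
  (p0 y)%:~R <= 4 * (p0 z)%:~R * `|t%:~R| :> R.
Proof.
move=> [xz zx _] [x0 _] E ex yx tn0 zy.
have x0' : 0 < (p0 x)%:~R :> R by rewrite ltr0z.
have xz' : (p0 x)%:~R <= (p0 z)%:~R :> R by rewrite ler_int ltW.
have t1 : 1 <= `|t%:~R| :> R by rewrite -intr_norm ler1z -gtz0_ge1 normr_gt0.
have zy' : (p0 z)%:~R <= (p0 y)%:~R :> R by rewrite ler_int.
have key (f : pt -> R) : (forall s x t y, f (lin s x t y) = s%:~R * f x + t%:~R * f y) ->
   (forall u, `|f u| <= err u) -> `|f x| = err x ->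
   (p0 y)%:~R <= 4 * (p0 z)%:~R * `|t%:~R| :> R.
  move=> fl fe fx.
  have H : (p0 y)%:~R * f x = (p0 x)%:~R * f y + t%:~R * ((p0 z)%:~R * f x - (p0 x)%:~R * f z).
    by rewrite E fl /= rmorphD !rmorphM /=; ring.
  have nX : `|(p0 x)%:~R : R| <= (p0 x)%:~R by rewrite gtr0_norm.
  have nZ : `|(p0 z)%:~R : R| <= (p0 z)%:~R by rewrite ger0_norm //; lra.
  have := norm_add_le (norm_mul_le nX (fe y)) (norm_mul_le (lexx `|t%:~R|) (norm_sub_le (norm_mul_le nZ (fe x)) (norm_mul_le nX (fe z)))).
  rewrite -H normrM fx gtr0_norm; last by lra.
  move=> h; have t0 : 0 <= `|t%:~R : R| by [].
  have h1 : (p0 x)%:~R * err y <= (p0 x)%:~R * err x by rewrite ler_pM2l.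
  have h2 : (p0 x)%:~R * err z <= (p0 z)%:~R * err x.
    by apply: ler_pM; rewrite ?ler0z ?err_ge0 ?ltW // ltr_int.
  have h3 : `|t%:~R| * ((p0 z)%:~R * err x + (p0 x)%:~R * err z) <=
     `|t%:~R| * (2 * ((p0 z)%:~R * err x)) by apply: ler_wpM2l => //; lra.
  have z0 : 0 <= (p0 z)%:~R * err x by rewrite mulr_ge0 ?ltW //; lra.
  have h4 : (p0 x)%:~R * err x <= `|t%:~R| * ((p0 z)%:~R * err x).
    by apply: le_trans (ler_peMl z0 t1); rewrite ler_pM2r.
  by have tz := mulr_ge0 t0 z0; rewrite -(ler_pM2r ex); lra.
have [h|h] := leP `|d2 x| `|d1 x|.
  apply: (key d1); [exact: d1_lin|exact: d1_le|by rewrite /err; exact/esym/max_idPl].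
apply: (key d2); [exact: d2_lin|exact: d2_le|rewrite /err; apply/esym/max_idPr; exact: ltW].
Qed.

Lemma det3_lin (x z v : pt) s t : det3 x (lin s x t z) v = t * det3 x z v.
Proof. by rewrite /det3 /=; ring. Qed.

(** [det3 x y v] is t times the nonzero integer [det3 x z v]. *)
Lemma det_lower (x y z v : pt) s t : y = lin s x t z ->
  0 < p0 x -> p0 x <= p0 y -> p0 y <= p0 v -> err v <= err y -> err y <= err x ->
  det3 x z v != 0 ->
  `|t%:~R| <= 6 * ((p0 v)%:~R * err x * err y) :> R.
Proof.
move=> E x0 xy yv ev ey dn.
have : `|(det3 x y v)%:~R| <= 6 * ((p0 v)%:~R * err x * err y) :> R.
  apply: le_trans (det3_bound xi x y v) _; rewrite !ger0_norm ?ler0z; try lia.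
  have ex0 := err_ge0 xi x; have ey0 := err_ge0 xi y; have ev0 := err_ge0 xi v.
  have h1 : (p0 y)%:~R * (err x * err v) <= (p0 v)%:~R * (err x * err y) :> R.
    by apply: ler_pM; rewrite ?mulr_ge0 ?ler0z ?ler_int //; [lia|exact: ler_wpM2l].
  have h2 : (p0 x)%:~R * (err y * err v) <= (p0 v)%:~R * (err x * err y) :> R.
    by apply: ler_pM; rewrite ?mulr_ge0 ?ler0z ?ler_int //; [lia|lia|exact: ler_pM].
  lra.
move=> h; apply: le_trans h; rewrite E det3_lin -!intr_norm ler_int normrM.
by rewrite ler_peMr // -gtz0_ge1 normr_gt0.
Qed.

Lemma pol_bound_prev (x y : pt) : 0 < p0 y -> p0 y <= p0 x ->
  err x <= err y -> err y <= 1 ->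
  `|(pol x y)%:~R : R| <= 24 * (1 + `|xi|) ^+ 2 * ((p0 x)%:~R ^+ 2 * err y).
Proof.
move=> y0 yx xy y1; set K := (1 + `|xi|) ^+ 2.
have K1 : 1 <= K by rewrite /K; have := normr_ge0 xi; nra.
have xiK : `|xi| <= K by rewrite /K; have := normr_ge0 xi; nra.
have xi2K : `|xi ^+ 2| <= K.
  by rewrite normrX /K; have := normr_ge0 xi; nra.
have X1 : 1 <= (p0 x)%:~R :> R by rewrite ler1z; lia.
have hX : `|(p0 x)%:~R : R| <= (p0 x)%:~R by rewrite gtr0_norm // (lt_le_trans ltr01).
have hY : `|(p0 y)%:~R : R| <= (p0 x)%:~R.
  by rewrite gtr0_norm ?ltr0z // ler_int.
have he := d1_le xi y; have he2 := d2_le xi y.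
have hd : `|d1 x| <= err y := le_trans (d1_le xi x) xy.
have hd2 : `|d2 x| <= err y := le_trans (d2_le xi x) xy.
have hdX : `|d1 x| <= (p0 x)%:~R by apply: le_trans hd (le_trans y1 X1).
have h1 : `|1 : R| <= K by rewrite normr1.
have -> : (pol x y)%:~R = (p0 x)%:~R * ((p0 x)%:~R * (1 * d2 y - 3 * (xi ^+ 2 * d1 y)))
  + 2 * ((p0 x)%:~R * ((p0 y)%:~R * (1 * d2 x - 3 * (xi ^+ 2 * d1 x))))
  - 6 * (xi * ((p0 x)%:~R * (d1 x * d1 y)))
  - 3 * (xi * ((p0 y)%:~R * (d1 x * d1 x)))
  - 3 * (1 * (d1 x * (d1 x * d1 y))) :> R.
  rewrite /pol /d1 /d2 !(rmorphD, rmorphB, rmorphM, rmorphXn) /=; ring.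
have := norm_sub_le (norm_sub_le (norm_sub_le (norm_add_le
  (norm_mul_le hX (norm_mul_le hX (norm_sub_le (norm_mul_le h1 he2) (norm_mul_le (norm_nat_le R 3) (norm_mul_le xi2K he)))))
  (norm_mul_le (norm_nat_le R 2) (norm_mul_le hX (norm_mul_le hY (norm_sub_le (norm_mul_le h1 hd2) (norm_mul_le (norm_nat_le R 3) (norm_mul_le xi2K hd)))))))
  (norm_mul_le (norm_nat_le R 6) (norm_mul_le xiK (norm_mul_le hX (norm_mul_le hdX he)))))
  (norm_mul_le (norm_nat_le R 3) (norm_mul_le xiK (norm_mul_le hY (norm_mul_le hdX hd)))))
  (norm_mul_le (norm_nat_le R 3) (norm_mul_le h1 (norm_mul_le hdX (norm_mul_le hdX he)))).
lra.
Qed.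

(* A primitive rational point of the cuspidal curve is (q^3, q^2 p, p^3), so that
   the minors it forms with another point are divisible by high powers of q. *)
Lemma cub_neq0 (x y : pt) : best y -> next_best y x -> err y <= 1 ->
  (24 * (1 + `|xi|) ^+ 2) ^+ 3 * ((p0 x)%:~R ^+ 2 * err y ^+ 3) < 1 ->
  cub x != 0.
Proof.
move=> by_ nx ey1; have [y0 yb] := by_; have [yx xy _] := nx.
have x0 : 0 < p0 x by lia.
set K := (1 + `|xi|) ^+ 2 => small.
have K1 : 1 <= K by rewrite /K; have := normr_ge0 xi; nra.
have X1 : 1 <= (p0 x)%:~R :> R by rewrite ler1z; lia.
set X := (p0 x)%:~R : R in small X1 *.
have ey0 := err_ge0 xi y.
apply/eqP => c0.
have x0n : p0 x != 0 by rewrite gt_eqF.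
have [g [p [q [g0 Ep Eq cpq]]]] := coprime_decomp (p1 x) x0n.
have q0 : q != 0 by apply: contraNneq x0n => q0; rewrite Eq q0 mulr0.
have Eg : q ^+ 2 * p2 x = g * p ^+ 3.
  apply: (mulfI (expf_neq0 2 g0)); move: c0; rewrite /cub Ep Eq; lra.
have cq2 : coprimez (q ^+ 2) (p ^+ 3).
  by rewrite coprimezXl // coprimezXr // coprimez_sym.
have /dvdzP[k Ek] : (q ^+ 2 %| g)%Z.
  by rewrite -(Gauss_dvdzl _ cq2) -Eg dvdz_mulr.
have E0 : p0 x = k * q ^+ 3 by rewrite Eq Ek; ring.
have E1 : p1 x = k * q ^+ 2 * p by rewrite Ep Ek; ring.
have E2 : p2 x = k * p ^+ 3.
  by apply: (mulfI (expf_neq0 2 q0)); rewrite Eg Ek; ring.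
have k0 : k != 0 by apply: contraNneq g0 => k0; rewrite Ek k0 mul0r.
have norm_ge1 (n : int) : n != 0 -> 1 <= `|n| by move=> n0; rewrite -gtz0_ge1 normr_gt0.
have k1 := norm_ge1 _ k0; have q1 := norm_ge1 _ q0.
pose u : R := `|k|%:~R; pose v : R := `|q|%:~R.
have Xk : X = u * v ^+ 3.
  by rewrite /u /v /X -[p0 x]gtr0_norm // E0 normrM normrX rmorphM rmorphXn.
have u1 : 1 <= u by rewrite ler1z.
have v1 : 1 <= v by rewrite ler1z.
have u0 : 0 <= u := le_trans ler01 u1.
have v0 : 0 <= v := le_trans ler01 v1.
have X0 : 0 <= X := le_trans ler01 X1.
have K0 : 0 <= K := le_trans ler01 K1.
have uv2 : 0 <= u * v ^+ 2 by rewrite mulr_ge0 ?exprn_ge0.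
have uv4 : 0 <= u ^+ 2 * v ^+ 4 by rewrite mulr_ge0 ?exprn_ge0.
have hX : `|X| <= X by rewrite gtr0_norm // (lt_le_trans ltr01).
(* A minor of [x] and [y] is k q^2 times this integer. Were it nonzero, u v^2 would be at most 2 X L
   with L = [err y]; as (u v^2)^3 is at least X^2, this gives 1 <= 8 X L^3, against [small]. *)
have n20 : q * p1 y - p * p0 y = 0.
  apply/eqP; apply: contraTT isT => /norm_ge1 n1.
  have hY : `|(p0 y)%:~R : R| <= X by rewrite gtr0_norm ?ltr0z // ler_int ltW.
  have := norm_sub_le (norm_mul_le hX (d1_le xi y)) (norm_mul_le hY (le_trans (d1_le xi x) (ltW xy))).
  have -> : X * d1 y - (p0 y)%:~R * d1 x = (k * q ^+ 2 * (q * p1 y - p * p0 y))%:~R.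
    rewrite /X /d1 E0 E1 !(rmorphD, rmorphB, rmorphM, rmorphXn) /=; ring.
  move=> h; have {}h : u * v ^+ 2 <= 2 * (X * err y).
    rewrite -intr_norm normrM normrM normrX rmorphM rmorphM rmorphXn /= in h.
    apply: le_trans (_ : _ <= X * err y + X * err y) _; last by lra.
    apply: le_trans h; rewrite ler_peMr ?ler1z //.
  have h3 : (u * v ^+ 2) ^+ 3 <= (2 * (X * err y)) ^+ 3.
    by rewrite lerXn2r // ?nnegrE ?mulr_ge0 ?exprn_ge0 // ?mulr_ge0 ?exprn_ge0.
  have h4 : X ^+ 2 <= (u * v ^+ 2) ^+ 3.
    rewrite Xk.
    have -> : (u * v ^+ 3) ^+ 2 = u ^+ 2 * v ^+ 6 by ring.
    have -> : (u * v ^+ 2) ^+ 3 = u ^+ 3 * v ^+ 6 by ring.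
    by rewrite ler_wpM2r ?ler_weXn2l ?exprn_ge0.
  have h5 : X ^+ 2 * 1 <= X ^+ 2 * (8 * (X * err y ^+ 3)) by lra.
  rewrite ler_pM2l ?exprn_gt0 ?(lt_le_trans ltr01) // in h5.
  have h6 : X * err y ^+ 3 <= X ^+ 2 * err y ^+ 3.
    by apply: ler_wpM2r; rewrite ?exprn_ge0 // expr2 ler_peMl.
  have h7 : 0 <= X ^+ 2 * err y ^+ 3 by rewrite mulr_ge0 ?exprn_ge0.
  have h8 : 1 <= K ^+ 3 by rewrite exprn_ege1.
  have h9 : 1 * (X ^+ 2 * err y ^+ 3) <= K ^+ 3 * (X ^+ 2 * err y ^+ 3) by apply: ler_wpM2r.
  by exfalso; lra.
have [l El0] : exists l, p0 y = q * l.
  have /dvdzP[l El] : (q %| p0 y)%Z.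
    have cqp : coprimez q p by rewrite coprimez_sym.
    rewrite -(Gauss_dvdzr _ cqp); apply/dvdzP; exists (p1 y).
    by apply/eqP; rewrite eq_sym -subr_eq0 -n20 [p1 y * q]mulrC.
  by exists l; rewrite El mulrC.
have El1 : p1 y = p * l.
  by apply: (mulfI q0); apply/eqP; rewrite -subr_eq0 -n20 El0; apply/eqP; ring.
(* Now [pol x y] is k^2 q^4 times this integer, and the cube of u^2 v^4 is at least X^4, so a
   nonzero value contradicts [small]. *)
have t0 : q ^+ 2 * p2 y - l * p ^+ 3 = 0.
  apply/eqP; apply: contraTT isT => /norm_ge1 n1.
  have := pol_bound_prev y0 (ltW yx) (ltW xy) ey1.
  have -> : pol x y = k ^+ 2 * q ^+ 4 * (q ^+ 2 * p2 y - l * p ^+ 3).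
    by rewrite /pol E0 E1 E2 El0 El1; ring.
  rewrite -/K -/X => h; have {}h : u ^+ 2 * v ^+ 4 <= 24 * K * (X ^+ 2 * err y).
    rewrite -intr_norm normrM normrM !normrX rmorphM rmorphM !rmorphXn /= in h.
    apply: le_trans h; rewrite ler_peMr ?ler1z //.
  have h3 : (u ^+ 2 * v ^+ 4) ^+ 3 <= (24 * K * (X ^+ 2 * err y)) ^+ 3.
    by rewrite lerXn2r // ?nnegrE ?mulr_ge0 ?exprn_ge0 // ?mulr_ge0 ?exprn_ge0.
  have h4 : X ^+ 4 <= (u ^+ 2 * v ^+ 4) ^+ 3.
    rewrite Xk.
    have -> : (u * v ^+ 3) ^+ 4 = u ^+ 4 * v ^+ 12 by ring.
    have -> : (u ^+ 2 * v ^+ 4) ^+ 3 = u ^+ 6 * v ^+ 12 by ring.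
    by rewrite ler_wpM2r ?ler_weXn2l ?exprn_ge0.
  have h5 : X ^+ 4 * 1 <= X ^+ 4 * ((24 * K) ^+ 3 * (X ^+ 2 * err y ^+ 3)) by lra.
  rewrite ler_pM2l ?exprn_gt0 ?(lt_le_trans ltr01) // in h5.
  by exfalso; lra.
have /dvdzP[m Em] : (q ^+ 2 %| l)%Z.
  by rewrite -(Gauss_dvdzl _ cq2); apply/dvdzP; exists (p2 y);
    apply/eqP; rewrite eq_sym -subr_eq0 -t0 [p2 y * _]mulrC.
have E2y : p2 y = m * p ^+ 3.
  by apply: (mulfI (expf_neq0 2 q0)); apply/eqP; rewrite -subr_eq0 -t0 Em; apply/eqP; ring.
have := next_minor by_ nx; rewrite E0 E1 E2 El0 El1 E2y Em.
case/orP => /eqP; apply; ring.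
Qed.
End State.

(** * The sequence of minimal points and the lower bound for approximations *)

Section Sequence.
Variables (R : realType) (xi : R).
Hypothesis irr : forall n0 n1 n2 : int,
  n0%:~R + n1%:~R * xi + n2%:~R * xi ^+ 3 = 0 -> [/\ n0 = 0, n1 = 0 & n2 = 0].
Local Notation err := (err xi).
Variable X : nat -> pt.
Hypothesis bX : forall i, best xi (X i).
Hypothesis nX : forall i, next_best xi (X i) (X i.+1).

Lemma p0_gt0 i : 0 < p0 (X i). Proof. by case: (bX i). Qed.

Lemma p0_step i : p0 (X i) < p0 (X i.+1). Proof. by case: (nX i). Qed.

Lemma p0_lt i j : (i < j)%N -> p0 (X i) < p0 (X j).
Proof. exact: (homo_ltn lt_trans p0_step). Qed.

Lemma p0_le i j : (i <= j)%N -> p0 (X i) <= p0 (X j).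
Proof. by rewrite leq_eqVlt => /orP[/eqP->//|/p0_lt/ltW]. Qed.

Lemma err_lt_seq i j : (i < j)%N -> err (X j) < err (X i).
Proof.
have step k : err (X k.+1) < err (X k) by case: (nX k).
have tr : transitive (fun a b : R => b < a) by move=> b a c h h'; apply: lt_trans h' h.
exact: (@homo_ltn _ (fun i => err (X i)) _ tr step).
Qed.

Lemma err_le_seq i j : (i <= j)%N -> err (X j) <= err (X i).
Proof. by rewrite leq_eqVlt => /orP[/eqP->//|/err_lt_seq/ltW]. Qed.

Lemma errX_gt0 i : 0 < err (X i).
Proof. exact: le_lt_trans (err_ge0 _ _) (err_lt_seq (ltnSn i)). Qed.

Lemma errX_le1 i : err (X i) <= 1.
Proof. by have := best_half (bX i); lra. Qed.

Lemma p0_ge i : (i < `|p0 (X i)|)%N.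
Proof.
elim: i => [|i IH]; first by rewrite absz_gt0 gt_eqF // p0_gt0.
have := p0_gt0 i; have := p0_step i.
move: (p0 (X i)) (p0 (X i.+1)) IH => u v; lia.
Qed.

Lemma p0_geR i : i%:R < (p0 (X i))%:~R :> R.
Proof.
rewrite -[p0 (X i)]gez0_abs ?(ltW (p0_gt0 i)) //.
by rewrite -[_%:~R]/(_%:R) ltr_nat p0_ge.
Qed.

(** If X_m lies in the plane of normal (N0, N1, N2), then |D| X_m is at most |N1| + |N2|, where D =
    N0 + N1 xi + N2 xi^3 is nonzero by independence. So some later point leaves the plane; [j.+1] is
    the first index to do so. *)
Lemma next_state i : exists j, [/\ (i < j)%N,
  det3 (X i) (X i.+1) (X j) = 0 & det3 (X i) (X i.+1) (X j.+1) != 0].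
Proof.
set x := X i; set z := X i.+1.
pose N0 := p1 x * p2 z - p2 x * p1 z.
pose N1 := p2 x * p0 z - p0 x * p2 z.
pose N2 := p0 x * p1 z - p1 x * p0 z.
have Ed v : det3 x z v = N0 * p0 v + N1 * p1 v + N2 * p2 v.
  by rewrite /det3 /N0 /N1 /N2; ring.
have nN : (N1 != 0) || (N2 != 0).
  have := next_minor (bX i) (nX i); rewrite -/x -/z -/N2 orbC.
  have -> : p0 x * p2 z - p2 x * p0 z = - N1 by rewrite /N1; ring.
  by rewrite oppr_eq0.
clearbody N0 N1 N2.
set D : R := N0%:~R + N1%:~R * xi + N2%:~R * xi ^+ 3.
have D0 : 0 < `|D|.
  by rewrite normr_gt0; apply/eqP => /irr[_ n1 n2]; rewrite n1 n2 eqxx in nN.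
have exm : exists m, (i.+1 < m)%N && (det3 x z (X m) != 0).
  set b : R := `|N1%:~R| + `|N2%:~R|.
  have b0 : 0 <= b by rewrite addr_ge0.
  set m := maxn i.+2 (Num.truncn (b / `|D|)).+1; exists m.
  rewrite leq_max leqnn /=; apply/eqP => dm.
  have : D * (p0 (X m))%:~R = - (N1%:~R * d1 xi (X m) + N2%:~R * d2 xi (X m)).
    apply/eqP; rewrite -addr_eq0; apply/eqP.
    transitivity ((det3 x z (X m))%:~R : R); last by rewrite dm.
    by rewrite Ed !(rmorphD, rmorphM) /= /d1 /d2 /D; ring.
  move/(congr1 Num.norm); rewrite normrN normrM => E.
  have := norm_add_le (norm_mul_le (lexx `|N1%:~R|) (d1_le xi (X m))) (norm_mul_le (lexx `|N2%:~R|) (d2_le xi (X m))).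
  have pm : 0 < (p0 (X m))%:~R :> R by rewrite ltr0z p0_gt0.
  rewrite -E -mulrDl -/b [X in _ * X]gtr0_norm // => h.
  have h1 : `|D| * (p0 (X m))%:~R <= b.
    by apply: le_trans h _; rewrite ler_piMr ?errX_le1.
  have h2 : b / `|D| < (p0 (X m))%:~R.
    apply: le_lt_trans (_ : _ <= m%:R) (p0_geR m).
    apply: ltW; apply: lt_le_trans (truncnS_gt _) _.
    by rewrite ler_nat /m leq_maxr.
  by move: h2; rewrite ltr_pdivrMr // mulrC ltNge h1.
case: (ex_minnP exm) => [[|j]] // /andP[ij dj] jmin.
exists j; split=> //; apply/eqP; apply: contraTT isT => dj'.
move: ij; rewrite ltnS leq_eqVlt => /orP[/eqP E|ij].
  by move: dj'; rewrite -E -/z /det3; rewrite (_ : _ + _ = 0) ?eqxx //; ring.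
by have := jmin j; rewrite ij dj' ltnn => /(_ isT).
Qed.

Definition lX i : R := ln (p0 (X i))%:~R.
Definition lK i : R := - ln (err (X i)).

Lemma lX_large (M : R) : exists N, forall i, (N <= i)%N -> M <= lX i.
Proof.
exists (Num.truncn (expR M)).+1 => i Ni; rewrite /lX -[M]expRK ler_ln ?posrE.
- apply: ltW; apply: lt_trans (p0_geR i); apply: lt_le_trans (truncnS_gt _) _.
  by rewrite ler_nat.
- exact: expR_gt0.
- by rewrite ltr0z p0_gt0.
Qed.

Lemma lX_ge0 i : 0 <= lX i.
Proof. by rewrite /lX ln_ge0 // ler1z -gtz0_ge1 p0_gt0. Qed.

Lemma lX_le i j : (i <= j)%N -> lX i <= lX j.
Proof.
by move=> ij; rewrite /lX ler_ln ?posrE ?ltr0z ?p0_gt0 // ler_int p0_le.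
Qed.

Lemma lK_ge0 i : 0 <= lK i.
Proof. by rewrite /lK oppr_ge0 ln_le0 // errX_le1. Qed.

Section Uniform.
Variable N0 : nat.
Hypothesis Hp : forall i, (N0 <= i)%N -> lX i.+1 <= 1421 / 1000 * lK i.
Let K : R := (1 + `|xi|) ^+ 2.
Let K1 : 1 <= K.
Proof. by rewrite /K; have := normr_ge0 xi; nra. Qed.

(** X_(i+1)^2 L_i^3 tends to zero because 2 * 1.421 < 3, so [cub_neq0] applies. *)
Lemma cub_eventually : exists N, forall i, (N <= i)%N -> cub (X i) != 0.
Proof.
have K24 : 0 < (24 * K) ^+ 3 by rewrite exprn_gt0 // mulr_gt0 // (lt_le_trans ltr01).
have [N HN] := lX_large (`|ln ((24 * K) ^+ 3)| * 100 + 1).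
exists (maxn N N0).+1 => -[//|i]; rewrite ltnS geq_max => /andP[Ni N0i].
apply: (cub_neq0 (bX i) (nX i) (errX_le1 i)).
have xp : 0 < (p0 (X i.+1))%:~R :> R by rewrite ltr0z p0_gt0.
have ep := errX_gt0 i.
rewrite -/K -ltr_ln ?posrE ?mulr_gt0 ?exprn_gt0 //.
have E (A x e : R) : 0 < A -> 0 < x -> 0 < e ->
    ln (A * (x ^+ 2 * e ^+ 3)) = ln A + (2 * ln x + 3 * ln e).
  move=> A0 x0 e0; have x2 := exprn_gt0 2 x0; have e3 := exprn_gt0 3 e0.
  rewrite lnM ?posrE ?mulr_gt0 //; congr (_ + _).
  by rewrite lnM ?posrE // (lnXn 2 x0) (lnXn 3 e0) !mulr_natl.
rewrite ln1 E //.
have := Hp N0i; have := HN _ (leqW Ni); rewrite /lX /lK.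
have := ler_norm (ln ((24 * K) ^+ 3)); have := normr_ge0 (ln ((24 * K) ^+ 3)).
move: (ln ((24 * K) ^+ 3)) => a; move: (ln _) (ln _) (`|a|) => u v w; lra.
Qed.

(** For large [w], compare with the last minimal point of first coordinate at most |w0|: its [cub]
    is a nonzero integer bounded by 8 K X_i^2 L_i. Small [w] are no better than [X N], and the
    maximum with 1 covers w0 = 0. *)
Lemma err_lower : exists2 c : R, 0 < c &
  forall w, nz w -> c <= err w * Num.max 1 ((p0 w)%:~R ^+ 2).
Proof.
have [N HN] := cub_eventually.
have K8 : 0 < 8 * K by rewrite mulr_gt0 // (lt_le_trans ltr01).
exists (Num.min (err (X N)) (8 * K)^-1).
  by rewrite lt_min errX_gt0 invr_gt0.
move=> w nw; set m := Num.max _ _.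
have m1 : 1 <= m by rewrite /m le_max lexx.
have m2 : (p0 w)%:~R ^+ 2 <= m by rewrite /m le_max lexx orbT.
have [lt|le] := ltP `|p0 w| (p0 (X N.+1)).
  rewrite ge_min; apply/orP; left; case: (nX N) => _ _ /(_ w nw lt) h.
  by apply: le_trans h _; rewrite ler_peMr // err_ge0.
have exi : exists i, `|p0 w| < p0 (X i.+1).
  exists `|p0 w|%N; have := p0_ge `|p0 w|.+1; have := p0_gt0 `|p0 w|.+1.
  rewrite -abszE; move: `|p0 w|%N => n; move: (p0 (X n.+1)) => u; lia.
case: (ex_minnP exi) => i lti imin.
have Ni : (N < i)%N.
  rewrite ltnNge; apply/negP => iN; have := p0_le (i := i.+1) (j := N.+1).
  by rewrite ltnS iN => /(_ isT); lia.
have lei : p0 (X i) <= `|p0 w|.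
  case: i {lti} imin Ni => // i imin _; rewrite leNgt; apply/negP => /imin.
  by rewrite ltnn.
rewrite ge_min; apply/orP; right.
have ei : err (X i) <= err w by case: (nX i) => _ _; apply.
have c1 : 1 <= 8 * K * ((p0 (X i))%:~R ^+ 2 * err (X i)).
  have X1 : 1 <= (p0 (X i))%:~R :> R by rewrite ler1z -gtz0_ge1 p0_gt0.
  apply: le_trans (cub_bound X1 (errX_le1 i)).
  by rewrite -intr_norm ler1z -gtz0_ge1 normr_gt0 HN // ltnW.
rewrite -[X in X <= _]mulr1 ler_pdivrMl //; apply: le_trans c1 _.
rewrite ler_pM2l // mulrC; apply: ler_pM => //; rewrite ?err_ge0 ?exprn_ge0 ?ler0z //.
  by rewrite ltW ?p0_gt0.
apply: le_trans m2; rewrite -[leRHS]real_normK ?num_real //.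
by rewrite lerXn2r ?nnegrE ?normr_ge0 ?ler0z ?(ltW (p0_gt0 _)) // -intr_norm ler_int.
Qed.
End Uniform.
End Sequence.

(** * Consequences of the divisibilities *)

Lemma norm_ge1 (n : int) : n != 0 -> 1 <= `|n|.
Proof. by move=> n0; rewrite -gtz0_ge1 normr_gt0. Qed.

Lemma dvd_small (m t e : int) : m = t * e -> `|m| < `|t| -> m = 0.
Proof.
move=> ->; have [->|e0] := eqVneq e 0; first by rewrite mulr0.
by rewrite normrM ltNge ler_peMr // norm_ge1.
Qed.

Lemma sqr_small (d u : int) : 0 <= d -> 5000 * d <= u -> 5000 * d ^+ 2 <= u ^+ 2.
Proof.
move=> d0 h; have h1 : d * (5000 * d) <= d * u by rewrite ler_wpM2l.
have h2 : d * u <= u * u by rewrite ler_wpM2r //; lra.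
by rewrite !expr2; lra.
Qed.

Section Dominate.
Variables b G D t : int.

(** A nonzero multiple of t^2 is at least t^2, and the share of D^2 is less than half of it. *)
Lemma order2_large (e : int) : 27 * (G ^+ 3 + 27 * D ^+ 2) = t ^+ 2 * e ->
  t != 0 -> G ^+ 3 + 27 * D ^+ 2 != 0 -> 5000 * `|D| <= `|t| -> `|t| ^+ 2 <= 54 * `|G| ^+ 3.
Proof.
move=> E t0 E0 Dt.
have : `|t ^+ 2| <= `|27 * (G ^+ 3 + 27 * D ^+ 2)|.
  rewrite leNgt; apply/negP => /(dvd_small E)/eqP.
  by rewrite mulf_eq0 (negPf E0) orbF.
have D2 := sqr_small (normr_ge0 D) Dt.
have := norm_add_le (lexx `|G ^+ 3|) (norm_mul_le (norm_nat_le int 27) (lexx `|D ^+ 2|)).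
move=> h1 h2; rewrite normrX normrM normr_nat in h2; rewrite !normrX in h1.
by have := exprn_ge0 3 (normr_ge0 G); lra.
Qed.

(** The order 3 combination is too small to be a nonzero multiple of t^3. Once it vanishes, 2 G
    times 9 (G^2 - 3 b D) equals 15 (G^3 + 27 D^2); hence the order 2 combination is O(G^2 + D^2),
    too small for t^2, and vanishes too. *)
Lemma order3_vanish (e2 e3 : int) :
  9 * (G ^+ 2 - 3 * b * D) = t ^+ 2 * e2 ->
  27 * (G ^+ 3 - 18 * b * G * D - 135 * D ^+ 2) = t ^+ 3 * e3 ->
  G != 0 -> 10 * `|G| < `|t| -> 5000 * `|D| <= `|t| ->
  5000 * `|b * G * D| <= `|t| ^+ 3 -> G ^+ 3 + 27 * D ^+ 2 = 0.
Proof.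
move=> E2 E3 G0 Gt Dt bGD.
have t1 : 1 <= `|t|.
  apply: norm_ge1; apply: contraTneq Gt => ->.
  by rewrite normr0 -leNgt mulr_ge0.
have G1 := norm_ge1 G0.
have G2 : 100 * `|G| ^+ 2 <= `|t| ^+ 2.
  have h1 : `|G| * (10 * `|G|) <= `|G| * `|t| by rewrite ler_wpM2l // ltW.
  have h2 : 10 * `|G| * `|t| <= `|t| * `|t| by rewrite ler_wpM2r // ltW.
  by rewrite !expr2; lra.
have D2 := sqr_small (normr_ge0 D) Dt.
have t23 : `|t| ^+ 2 <= `|t| ^+ 3 by rewrite ler_weXn2l.
have G3 : 1000 * `|G| ^+ 3 <= `|t| ^+ 3.
  have h1 : `|G| * (100 * `|G| ^+ 2) <= `|G| * `|t| ^+ 2 by rewrite ler_wpM2l.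
  have h2 : 10 * `|G| * `|t| ^+ 2 <= `|t| * `|t| ^+ 2.
    by rewrite ler_wpM2r ?exprn_ge0 // ltW.
  by rewrite [`|G| ^+ 3]exprS [`|t| ^+ 3]exprS; lra.
have f3 : G ^+ 3 - 18 * b * G * D - 135 * D ^+ 2 = 0.
  have : 27 * (G ^+ 3 - 18 * b * G * D - 135 * D ^+ 2) = 0.
    apply: (dvd_small E3).
    have := norm_mul_le (norm_nat_le int 27) (norm_sub_le (norm_sub_le (lexx `|G ^+ 3|) (norm_mul_le (norm_nat_le int 18) (lexx `|b * G * D|)))
      (norm_mul_le (norm_nat_le int 135) (lexx `|D ^+ 2|))).
    rewrite !mulrA !normrX; have : 0 < `|t| ^+ 3 by rewrite exprn_gt0 // (lt_le_trans ltr01).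
    lra.
  by move/eqP; rewrite mulf_eq0 /= => /eqP.
have u0 : 9 * (G ^+ 2 - 3 * b * D) = 0.
  apply: (dvd_small E2).
  have E : 2 * G * (9 * (G ^+ 2 - 3 * b * D)) = 15 * G ^+ 3 + 405 * D ^+ 2.
    by move: f3; lra.
  have := norm_add_le (norm_mul_le (norm_nat_le int 15) (lexx `|G ^+ 3|)) (norm_mul_le (norm_nat_le int 405) (lexx `|D ^+ 2|)).
  rewrite -E !normrX (normrM (2 * G)) (normrM 2) normr_nat => h.
  have : `|G| * (2 * `|9 * (G ^+ 2 - 3 * b * D)|) <= `|G| * (15 * `|G| ^+ 2 + 405 * `|D| ^+ 2).
    rewrite [leRHS]mulrDr.
    have : 405 * `|D| ^+ 2 <= `|G| * (405 * `|D| ^+ 2) by rewrite ler_peMl // mulr_ge0 ?exprn_ge0.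
    lra.
  rewrite ler_pM2l ?(lt_le_trans ltr01) // => {}h.
  have := exprn_ge0 2 (normr_ge0 D); have T2 : 0 < `|t| ^+ 2.
    by rewrite exprn_gt0 // (lt_le_trans ltr01).
  by lra.
have : 15 * G ^+ 3 + 405 * D ^+ 2 = 0.
  transitivity (2 * G * (9 * (G ^+ 2 - 3 * b * D))); last by rewrite u0 mulr0.
  by move: f3; lra.
lra.
Qed.

(** The term b G^4 dominates the other five, so the combination is nonzero and at most 2 * 729 times
    this term in absolute value. *)
Lemma order6_dominant (e6 : int) :
  729 * (b ^+ 3 * D ^+ 2 + 11 * b ^+ 2 * G ^+ 2 * D
  - b * G ^+ 4 + 180 * b * G * D ^+ 2 - 10 * G ^+ 3 * D + 675 * D ^+ 3)
  = t ^+ 6 * e6 -> b != 0 -> G != 0 -> 100 * `|b * D| <= `|G| ^+ 2 ->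
  1000 * `|D| <= `|G| -> `|t| ^+ 6 <= 1458 * (`|b| * `|G| ^+ 4).
Proof.
set f := _ - _ + _ => E b0 G0 bD DG.
have b1 := norm_ge1 b0; have G1 := norm_ge1 G0.
set g := `|G| in bD DG G1 *; set B := `|b| in b1 *.
have hG : `|G| <= g by []. have hb : `|b| <= B by [].
have d0 : 0 <= `|D| by [].
have hbd : `|b * D| <= `|b * D| by []; have bd0 : 0 <= `|b * D| by [].
have g2 : 1 <= g ^+ 2 by rewrite exprn_ege1.
have Bg : g ^+ 4 <= B * g ^+ 4 by rewrite ler_peMl // exprn_ge0.
have Ef : f + b * G ^+ 4 = b * ((b * D) * (b * D)) + 11 * (b * (G * (G * (b * D))))
  + 180 * (b * (G * (D * D))) - 10 * (G * (G * (G * D))) + 675 * (D * (D * D)).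
  by rewrite /f; ring.
have M := norm_add_le (norm_sub_le (norm_add_le (norm_add_le (norm_mul_le hb (norm_mul_le hbd hbd)) (norm_mul_le (norm_nat_le int 11) (norm_mul_le hb (norm_mul_le hG (norm_mul_le hG hbd)))))
   (norm_mul_le (norm_nat_le int 180) (norm_mul_le hb (norm_mul_le hG (norm_mul_le (lexx `|D|) (lexx `|D|))))))
   (norm_mul_le (norm_nat_le int 10) (norm_mul_le hG (norm_mul_le hG (norm_mul_le hG (lexx `|D|))))))
   (norm_mul_le (norm_nat_le int 675) (norm_mul_le (lexx `|D|) (norm_mul_le (lexx `|D|) (lexx `|D|)))).
rewrite -Ef in M; move: (`|b * D|) (`|D|) bD DG d0 bd0 M => u v bD DG d0 bd0 M.
have g0 : 0 <= g := le_trans ler01 G1; have B0 : 0 <= B := le_trans ler01 b1.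
have g4 : g ^+ 4 = g ^+ 2 * g ^+ 2 by ring.
have g34 : g ^+ 3 <= g ^+ 4 by rewrite ler_weXn2l.
have ug : u <= g ^+ 2 by lra.
have vg : v <= g by lra.
have h1 : u * (100 * u) <= g ^+ 4 by rewrite g4 ler_pM // mulr_ge0.
have h2 : g ^+ 2 * (100 * u) <= g ^+ 4 by rewrite g4 ler_wpM2l // exprn_ge0.
have h3 : (1000 * v) * (g * v) <= g ^+ 3.
  by rewrite exprS expr2 ler_pM ?mulr_ge0 // ler_wpM2l.
have h4 : g ^+ 3 * (1000 * v) <= g ^+ 4 by rewrite [leRHS]exprSr ler_wpM2l // exprn_ge0.
have h5 : (1000 * v) * ((10 * v) * v) <= g ^+ 3.
  rewrite exprS expr2 ler_pM ?mulr_ge0 // ler_pM ?mulr_ge0 //; lra.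
have k1 := ler_wpM2l B0 h1; have k2 := ler_wpM2l B0 h2.
have k3 := ler_wpM2l B0 (le_trans h3 g34).
have k5 := le_trans (le_trans h5 g34) Bg; have k4 := le_trans h4 Bg.
clear h1 h2 h3 h4 h5 ug vg DG bD.
have Bg0 : 0 < B * g ^+ 4 by apply: lt_le_trans Bg; rewrite exprn_gt0 // (lt_le_trans ltr01).
have M' : 10 * `|f + b * G ^+ 4| <= 5 * (B * g ^+ 4) by lra.
have nf := ler_normB (f + b * G ^+ 4) f; have nf2 := ler_normB (f + b * G ^+ 4) (b * G ^+ 4).
have Ebg : `|b * G ^+ 4| = B * g ^+ 4 by rewrite normrM normrX.
rewrite addrK in nf2; rewrite addrAC subrr add0r Ebg in nf; rewrite Ebg in nf2.
have : `|t ^+ 6| <= `|729 * f|.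
  rewrite leNgt; apply/negP => /(dvd_small E)/eqP; rewrite mulf_eq0 /= => /eqP f0.
  have f1 : `|f| = 0 by rewrite f0 normr0.
  by clear E f0; lra.
by rewrite normrX normrM normr_nat; clear E; lra.
Qed.
End Dominate.

(** * The same consequences in logarithmic form *)

Section Lg.
Variable R : realType.

Definition lg (n : int) : R := ln `|n|%:~R.

Lemma absR_ge1 (n : int) : n != 0 -> 1 <= `|n|%:~R :> R.
Proof. by move=> n0; rewrite ler1z norm_ge1. Qed.

Lemma absR_gt0 (n : int) : n != 0 -> 0 < `|n|%:~R :> R.
Proof. by move=> n0; rewrite ltr0z normr_gt0. Qed.

Lemma lg_ge0 (n : int) : n != 0 -> 0 <= lg n.
Proof. by move=> n0; rewrite ln_ge0 // absR_ge1. Qed.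

Lemma lgM (m n : int) : m != 0 -> n != 0 -> lg (m * n) = lg m + lg n.
Proof.
by move=> m0 n0; rewrite /lg normrM rmorphM lnM ?posrE ?absR_gt0.
Qed.

Lemma lgX (m : int) n : m != 0 -> lg (m ^+ n) = n%:R * lg m.
Proof.
by move=> m0; rewrite /lg normrX rmorphXn lnXn ?absR_gt0 // mulr_natl.
Qed.

Lemma ln_absX (m : int) n : m != 0 -> ln (`|m|%:~R ^+ n) = n%:R * lg m.
Proof. by move=> m0; rewrite lnXn ?absR_gt0 // mulr_natl. Qed.

Lemma lg_le_ln (n : int) (u : R) : n != 0 -> `|n|%:~R <= u -> lg n <= ln u.
Proof.
by move=> n0 h; rewrite ler_ln ?posrE ?absR_gt0 // (lt_le_trans (absR_gt0 n0)).
Qed.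

Variables (c : nat) (M C : R).
Hypotheses (c0 : (0 < c)%N) (M1 : c%:R <= M) (MC : ln M <= C).

Lemma ln_sep (u v : R) : 0 < u -> 0 < v -> ln u + C <= ln v -> M * u <= v.
Proof.
move=> u0 v0 h; have M0 : 0 < M by apply: lt_le_trans M1; rewrite ltr0n.
by rewrite -ler_ln ?posrE ?mulr_gt0 // lnM ?posrE //; have := MC; lra.
Qed.

Lemma lg_sep (m n : int) : n != 0 -> lg m + C <= lg n -> c%:R * `|m| <= `|n|.
Proof.
move=> n0 h; have [->|m0] := eqVneq m 0; first by rewrite normr0 mulr0.
have := ln_sep (absR_gt0 m0) (absR_gt0 n0) h.
rewrite -(ler_int R) rmorphM /= rmorph_nat; apply: le_trans.
by rewrite ler_pM2r ?absR_gt0.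
Qed.
End Lg.


Section Domination.
Variables (R : realType) (M C : R) (b G D t : int).
Hypotheses (M1 : 10000 <= M) (hC : ln M <= C) (C1 : 1 <= C).
Hypotheses (G0 : G != 0) (D0 : D != 0) (t0 : t != 0).
Hypothesis disc0 : G ^+ 3 + 27 * D ^+ 2 != 0.
Hypothesis hDt : lg R D + 10 * C <= lg R t.
Local Notation lg := (lg R).

Let sepz (c : nat) (m n : int) : (0 < c <= 10000)%N -> n != 0 ->
  lg m + C <= lg n -> c%:R * `|m| <= `|n|.
Proof.
move=> /andP[c0 c1] n0; apply: (lg_sep c0 (le_trans _ M1) hC n0).
by rewrite ler_nat.
Qed.

Let ln_const (n : nat) : (0 < n <= 10000)%N -> ln n%:R <= C :> R.
Proof.
case/andP=> n0 n1; apply: le_trans hC.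
have h : n%:R <= M by apply: le_trans M1; rewrite ler_nat.
by rewrite ler_ln ?posrE ?(lt_le_trans _ h) ?ltr0n.
Qed.

Let D_t : 5000 * `|D| <= `|t|.
Proof. by apply: (@sepz 5000%N) => //; have := hDt; have := C1; lra. Qed.

Lemma order2_lg e : 27 * (G ^+ 3 + 27 * D ^+ 2) = t ^+ 2 * e ->
  2 * lg t <= 3 * lg G + 10 * C.
Proof.
move/order2_large => /(_ t0 disc0 D_t).
rewrite -(ler_int R) (rmorphM _ 54) !rmorphXn /= rmorph_nat => h.
have t00 := absR_gt0 R t0; have G00 := absR_gt0 R G0.
have h54 : ln 54 <= C :> R by exact: ln_const.
have lt2 : ln (`|t|%:~R ^+ 2) = 2 * lg t by exact: ln_absX.
have lG3 : ln (`|G|%:~R ^+ 3) = 3 * lg G by exact: ln_absX.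
move: (`|t|%:~R ^+ 2) (`|G|%:~R ^+ 3) (exprn_gt0 2 t00) (exprn_gt0 3 G00) lt2 lG3 h.
move=> u v u0 v0 lt2 lG3 h; rewrite -ler_ln ?posrE ?mulr_gt0 // in h.
rewrite lnM ?posrE // lt2 lG3 in h.
by have := C1; lra.
Qed.

Hypotheses (b0 : b != 0) (hf3 : lg b + lg G + lg D + 10 * C <= 3 * lg t).

Lemma order3_lg e2 e3 : 9 * (G ^+ 2 - 3 * b * D) = t ^+ 2 * e2 ->
  27 * (G ^+ 3 - 18 * b * G * D - 135 * D ^+ 2) = t ^+ 3 * e3 ->
  lg t <= lg G + C.
Proof.
move=> E2 E3.
have h : `|t| <= 10 * `|G|.
  rewrite leNgt; apply/negP => Gt; have := disc0; apply/negP; rewrite negbK; apply/eqP.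
  apply: (order3_vanish E2 E3 G0 Gt D_t).
  rewrite -normrX; apply: (@sepz 5000%N); rewrite // ?expf_neq0 //.
  have bG0 : b * G != 0 by rewrite mulf_neq0.
  by rewrite (lgM R bG0 D0) (lgM R b0 G0) lgX //; have := hf3; have := C1; lra.
move: h; rewrite -(ler_int R) (rmorphM _ 10) /= rmorph_nat => h.
have t00 := absR_gt0 R t0; have G00 := absR_gt0 R G0.
have h10 : ln 10 <= C :> R by exact: ln_const.
rewrite -ler_ln ?posrE ?mulr_gt0 // lnM ?posrE // in h.
by rewrite /lg; have := C1; lra.
Qed.

Lemma order6_lg e6 :
  729 * (b ^+ 3 * D ^+ 2 + 11 * b ^+ 2 * G ^+ 2 * D
  - b * G ^+ 4 + 180 * b * G * D ^+ 2 - 10 * G ^+ 3 * D + 675 * D ^+ 3)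
  = t ^+ 6 * e6 -> lg t <= lg G + C -> lg b + lg D + 40 * C <= 2 * lg t ->
  6 * lg t <= lg b + 4 * lg G + 10 * C.
Proof.
move=> E6 tG fb.
have h : `|t| ^+ 6 <= 1458 * (`|b| * `|G| ^+ 4).
  apply: (order6_dominant E6) => //.
    rewrite -normrX; apply: (@sepz 100%N); rewrite // ?expf_neq0 //.
    by rewrite lgM // lgX //; have := C1; lra.
  by apply: (@sepz 1000%N) => //; have := hDt; have := C1; lra.
move: h; rewrite -(ler_int R) (rmorphM _ 1458) (rmorphM _ `|b|) !rmorphXn /= rmorph_nat => h.
have t00 := absR_gt0 R t0; have G00 := absR_gt0 R G0; have b00 := absR_gt0 R b0.
have h1458 : ln 1458 <= C :> R by exact: ln_const.
have lt6 : ln (`|t|%:~R ^+ 6) = 6 * lg t by exact: ln_absX.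
have lG4 : ln (`|G|%:~R ^+ 4) = 4 * lg G by exact: ln_absX.
move: (`|t|%:~R ^+ 6) (`|G|%:~R ^+ 4) (exprn_gt0 6 t00) (exprn_gt0 4 G00) lt6 lG4 h.
move=> u v u0 v0 lt6 lG4.
have c0 : 0 < 1458 :> R by rewrite ltr0n.
move: (1458 : R) c0 h1458 => cc c0 h1458 h.
have bv : 0 < `|b|%:~R * v by rewrite mulr_gt0.
rewrite -ler_ln ?posrE ?mulr_gt0 // [leRHS]lnM ?posrE // [ln (_ * v)]lnM ?posrE // lt6 lG4 in h.
rewrite -[ln `|b|%:~R]/(lg b) in h.
by have := C1; lra.
Qed.
End Domination.

(** * The cubic form on the plane of two consecutive minimal points *)

Lemma absorb_small (R : realFieldType) (g K u v v' : R) :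
  g <= 1000 * K * (u + v + v') -> 1 <= g -> 10000 * K * v <= 1 ->
  10000 * K * v' <= 1 -> 0 <= K * u -> g <= 2000 * K * u.
Proof. lra. Qed.

Section OneState.
Variables (R : realType) (xi : R) (x y z : pt) (s t : int) (C lB' : R).
Local Notation err := (err xi).
Local Notation lg := (lg R).
Local Notation X := ((p0 x)%:~R : R).
Local Notation Y := ((p0 y)%:~R : R).
Local Notation B := ((p0 z)%:~R : R).
Local Notation L := (err x).
Local Notation L' := (err y).
Local Notation lX := (ln X).
Local Notation lY := (ln Y).
Local Notation lB := (ln B).
Local Notation k := (- ln L).
Local Notation k' := (- ln L').
Let K : R := (1 + `|xi|) ^+ 2.
(** Every constant of the estimates is at most [M], so a gap [C] between logarithms absorbs any of
    them. *)
Let M : R := 10000 * K ^+ 2.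
Hypotheses (bx : best xi x) (nxz : next_best xi x z) (by_ : best xi y).
Hypotheses (Ey : y = lin s x t z) (cst : coprimez s t) (t0 : t != 0).
Hypotheses (a0 : cub x != 0) (d0 : cub y != 0).
Hypotheses (xy : p0 x <= p0 y) (eyx : L' <= L) (ex : 0 < L) (ey : 0 < L').
Hypothesis hbase : base C lX lB k lY lB' k' (lg t).
Hypothesis hC : ln M <= C.

Let K1 : 1 <= K.
Proof. by rewrite /K; have := normr_ge0 xi; nra. Qed.
Let K0 : 0 < K. Proof. exact: lt_le_trans K1. Qed.
Let K2 : K <= K ^+ 2.
Proof. by rewrite expr2 ler_peMl // ltW. Qed.
Let M1 : 10000 <= M.
Proof. by rewrite /M ler_peMr ?ler0n // (le_trans K1). Qed.
Let X1 : 1 <= X. Proof. by rewrite ler1z -gtz0_ge1; case: bx. Qed.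
Let Y1 : 1 <= Y. Proof. by rewrite ler1z -gtz0_ge1; case: by_. Qed.
Let X0 : 0 < X. Proof. exact: lt_le_trans X1. Qed.
Let Y0 : 0 < Y. Proof. exact: lt_le_trans Y1. Qed.
Let XY : X <= Y. Proof. by rewrite ler_int. Qed.
Let L1 : L <= 1. Proof. by have := best_half bx; lra. Qed.
Let L1' : L' <= 1. Proof. exact: le_trans eyx L1. Qed.

Let lnE (u v : R) m n : 0 < u -> 0 < v ->
  ln (u ^+ m * v ^+ n) = m%:R * ln u + n%:R * ln v.
Proof.
move=> u0 v0; have um := exprn_gt0 m u0; have vn := exprn_gt0 n v0.
by rewrite lnM ?posrE // (lnXn m u0) (lnXn n v0) !mulr_natl.
Qed.

Let sep (u v : R) : 0 < u -> 0 < v -> ln u + C <= ln v -> M * u <= v.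
Proof. exact: (ln_sep _ M1 hC). Qed.

Lemma sqrX_errY_le : X ^+ 2 * L' ^+ 1 <= Y ^+ 1 * L ^+ 2.
Proof.
rewrite -ler_ln ?posrE ?mulr_gt0 ?exprn_gt0 // !lnE //.
by have := base_sqrX_errY hbase; lra.
Qed.

Lemma mixed_terms_small : M * ((X ^+ 3 * Y ^+ 1) * (L ^+ 1 * L' ^+ 1)) <= 1 /\
  M * (X ^+ 4 * L' ^+ 2) <= 1.
Proof.
have [h1 h2] := base_mixed_terms hbase; have C1 := base_C hbase.
split; apply: sep; rewrite ?mulr_gt0 ?exprn_gt0 //.
  by rewrite lnM ?posrE ?mulr_gt0 ?exprn_gt0 // !lnE // ln1; lra.
by rewrite lnE // ln1; lra.
Qed.

Lemma X_sqr_err_small : M * (X ^+ 1 * L ^+ 2) <= 1.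
Proof.
have [h1 h2] := base_X_sqr_err hbase; have C1 := base_C hbase.
by apply: sep; rewrite ?mulr_gt0 ?exprn_gt0 // lnE // ln1; lra.
Qed.

Lemma lnM_const (c : R) : 0 < c -> c <= M -> ln c <= C.
Proof. by move=> c0 cM; apply: le_trans hC; rewrite ler_ln ?posrE // (lt_le_trans c0). Qed.

Let KM : 10000 * K <= M.
Proof. by rewrite /M ler_pM2l ?ltr0n. Qed.

Lemma al_le : lg (cub x) <= 2 * lX - k + C.
Proof.
have h := cub_bound X1 L1; rewrite -/K -intr_norm in h.
apply: le_trans (lg_le_ln a0 h) _.
have K8 : 0 < 8 * K by rewrite mulr_gt0.
rewrite -[L]expr1 in h *; rewrite lnM ?posrE ?mulr_gt0 ?exprn_gt0 // lnE //.
have K8M : 8 * K <= M by have := K0; have := KM; lra.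
by have := lnM_const K8 K8M; rewrite expr1; lra.
Qed.

Lemma de_le : lg (cub y) <= 2 * lY - k' + C.
Proof.
have h := cub_bound Y1 L1'; rewrite -/K -intr_norm in h.
apply: le_trans (lg_le_ln d0 h) _.
have K8 : 0 < 8 * K by rewrite mulr_gt0.
rewrite -[L']expr1 in h *; rewrite lnM ?posrE ?mulr_gt0 ?exprn_gt0 // lnE //.
have K8M : 8 * K <= M by have := K0; have := KM; lra.
by have := lnM_const K8 K8M; rewrite expr1; lra.
Qed.

Local Notation a := ((cub x)%:~R : R).
Local Notation b := (pol x y).
Local Notation G := (pol x y ^+ 2 - 4 * cub x * pol y x).
Local Notation w := (wpt x y).

Lemma wpt_p0_le : `|(p0 w)%:~R : R| <= 26 * K * (X * Y * L ^+ 2).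
Proof.
have h := wpt_p0 X1 XY L1; rewrite -/K in h; apply: le_trans h _.
have h := ler_wpM2l (ltW X0) sqrX_errY_le; rewrite !expr1 in h.
have h' := ler_wpM2l (ltW K0) h; lra.
Qed.

Let a1 : 1 <= `|a|.
Proof. by rewrite -intr_norm absR_ge1. Qed.

Let w0E : (p0 w)%:~R = b%:~R * X - 2 * a * Y :> R.
Proof. by rewrite /wpt /= rmorphD !rmorphM rmorphN /=; ring. Qed.

Lemma wpt_p0_small : `|(p0 w)%:~R : R| <= Y / 100.
Proof.
apply: le_trans wpt_p0_le _.
have h := X_sqr_err_small; rewrite expr1 in h.
have XL : 0 <= X * L ^+ 2 by rewrite mulr_ge0 ?exprn_ge0 // ltW.
have h2 := ler_wpM2r XL KM.
have h3 : 26 * K * (X * L ^+ 2) <= 1 / 100.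
  by have K3 := mulr_ge0 (ltW K0) XL; lra.
by have := ler_wpM2l (ltW Y0) h3; lra.
Qed.

(** The first coordinate b X - 2 a Y of [w] is at most Y / 100 while |a| is at least 1, so b X is
    close to 2 a Y. *)
Lemma b_bounds : b != 0 /\ `|b%:~R| * X <= 3 * `|a| * Y.
Proof.
have h := wpt_p0_small; rewrite w0E in h.
have aY : Y <= `|a| * Y by rewrite ler_peMl // ltW.
have E : `|2 * a * Y| = 2 * `|a| * Y by rewrite !normrM normr_nat (gtr0_norm Y0).
have Eb : `|b%:~R * X| = `|b%:~R| * X by rewrite normrM (gtr0_norm X0).
have h1 := ler_normB (2 * a * Y) (2 * a * Y - b%:~R * X).
have h2 := ler_normD (b%:~R * X - 2 * a * Y) (2 * a * Y).
rewrite subrK Eb E in h2; have Yp := Y0; split; last by lra.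
apply: contraTneq h => ->; rewrite mul0r sub0r normrN E -ltNge.
lra.
Qed.

Lemma be_le : lg b <= lg (cub x) + lY - lX + C.
Proof.
have [b0 h] := b_bounds.
have C3 : ln 3 <= C :> R.
  by apply: lnM_const; rewrite ?ltr0n // (le_trans _ M1) // ler_nat.
rewrite -!intr_norm in h.
have h0 : 0 < `|b|%:~R * X by rewrite mulr_gt0 // absR_gt0.
have a00 := absR_gt0 R a0; have b00 := absR_gt0 R b0.
rewrite -ler_ln ?posrE ?mulr_gt0 // in h.
rewrite !lnM ?posrE ?mulr_gt0 // in h.
by rewrite /lg; lra.
Qed.

Lemma err_wpt_le : X * err w <= 5 * `|a| * (Y * L).
Proof.
have h := wpt_err xi x y.
have [_ hb] := b_bounds; apply: le_trans (ler_wpM2l (ltW X0) h) _.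
have h1 := ler_wpM2r (ltW ex) hb.
have h2 : X * L' <= Y * L by rewrite ler_pM // ltW.
have h3 := ler_wpM2l (normr_ge0 a) h2.
lra.
Qed.

(** A nonzero integer is at least 1, so the two mixed terms of [disc_bound], both tiny, are absorbed
    by the main one. *)
Lemma G_le : G != 0 -> `|G%:~R : R| <= 2000 * K ^+ 2 * (Y ^+ 2 * L ^+ 4).
Proof.
move=> G0; have h := disc_bound X1 XY L1 eyx; rewrite -/K in h.
have [h1 h2] := mixed_terms_small.
have G1 : 1 <= `|G%:~R : R| by rewrite -intr_norm absR_ge1.
rewrite !expr1 in h1; apply: (absorb_small h G1 h1 h2).
by rewrite !mulr_ge0 ?exprn_ge0 // ltW.
Qed.

Lemma ga_le : G != 0 -> lg G <= 2 * lY - 4 * k + C /\ 2 * k - 10 * C <= lY.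
Proof.
move=> G0; have h := G_le G0; rewrite -intr_norm in h.
have h1 := lg_le_ln G0 h; have g0 := lg_ge0 R G0.
have c0 : 0 < 2000 * K ^+ 2 by rewrite mulr_gt0 ?ltr0n ?exprn_gt0.
have cM : 2000 * K ^+ 2 <= M by rewrite /M ler_pM2r ?exprn_gt0 // ler_nat.
have h2 := lnM_const c0 cM; have C1 := base_C hbase.
move: (2000 * K ^+ 2) c0 h1 h2 => c c0.
rewrite lnM ?posrE ?mulr_gt0 ?exprn_gt0 // lnE // => h1 h2.
by split; lra.
Qed.

Section DoubleRoot.
Variable c : R.
Hypotheses (c0 : 0 < c) (cC : - ln c <= C).
Hypothesis c_le : forall v, nz v -> c <= err v * Num.max 1 ((p0 v)%:~R ^+ 2).

(** [w] is 2 g p V for the nonzero lattice vector V = q x - p y. Hence P = |g p| is O(X Y L^2), and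
    since t divides 3 g with |g| <= P the first bound follows. The second comes from [c_le] at V,
    using P^3 / |a| = P |g| >= g^2. *)
Lemma double_root : G = 0 -> - 10 * C <= lX + lB - 2 * k /\
  5 * k - 2 * lB - lX - 10 * C <= lY.
Proof.
move/eqP; rewrite subr_eq0 => /eqP; rewrite [in pol x _]Ey [in pol _ x]Ey.
rewrite pol_linr pol_linl => /(dvd_double_root a0 t0 cst) [g [p [q [Ea Eb td]]]].
rewrite -pol_linr -Ey in Eb.
have g0 : g != 0 by apply: contraNneq a0 => g0; rewrite Ea g0 mul0r.
have pn0 : p != 0 by apply: contraNneq a0 => pz; rewrite Ea pz expr0n /= mulr0.
pose V := lin q x (- p) y.
have gp0 : g * p != 0 by rewrite mulf_neq0.
pose P : R := `|g * p|%:~R.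
have P1 : 1 <= P by rewrite absR_ge1.
have P0 : 0 < P := lt_le_trans ltr01 P1.
have r2 : `|(2 * (g * p))%:~R| = 2 * P :> R.
  by rewrite rmorphM /= normrM normr_nat -intr_norm.
have Vw0 : (p0 w)%:~R = (2 * (g * p))%:~R * (p0 V)%:~R :> R.
  by rewrite -rmorphM; congr (_%:~R); rewrite /= Eb Ea; ring.
have hV0 : P * `|(p0 V)%:~R| <= 20 * K * (X * Y * L ^+ 2).
  have := wpt_p0_le; rewrite Vw0 normrM r2.
  have : 0 <= K * (X * Y * L ^+ 2) by rewrite !mulr_ge0 ?exprn_ge0 // ltW.
  by move: (`|(p0 V)%:~R|) => v; lra.
have heV : X * (2 * P * err V) <= 5 * `|a| * (Y * L).
  have <- : err w = 2 * P * err V; last exact: err_wpt_le.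
  rewrite -r2; apply: err_scale => //; rewrite -rmorphM; congr (_%:~R);
    by rewrite /= Eb Ea; ring.
have heV' : P * err V <= 20 * K * (X * Y * L ^+ 2).
  have := cub_bound X1 L1; rewrite -/K => ha.
  have YL : 0 <= Y * L by rewrite mulr_ge0 // ltW.
  have := ler_wpM2r YL ha => h.
  rewrite -(ler_pM2l X0); move: heV h; move: (`|a|) => u; lra.
have Vnz : nz V.
  apply/negPn/negP => /nzPn[/= v0 v1 v2].
  have pt0 : p * t != 0 by rewrite mulf_neq0.
  have y0 : p0 y = s * p0 x + t * p0 z by rewrite Ey.
  have y1 : p1 y = s * p1 x + t * p1 z by rewrite Ey.
  have y2 : p2 y = s * p2 x + t * p2 z by rewrite Ey.
  rewrite y0 in v0; rewrite y1 in v1; rewrite y2 in v2.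
  have := next_minor bx nxz; apply/negP; rewrite negb_or !negbK.
  apply/andP; split; apply/eqP; apply: (mulfI pt0); rewrite mulr0.
    transitivity (p1 x * (q * p0 x + - p * (s * p0 x + t * p0 z))
      - p0 x * (q * p1 x + - p * (s * p1 x + t * p1 z))); first ring.
    by rewrite v0 v1 !mulr0 subr0.
  transitivity (p2 x * (q * p0 x + - p * (s * p0 x + t * p0 z))
      - p0 x * (q * p2 x + - p * (s * p2 x + t * p2 z))); first ring.
  by rewrite v0 v2 !mulr0 subr0.
set U := 20 * K * (X * Y * L ^+ 2) in hV0 heV'.
(* Either V has nonzero first coordinate, which is then at least 1 in absolute value, or its error
   is at least 1. *)
have PU : P <= U.
  have [v0|v0] := eqVneq (p0 V) 0.
    by apply: le_trans heV'; rewrite ler_peMr ?(ltW P0) // err_p0_eq0.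
  by apply: le_trans hV0; rewrite ler_peMr ?(ltW P0) // -intr_norm absR_ge1.
have U0 : 0 < U := lt_le_trans P0 PU.
have C1 := base_C hbase.
have K20 : 0 < 20 * K by rewrite mulr_gt0.
have lU : ln U <= C + lX + lY - 2 * k.
  rewrite /U lnM ?posrE ?mulr_gt0 ?exprn_gt0 // -[X * Y]expr1 lnE ?mulr_gt0 //.
  rewrite [ln (X * Y)]lnM ?posrE //.
  have K20M : 20 * K <= M by have := K0; have := KM; lra.
  by have := lnM_const K20 K20M; lra.
have lP : lg g + lg (cub x) = 2 * ln P.
  rewrite -lgM // -[2 * _]lgX //; congr lg.
  by rewrite Ea; ring.
have gP : lg g <= ln P.
  rewrite -[ln P]/(lg (g * p)) lgM // lerDl; exact: lg_ge0.
have tg : lg t <= C + lg g.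
  have C3 : ln 3 <= C :> R.
    by apply: lnM_const; rewrite ?ltr0n // (le_trans _ M1) // ler_nat.
  have E3 : lg (3 * g) = ln 3 + lg g by rewrite lgM // /lg gtr0_norm.
  have : lg t <= lg (3 * g).
    apply: lg_le_ln => //; rewrite ler_int; have /dvdzP[e Ee] := td.
    rewrite Ee normrM ler_peMl // norm_ge1 //; apply: contraTneq isT => e0.
    by move: Ee; rewrite e0 mul0r => /eqP; rewrite mulf_eq0 (negPf g0).
  by rewrite E3; lra.
have PU' : ln P <= ln U by rewrite ler_ln.
have ht := base_tau hbase.
split; first by lra.
clearbody P U.
have h1 : c * P ^+ 2 <= err V * U ^+ 2.
  have := ler_wpM2r (exprn_ge0 2 (ltW P0)) (c_le Vnz).
  move/le_trans; apply; rewrite -mulrA ler_wpM2l ?err_ge0 //.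
  rewrite maxr_pMl ?exprn_ge0 ?(ltW P0) // mul1r ge_max; apply/andP; split.
    by rewrite lerXn2r ?nnegrE ?(ltW P0) ?(ltW U0).
  rewrite -exprMn -[leLHS]real_normK ?num_real // normrM (gtr0_norm P0) mulrC.
  apply: lerXn2r hV0; rewrite nnegrE ?(ltW U0) //.
  by rewrite mulr_ge0 // ltW.
have h2 : X * (c * P ^+ 3) <= 5 * `|a| * (Y * L) * U ^+ 2.
  have h3 := ler_wpM2l (ltW (mulr_gt0 X0 P0)) h1.
  have h4 := ler_wpM2r (exprn_ge0 2 (ltW U0)) heV.
  have h5 : 0 <= X * (P * err V) * U ^+ 2.
    by rewrite !mulr_ge0 ?exprn_ge0 ?err_ge0 // ltW.
  by rewrite exprS; lra.
rewrite -intr_norm in h2.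
have a00 : 0 < `|cub x|%:~R :> R by rewrite absR_gt0.
have lP3 : ln (P ^+ 3) = 3 * ln P by rewrite lnXn // mulr_natl.
have lU2 : ln (U ^+ 2) = 2 * ln U by rewrite lnXn // mulr_natl.
move: (P ^+ 3) (U ^+ 2) (exprn_gt0 3 P0) (exprn_gt0 2 U0) lP3 lU2 h2.
move=> P3 U2 P30 U20 lP3 lU2 h2.
rewrite -ler_ln ?posrE ?mulr_gt0 // in h2.
rewrite !lnM ?posrE ?mulr_gt0 // lP3 lU2 in h2.
have C5 : ln 5 <= C :> R.
  by apply: lnM_const; rewrite ?ltr0n // (le_trans _ M1) // ler_nat.
rewrite -[ln `|cub x|%:~R]/(lg (cub x)) in h2; have cC1 := cC.
lra.
Qed.
End DoubleRoot.

Section SimpleRoots.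
Hypothesis G0 : G != 0.
Hypothesis k_ge : 187 / 100 * lX <= k.
Local Notation D := (cub x ^+ 2 * cub y).

Let D0 : D != 0. Proof. by rewrite mulf_neq0 // expf_neq0. Qed.

Let lgD : lg D = 2 * lg (cub x) + lg (cub y).
Proof. by rewrite lgM ?expf_neq0 // lgX. Qed.

Let F := proj2 (ga_le G0).

Let XYL_t : 10000 * (K * (X * Y * L ^+ 2)) <= `|t|%:~R.
Proof.
have h := base_cusp_small hbase al_le de_le F k_ge.
have t00 := absR_gt0 R t0; have ht := base_tau hbase; have C1 := base_C hbase.
have S0 : 0 < X * Y * L ^+ 2 by rewrite !mulr_gt0 ?exprn_gt0.
have E : ln (X * Y * L ^+ 2) = lX + lY - 2 * k.
  rewrite -[X * Y]expr1 lnE ?mulr_gt0 //.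
  by rewrite [ln (X * Y)]lnM ?posrE //; lra.
have q : ln (X * Y * L ^+ 2) + C <= ln `|t|%:~R.
  by rewrite E -[ln `|t|%:~R]/(lg t); lra.
by have := sep S0 t00 q; have := ler_wpM2r (ltW S0) KM; lra.
Qed.

(** The vector 3 (w - r x) / t is integral by [dvd_cuspidal]. Its first coordinate and its error are
    below 1, so it is zero, although its coefficient - 6 a on [z] is not. *)
Lemma no_cusp : G ^+ 3 + 27 * D ^+ 2 != 0.
Proof.
apply/negP => /eqP/(cuspidal_param D0)[r [EG ED]].
(* From 3 r^2 = |G|; the constant satisfies 3 * 26^2 > 2000. *)
have r_le : `|r%:~R| <= 26 * (K * (Y * L ^+ 2)).
  have S0 : 0 < Y * L ^+ 2 by rewrite !mulr_gt0 ?exprn_gt0.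
  have T0 : 0 <= 26 * (K * (Y * L ^+ 2)) by rewrite mulr_ge0 // mulr_ge0 ?ltW.
  rewrite -(@ler_pXn2r _ 2) ?nnegrE ?normr_ge0 // -normrX.
  have := G_le G0; rewrite {1}EG rmorphM normrM rmorphN normrN rmorphXn /= normr_nat.
  have := exprn_ge0 2 (mulr_ge0 (ltW K0) (ltW S0)).
  have -> : 2000 * K ^+ 2 * (Y ^+ 2 * L ^+ 4) = 2000 * (K * (Y * L ^+ 2)) ^+ 2 by ring.
  rewrite (exprMn 2 26); move: ((K * _) ^+ 2) (`|_ ^+ 2|) => u v; lra.
have Eb := pol_linr s x t z; have Ec := pol_linl s x t z; have Ed := cub_lin s x t z.
rewrite -Ey in Eb Ec Ed.
have /dvdzP[e Ee] : (t %| (3 * (s * cub x - r))%R)%Z.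
  apply: (@dvd_cuspidal (cub x) (pol x z) (pol z x) (cub z) s t r).
    by rewrite -Eb -Ec.
  rewrite -[RHS]ED Ed; ring.
(* This is 3 (w - r x) / t written on the basis [x], [z], with e = 3 (s a - r) / t. *)
pose V := lin (3 * pol x z + e) x (- 6 * cub x) z.
have VE f : (f (lin s x t z) = s * f x + t * f z :> int) ->
  f V = (3 * pol x z + e) * f x + (- 6 * cub x) * f z ->
  f w = pol x y * f x + (- 2 * cub x) * f y ->
  t * f V = 3 * (f w - r * f x).
  move=> E1 -> ->; rewrite -Ey in E1.
  transitivity ((t * (3 * pol x z) + e * t) * f x - 6 * cub x * (t * f z)); first ring.
  by rewrite -Ee E1 Eb; ring.
have V0 := VE p0 erefl erefl erefl; have V1 := VE p1 erefl erefl erefl.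
have V2 := VE p2 erefl erefl erefl.
have t00 := absR_gt0 R t0.
have S0 : 0 < K * (Y * L ^+ 2) by rewrite !mulr_gt0 ?exprn_gt0.
have XS0 : 0 < X * (K * (Y * L ^+ 2)) by rewrite mulr_gt0.
have XYL : 10000 * (X * (K * (Y * L ^+ 2))) <= `|t|%:~R.
  by have -> : X * (K * (Y * L ^+ 2)) = K * (X * Y * L ^+ 2) by ring.
have V00 : p0 V = 0.
  apply: (mulfI t0); rewrite mulr0 V0; apply: (@dvd_small _ t (p0 V)) => //.
  rewrite -(ltr_int R) !intr_norm rmorphM /= rmorphB rmorphM /= normrM normr_nat.
  have h := norm_sub_le wpt_p0_le (norm_mul_le r_le (lexx `|X|)); rewrite (gtr0_norm X0) in h.
  rewrite -intr_norm; move: h XYL XS0; move: (`|_%:~R - _|) => u.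
  have -> : X * (K * (Y * L ^+ 2)) = K * (X * Y * L ^+ 2) by ring.
  have -> : 26 * (K * (Y * L ^+ 2)) * X = 26 * (K * (X * Y * L ^+ 2)) by ring.
  rewrite -mulrA; lra.
have eV : err V < 1.
  have e1 (f : pt -> R) : f V = (3 * pol x z + e)%:~R * f x + (- 6 * cub x)%:~R * f z ->
      f w = (pol x y)%:~R * f x + (- 2 * cub x)%:~R * f y ->
      f y = s%:~R * f x + t%:~R * f z ->
      `|f w| <= err w -> `|f x| <= L -> `|f V| < 1.
    move=> fV fw fy hw hx.
    have fE : t%:~R * f V = 3 * (f w - r%:~R * f x).
      have E2 : e%:~R * t%:~R = 3 * (s%:~R * a - r%:~R) :> R.
        by rewrite -[LHS]rmorphM /= -Ee (rmorphM _ 3) rmorphB (rmorphM _ s).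
      have E3 : b%:~R = t%:~R * (pol x z)%:~R + 3 * s%:~R * a.
        by rewrite Eb rmorphD /= !(rmorphM _ t) (rmorphM _ (3 * s)) (rmorphM _ 3).
      have E4 : (3 * pol x z + e)%:~R = 3 * (pol x z)%:~R + e%:~R :> R.
        by rewrite rmorphD (rmorphM _ 3).
      have E5 n : (- n%:R * cub x)%:~R = - n%:R * a.
        by rewrite (rmorphM _ (- n%:R)) rmorphN rmorph_nat.
      rewrite fw fV fy E3 E4 !E5.
      move: E2; move: (pol x z)%:~R a => P A E2.
      transitivity (t%:~R * 3 * P * f x + (e%:~R * t%:~R) * f x
        - 6 * A * (t%:~R * f z)); first ring.
      by rewrite E2; ring.
    rewrite -(ltr_pM2l t00) mulr1 {1}intr_norm -normrM fE normrM normr_nat.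
    have h := norm_sub_le hw (norm_mul_le r_le hx).
    have h1 := err_wpt_le.
    have YL : 0 <= Y * L by rewrite mulr_ge0 // ltW.
    have ha := cub_bound X1 L1; rewrite -/K in ha.
    have h2 := ler_wpM2r YL ha.
    have h3 : K * (Y * L ^+ 2) * L <= X * (K * (Y * L ^+ 2)).
      by rewrite mulrC ler_wpM2r ?(ltW S0) // (le_trans L1).
    have h4 : err w <= 40 * (X * (K * (Y * L ^+ 2))).
      rewrite -(ler_pM2l X0); apply: le_trans h1 _.
      have -> : X * (40 * (X * (K * (Y * L ^+ 2)))) = 5 * (8 * K * (X ^+ 2 * L) * (Y * L)) by ring.
      by rewrite -mulrA ler_pM2l.
    move: h h3 h4 XYL XS0; rewrite -!mulrA; move: (`|f w - _|) => u; lra.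
  apply: err_lt.
    apply: (e1 (d1 xi)); try exact: d1_lin; try exact: d1_le.
    by rewrite [in LHS]Ey d1_lin.
  apply: (e1 (d2 xi)); try exact: d2_lin; try exact: d2_le.
  by rewrite [in LHS]Ey d2_lin.
have := next_minor bx nxz; apply/negP; rewrite negb_or !negbK.
have [Vnz|/nzPn[/= v0 v1 v2]] := boolP (nz V).
  by have := err_p0_eq0 xi V00 Vnz; rewrite leNgt eV.
have a6 : - 6 * cub x != 0 by rewrite mulf_neq0.
apply/andP; split; apply/eqP; apply: (mulfI a6); rewrite mulr0.
  transitivity (p0 x * p1 V - p1 x * p0 V); first by rewrite /V /=; ring.
  by rewrite /= v0 v1 !mulr0 subr0.
transitivity (p0 x * p2 V - p2 x * p0 V); first by rewrite /V /=; ring.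
by rewrite /= v0 v2 !mulr0 subr0.
Qed.

Let hdh := base_disc_part_small hbase al_le de_le F k_ge.
Let C1 := base_C hbase.

Let D_t : lg D + 10 * C <= lg t. Proof. by rewrite lgD. Qed.

Let Eb := pol_linr s x t z.
Let Ec := pol_linl s x t z.
Let Ed := cub_lin s x t z.

Let EG : G = (t * pol x z + 3 * s * cub x) ^+ 2 - 4 * cub x *
   (t ^+ 2 * pol z x + 2 * t * s * pol x z + 3 * s ^+ 2 * cub x).
Proof. by rewrite [in pol x _]Ey [in pol _ x]Ey Eb Ec. Qed.

Let ED : D = cub x ^+ 2 * (cub x * s ^+ 3 + pol x z * s ^+ 2 * t
   + pol z x * s * t ^+ 2 + cub z * t ^+ 3).
Proof. by rewrite [in cub y]Ey Ed. Qed.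

Let EB : pol x y = t * pol x z + 3 * s * cub x.
Proof. by rewrite [in LHS]Ey Eb. Qed.

Lemma simple_roots_order2 : 228 / 100 * k <= lY.
Proof.
apply: (base_order2 hbase al_le de_le F k_ge (proj1 (ga_le G0))).
have [e Ee] := dvd_order2 (cub x) (pol x z) (pol z x) (cub z) s t.
rewrite -ED -EG in Ee.
exact: (order2_lg M1 hC C1 G0 t0 no_cusp D_t Ee).
Qed.

Hypothesis k_ge2 : 193 / 100 * lX <= k.

Lemma simple_roots_order6 : 17 * k - 6 * lB - lX - 30 * C <= 3 * lY.
Proof.
have f3 := base_order3 hbase al_le de_le F k_ge (proj1 (ga_le G0)) k_ge2 simple_roots_order2 be_le.
have [b0 _] := b_bounds.
have [e2 E2] := dvd_order2b (cub x) (pol x z) (pol z x) (cub z) s t.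
have [e3 E3] := dvd_order3 (cub x) (pol x z) (pol z x) (cub z) s t.
have [e6 E6] := dvd_order6 (cub x) (pol x z) (pol z x) (cub z) s t.
rewrite -ED -EG -EB in E2 E3 E6; rewrite -lgD in f3.
have ht := order3_lg M1 hC C1 G0 D0 t0 no_cusp D_t b0 f3 E2 E3.
have ht' : lg t <= lg G + 10 * C by have := ht; have := C1; lra.
have f9 := base_order6 hbase al_le de_le F k_ge (proj1 (ga_le G0)) k_ge2 simple_roots_order2 be_le ht'.
have fb := base_order6_small hbase al_le de_le F k_ge (proj1 (ga_le G0)) k_ge2 simple_roots_order2 be_le ht'.
apply: f9; rewrite -lgD in fb.
exact: (order6_lg M1 hC C1 G0 D0 t0 D_t b0 E6 ht fb).
Qed.
End SimpleRoots.

Lemma k_le : k <= 2 * lX + C.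
Proof. by have := al_le; have := lg_ge0 R a0; lra. Qed.

Lemma root_dichotomy (c : R) : 0 < c -> - ln c <= C ->
  (forall v, nz v -> c <= err v * Num.max 1 ((p0 v)%:~R ^+ 2)) ->
  (- 10 * C <= lX + lB - 2 * k /\ 5 * k - 2 * lB - lX - 10 * C <= lY) \/
  [/\ 2 * k - 10 * C <= lY, 187 / 100 * lX <= k -> 228 / 100 * k <= lY &
    187 / 100 * lX <= k -> 193 / 100 * lX <= k ->
    17 * k - 6 * lB - lX - 30 * C <= 3 * lY].
Proof.
move=> c0 cC c_le; have [G0|G0] := eqVneq G 0.
  by left; exact: (double_root c0 cC c_le G0).
right; split; first exact: (proj2 (ga_le G0)).
  by move=> h; exact: simple_roots_order2.
by move=> h h'; exact: simple_roots_order6.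
Qed.
End OneState.

(** * Growth of the ratio k / A from plane to plane *)

Section Chain.
Variable R : realType.

(** At the limiting ratio r = 2 the right side exceeds q r (c r - 1) by exactly 3 e. This excess has
    slope between -7 and -6 there: it only grows for r < 2, and up to r = 2 + e / 8 it loses at most
    e. *)
Lemma ratio_gain (q r : R) : let c := 11 - 6 * q in let e := 8 * q ^+ 2 - 20 * q + 7 in
  42 / 100 <= q -> q <= 421 / 1000 -> 0 < e -> 193 / 100 <= r -> r <= 2 + e / 8 ->
  2 * e + q * r * (c * r - 1) <= (c * r - 1) - 3 * (q * r).
Proof.
move=> c e q1 q2 e0 r1 r2.
have E : (c * r - 1) - 3 * (q * r) - q * r * (c * r - 1) =
  3 * e + (r - 2) * ((24 * q ^+ 2 - 52 * q + 11) - q * c * (r - 2)).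
  by rewrite /c /e; ring.
have qc1 : 0 <= q * c by rewrite mulr_ge0 /c //; lra.
have qc2 : q * c <= 4 by rewrite /c; nra.
have e1 : e <= 1 / 10 by rewrite /e; nra.
have d1 : - 7 <= 24 * q ^+ 2 - 52 * q + 11 by nra.
have d2 : 24 * q ^+ 2 - 52 * q + 11 <= - 6 by nra.
suff : - e <= (r - 2) * ((24 * q ^+ 2 - 52 * q + 11) - q * c * (r - 2)) by lra.
move: (24 * q ^+ 2 - 52 * q + 11) d1 d2 => d d1 d2.
move: (q * c) qc1 qc2 => w w1 w2; move: e e0 r2 e1 {E c q1 q2} => e e0 r2 e1.
have [u0|u0] := lerP r 2.
  have : 0 <= (2 - r) * (- d - w * (2 - r)) by rewrite mulr_ge0 //; nra.
  nra.
have : (r - 2) * (- d + w * (r - 2)) <= (e / 8) * 8.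
  by apply: ler_pM; nra.
nra.
Qed.

Variables (A lB k tau : nat -> R) (p C : R).
Let e := 8 * p ^+ 2 - 36 * p + 35.
Hypotheses (p1 : 142 / 100 <= p) (p2 : p <= 1421 / 1000) (e0 : 0 < e).
Hypothesis hb : forall n, base C (A n) (lB n) (k n) (A n.+1) (lB n.+1) (k n.+1) (tau n).
Hypothesis hp : forall n, lB n <= p * k n.
Hypothesis hk : forall n, k n <= 2 * A n + C.
Hypothesis hA : forall n, 48 * C <= e * A n.
Hypothesis dich : forall n,
  (- 10 * C <= A n + lB n - 2 * k n /\ 5 * k n - 2 * lB n - A n - 10 * C <= A n.+1) \/
  [/\ 2 * k n - 10 * C <= A n.+1,
    187 / 100 * A n <= k n -> 228 / 100 * k n <= A n.+1 &
    187 / 100 * A n <= k n -> 193 / 100 * A n <= k n ->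
    17 * k n - 6 * lB n - A n - 30 * C <= 3 * A n.+1].

Let F n := [/\ 2 * k n - 10 * C <= A n.+1,
    187 / 100 * A n <= k n -> 228 / 100 * k n <= A n.+1 &
    187 / 100 * A n <= k n -> 193 / 100 * A n <= k n ->
    17 * k n - 6 * lB n - A n - 30 * C <= 3 * A n.+1].

Let F_step n : F n -> F n.+1.
Proof.
case=> F1 _ _; have := next_not_double_root (hb n) F1.
by case: (dich n.+1) => // -[h _]; rewrite ltNge h.
Qed.

(** The double-root alternative cannot hold twice in a row, and [F] persists once it holds. *)
Let F1 n : F n.+1.
Proof.
elim: n => [|n IH]; last exact: F_step.
case: (dich 0) => [[_ a1]|]; last exact: F_step.
by case: (dich 1) => // -[a2 _]; case: (no_two_double_roots (hb 0) a1 a2).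
Qed.

Let low1 n : 187 / 100 * A n.+2 <= k n.+2.
Proof. by case: (F1 n) => h _ _; have := next_ratio_ge187 (hb n.+1) h. Qed.

Let A0 n : 0 < A n.
Proof. have h := base_big (hb n); have h' := base_C (hb n); lra. Qed.

Let low2 n : 193 / 100 * A n.+3 <= k n.+3.
Proof.
have [h1 h2 _] := F1 n.+1; have h := low1 n.
exact: (next_ratio_ge193 (hb n.+2) (h2 h)).
Qed.

Let F3 n : 17 * k n.+3 - 6 * lB n.+3 - A n.+3 - 30 * C <= 3 * A n.+4.
Proof. by have [_ _ h3] := F1 n.+2; apply: h3; [exact: low1|exact: low2]. Qed.

(** [F3] bounds A_n, hence k_n = r' A_n, in terms of A_(n+1); [base_det] then bounds k_(n+1) from
    below. Of the surplus 2 e in [ratio_gain], one e absorbs the constants (18 C + 30 C), and the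
    other, divided by q (c r' - 1) <= 8, yields e / 8. *)
Let gain n r : r * A n.+3 <= k n.+3 -> (r + e / 8) * A n.+4 <= k n.+4.
Proof.
move=> hr; have Ap := A0 n.+3; have Ap' := A0 n.+4.
pose q := p - 1; pose r' := k n.+3 / A n.+3.
have Er : k n.+3 = r' * A n.+3 by rewrite /r' divfK // gt_eqF.
have rr' : r <= r' by rewrite -(ler_pM2r Ap) -Er.
have eE : 8 * q ^+ 2 - 20 * q + 7 = e by rewrite /q /e; ring.
have r1 : 193 / 100 <= r' by rewrite -(ler_pM2r Ap) -Er low2.
have C1 := base_C (hb 0).
have r2 : r' <= 2 + e / 8.
  by rewrite -(ler_pM2r Ap) -Er; have := hk n.+3; have := hA n.+3; lra.
have p1' := p1; have p2' := p2.
have := @ratio_gain q r'; rewrite eE => /(_ _ _ e0 r1 r2).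
have q1 : 42 / 100 <= q by rewrite /q; lra.
have q2 : q <= 421 / 1000 by rewrite /q; lra.
move/(_ q1 q2); set c := 11 - 6 * q => gn.
have c1 : 8 <= c by rewrite /c; lra.
have c2 : c <= 9 by rewrite /c; lra.
have e1 : e <= 1 / 10 by rewrite -eE; nra.
have cr0 : 0 < c * r' - 1 by nra.
have cr1 : c * r' - 1 <= 18 by nra.
have qr1 : q * r' <= 1 by nra.
have h1 : A n.+4 - q * k n.+3 - C <= q * k n.+4.
  have := base_det (hb n.+3); have := hp n.+3; have := hp n.+4; rewrite /q; lra.
have h2 : (c * r' - 1) * A n.+3 <= 3 * A n.+4 + 30 * C.
  have := F3 n; have := hp n.+3; rewrite -/q; rewrite Er /c /q; lra.
have h3 : (c * r' - 1) * k n.+3 <= r' * (3 * A n.+4 + 30 * C).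
  have r0 : 0 <= r' by lra.
  by have := ler_wpM2l r0 h2; rewrite Er; lra.
have h4 := ler_wpM2l (ltW cr0) h1.
have q0 : 0 <= q by lra.
have h5 := ler_wpM2l q0 h3.
have h6 := ler_wpM2r (ltW Ap') gn.
have h7 : ((c * r' - 1) + 30 * (q * r')) * C <= 48 * C by rewrite ler_wpM2r //; lra.
have h8 := hA n.+4.
have qv0 : 0 < q * (c * r' - 1) by rewrite mulr_gt0 //; lra.
have qv8 : q * (c * r' - 1) <= 8.
  by apply: le_trans (_ : q * 18 <= _); [rewrite ler_wpM2l | lra].
have h9 : (q * (c * r' - 1)) * (r' * A n.+4) + e * A n.+4 <= (q * (c * r' - 1)) * k n.+4.
  move: h4 h5 h6 h7 h8; move: (c * r' - 1) => v; move: (A n.+4) (k n.+4) (k n.+3) => a b d.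
  lra.
have eA : 0 <= e / 8 * A n.+4 by rewrite mulr_ge0 ?(ltW Ap') // divr_ge0 ?(ltW e0).
have h10 := ler_wpM2r eA qv8.
have h11 : (r' + e / 8) * A n.+4 <= k n.+4.
  rewrite -(ler_pM2l qv0); move: h9 h10; move: (q * _) => v.
  move: (A n.+4) (k n.+4) => a b; lra.
by apply: le_trans h11; rewrite ler_pM2r // lerD2r.
Qed.

Lemma chain_absurd : False.
Proof.
have H m : (193 / 100 + m%:R * (e / 8)) * A m.+3 <= k m.+3.
  elim: m => [|m IH]; first by rewrite mul0r addr0; exact: low2.
  have -> : m.+1%:R = m%:R + 1 :> R by rewrite natr1.
  by rewrite [(_ + 1) * _]mulrDl mul1r addrA; exact: gain.
(* After m + 1 steps the increments add up to more than 2, so the ratio exceeds 3.93, against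
   [hk]. *)
pose m := Num.truncn (16 / e); have mE : 16 / e < m.+1%:R := truncnS_gt _.
have e0' := e0; rewrite ltr_pdivrMr // in mE.
have C1 := base_C (hb 0); have := H m.+1; have := hk m.+4; have := A0 m.+4.
have := base_big (hb m.+4).
move: (A m.+4) (k m.+4) => a b h1 h2 h3 h4.
have : (193 / 100 + 2) * a <= (193 / 100 + m.+1%:R * (e / 8)) * a.
  by rewrite ler_pM2r //; lra.
lra.
Qed.
End Chain.

(** Supplies [base_low] for the next state: lB - k is at most (1 - 1 / 1.421) lB, so the remaining
    term of the determinant inequality is at least 0.703 Y - C. *)
Lemma base_low_of_det (R : realFieldType) (C lB k Y d : R) : 0 <= Y ->
  Y <= (lB - k) + d + C -> lB <= 1421 / 1000 * k -> lB <= Y ->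
  703 / 1000 * Y - C <= d.
Proof. lra. Qed.

(** * The chain of planes spanned by minimal points *)

Section Exponent.
Variables (R : realType) (xi : R).
Hypothesis irr : forall n0 n1 n2 : int,
  n0%:~R + n1%:~R * xi + n2%:~R * xi ^+ 3 = 0 -> [/\ n0 = 0, n1 = 0 & n2 = 0].
Local Notation err := (err xi).
Local Notation lg := (lg R).
Variable X : nat -> pt.
Hypothesis bX : forall i, best xi (X i).
Hypothesis nX : forall i, next_best xi (X i) (X i.+1).
Local Notation lX := (lX R X).
Local Notation lK := (lK xi X).

Definition state i j s t := [/\ (i < j)%N, X j = lin s (X i) t (X i.+1),
  coprimez s t, t != 0 & det3 (X i) (X i.+1) (X j.+1) != 0].

Lemma state_ex i : exists js : nat * (int * int), state i js.1 js.2.1 js.2.2.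
Proof.
have [j [ij dj dj']] := next_state irr bX nX i.
have [s [t E]] := lattice_basis (bX i) (nX i) dj.
exists (j, (s, t)); split=> //=.
  exact: coprime_coords (bX j) (errX_gt0 nX j) E.
(* If t = 0, coprimality gives s = 1 or s = -1, so X_j would be X_i up to sign. *)
apply/eqP => t0; have cst := coprime_coords (bX j) (errX_gt0 nX j) E.
have := p0_lt nX ij; rewrite E t0 /= mul0r addr0; have := p0_gt0 bX i.
move: cst; rewrite t0 /coprimez gcdz0; move: (p0 (X i)) => u.
case: (lerP 0 s) => s0; [rewrite gez0_abs //|rewrite ltz0_abs //] => /eqP E1.
  by rewrite E1 mul1r ltxx.
have -> : s = -1 by rewrite -[s]opprK E1.
lia.
Qed.

Section OneStep.
Variables (i j : nat) (s t : int) (C : R).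
Hypotheses (st : state i j s t) (C24 : ln 24 <= C).

Let P0 n : 0 < (p0 (X n))%:~R :> R. Proof. by rewrite ltr0z (p0_gt0 bX). Qed.
Let E0 n : 0 < err (X n). Proof. exact: errX_gt0. Qed.

Let coord : (p0 (X j))%:~R <= 4 * (p0 (X i.+1))%:~R * `|t|%:~R :> R.
Proof.
case: st => ij E cst t0 dn; rewrite intr_norm.
exact: coord_lower (nX i) (bX i) E (E0 i) (ltW (err_lt_seq nX ij)) t0 (p0_le nX ij).
Qed.

Lemma state_tau : lX j - lX i.+1 - C <= lg t.
Proof.
case: st => ij E cst t0 dn; have t00 := absR_gt0 R t0.
have h := coord; have h4 : ln 4 <= ln 24 :> R by rewrite ler_ln ?posrE ?ltr0n // ler_nat.
rewrite -ler_ln ?posrE ?mulr_gt0 // !lnM ?posrE ?mulr_gt0 // in h.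
by have := C24; rewrite /lX /lg; lra.
Qed.

Lemma state_det : lX j <= (lX i.+1 - lK i) + (lX j.+1 - lK j) + C.
Proof.
case: st => ij E cst t0 dn.
have h := det_lower E (p0_gt0 bX i) (p0_le nX (ltnW ij)) (ltW (p0_step nX j))
  (ltW (err_lt_seq nX (ltnSn j))) (err_le_seq nX (ltnW ij)) dn.
rewrite -intr_norm in h.
have B4 : 0 <= 4 * (p0 (X i.+1))%:~R :> R by rewrite mulr_ge0 // ltW.
have := le_trans coord (ler_wpM2l B4 h).
have -> : 4 * (p0 (X i.+1))%:~R * (6 * ((p0 (X j.+1))%:~R * err (X i) * err (X j)))
  = 24 * ((p0 (X i.+1))%:~R * ((p0 (X j.+1))%:~R * (err (X i) * err (X j)))) by ring.
move=> {}h.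
have c0 : 0 < 24 :> R by rewrite ltr0n.
rewrite -ler_ln ?posrE ?mulr_gt0 // in h.
have := C24; rewrite /lX /lK => C24'.
rewrite lnM ?posrE ?mulr_gt0 // lnM ?posrE ?mulr_gt0 // lnM ?posrE ?mulr_gt0 // lnM ?posrE // in h.
lra.
Qed.
End OneStep.

Variables (p : R) (N0 : nat).
Let e := 8 * p ^+ 2 - 36 * p + 35.
Hypotheses (p1 : 142 / 100 <= p) (p2 : p <= 1421 / 1000) (e0 : 0 < e).
Hypothesis Hp : forall i, (N0 <= i)%N -> lX i.+1 <= p * lK i.

Let Hp' i : (N0 <= i)%N -> lX i.+1 <= 1421 / 1000 * lK i.
Proof.
move=> Ni; apply: le_trans (Hp Ni) _; rewrite ler_wpM2r //.
exact: lK_ge0.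
Qed.

Lemma exponent_absurd : False.
Proof.
have [c c0 c_le] := err_lower bX nX Hp'.
have [N1 cubN] := cub_eventually bX nX Hp'.
pose M : R := 10000 * ((1 + `|xi|) ^+ 2) ^+ 2.
have M1 : 10000 <= M.
  rewrite /M ler_peMr ?ler0n // -exprM exprn_ege1 // lerDl.
  exact: normr_ge0.
pose C : R := 1 + `|ln M| + `|ln c|.
have CM : ln M <= C.
  by have := ler_norm (ln M); have := normr_ge0 (ln c); rewrite /C; lra.
have Cc : - ln c <= C.
  by have := ler_norm (- ln c); have := normr_ge0 (ln M); rewrite normrN /C; lra.
have C1 : 1 <= C.
  by have := normr_ge0 (ln c); have := normr_ge0 (ln M); rewrite /C; lra.
have C24 : ln 24 <= C.
  have h : 24 <= M by apply: le_trans M1; rewrite ler_nat.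
  by apply: le_trans CM; rewrite ler_ln ?posrE ?ltr0n ?(lt_le_trans _ h) ?ltr0n.
clearbody C.
have [N2 lXN2] := lX_large bX nX (100 * (100 * C)).
have [N3 lXN3] := lX_large bX nX (48 * C / e).
pose N := maxn N0 (maxn N1 (maxn N2 N3)).
pose nxt i := (projT1 (cid (state_ex i))).1.
pose I n := iter n nxt N.
have H n : exists st : int * int, state (I n) (I n.+1) st.1 st.2.
  rewrite /I iterS -/(I n) /nxt; case: cid => -[j st] /= h; by exists st.
pose S n := projT1 (cid (H n)); have hS n : state (I n) (I n.+1) (S n).1 (S n).2 := projT2 (cid (H n)).
clearbody S.
have IN n : (N <= I n)%N.
  by elim: n => // n IH; case: (hS n) => h *; apply: leq_trans IH (ltnW h).
have In n : [/\ (N0 <= I n)%N, (N1 <= I n)%N, (N2 <= I n)%N & (N3 <= I n)%N].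
  by have := IN n; rewrite /N !geq_max => /and4P[].
(* The chain starts at [I 1], because [base_low] for a state comes from the determinant inequality
   of the preceding one. *)
have hb n : base C (lX (I n.+1)) (lX (I n.+1).+1) (lK (I n.+1)) (lX (I n.+2))
    (lX (I n.+2).+1) (lK (I n.+2)) (lg (S n.+1).2).
  have [a1 a2 a3 a4] := In n.+1; have [b1 b2 b3 b4] := In n.+2.
  have [d1 d2 d3 d4] := In n.
  case: (hS n.+1) => ij *; case: (hS n) => ij' *.
  split=> //.
  - exact: state_tau (hS n.+1) C24.
  - exact: state_det (hS n.+1) C24.
  - exact: Hp'.
  - exact: Hp'.
  - exact: lX_le.
  - exact: lX_le.
  - exact: lX_le.
  - exact: base_low_of_det (lX_ge0 bX _) (state_det (hS n) C24) (Hp' d1) (lX_le bX nX ij').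
  - exact: lXN2.
apply: (@chain_absurd R (fun n => lX (I n.+1)) (fun n => lX (I n.+1).+1)
  (fun n => lK (I n.+1)) (fun n => lg (S n.+1).2) p C) => // n.
- by apply: Hp; case: (In n.+1).
- have [_ a2 _ _] := In n.+1.
  exact: (k_le (bX _) (cubN _ a2) (errX_gt0 nX _) CM).
- have [_ _ _ a4] := In n.+1; have := lXN3 _ a4.
  by rewrite ler_pdivrMr ?[_ * e]mulrC //; exact: e0.
have [_ a2 _ _] := In n.+1; have [_ b2 _ _] := In n.+2.
case: (hS n.+1) => ij E cst t0 _.
exact: (root_dichotomy (bX _) (nX _) (bX _) E cst t0 (cubN _ a2) (cubN _ b2)
  (p0_le nX (ltnW ij)) (err_le_seq nX (ltnW ij)) (errX_gt0 nX _) (errX_gt0 nX _)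
  (hb n) CM c0 Cc c_le).
Qed.
End Exponent.

(** * Transference *)

Section Transference.
Variables (R : realType) (xi : R) (x z : pt).
Hypotheses (bx : best xi x) (nxz : next_best xi x z) (ex : 0 < err xi x).
Local Notation err := (err xi).
Local Notation X := ((p0 x)%:~R : R).
Local Notation B := ((p0 z)%:~R : R).
Local Notation L := (err x).

Lemma lattice_dvd (g m n : int) (w : pt) : g != 0 ->
  g * p0 w = m * p0 x + n * p0 z -> g * p1 w = m * p1 x + n * p1 z ->
  g * p2 w = m * p2 x + n * p2 z -> (g %| n)%Z.
Proof.
move=> g0 e0 e1 e2.
have : det3 x z w = 0.
  apply: (mulfI g0); rewrite mulr0.
  transitivity (p0 x * (p1 z * (g * p2 w) - p2 z * (g * p1 w))
   - p1 x * (p0 z * (g * p2 w) - p2 z * (g * p0 w))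
   + p2 x * (p0 z * (g * p1 w) - p1 z * (g * p0 w))); first by rewrite /det3; ring.
  by rewrite e0 e1 e2; ring.
move/(lattice_basis bx nxz) => [s [t E]].
apply/dvdzP; exists t; move: e0 e1 e2; rewrite E /= => e0 e1 e2.
case/orP: (next_minor bx nxz) => h; apply: (mulIf h).
  apply/eqP; rewrite -subr_eq0; apply/eqP.
  transitivity (p0 x * (m * p1 x + n * p1 z - g * (s * p1 x + t * p1 z))
    - p1 x * (m * p0 x + n * p0 z - g * (s * p0 x + t * p0 z))); first ring.
  by rewrite e0 e1 !subrr !mulr0 subrr.
apply/eqP; rewrite -subr_eq0; apply/eqP.
transitivity (p0 x * (m * p2 x + n * p2 z - g * (s * p2 x + t * p2 z))
  - p2 x * (m * p0 x + n * p0 z - g * (s * p0 x + t * p0 z))); first ring.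
by rewrite e0 e2 !subrr !mulr0 subrr.
Qed.

Lemma best_primitive (g : int) : 0 < g -> (g %| p0 x)%Z -> (g %| p1 x)%Z ->
  (g %| p2 x)%Z -> g = 1.
Proof.
move=> g0 /dvdzP[x0 E0] /dvdzP[x1 E1] /dvdzP[x2 E2].
have [p0x xb] := bx.
have E : L = `|g%:~R| * err (Pt x0 x1 x2).
  by apply: err_scale; rewrite /= ?E0 ?E1 ?E2 rmorphM mulrC.
have x00 : 0 < x0 by move: p0x; rewrite E0 pmulr_lgt0.
have := xb (Pt x0 x1 x2); rewrite /= => /(_ (nz_p0 (w := Pt x0 x1 x2) x00)).
rewrite (gtr0_norm x00) E0 ler_peMr ?(ltW x00) // => h.
have {}h : L <= err (Pt x0 x1 x2) by apply: h; lia.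
have e0 : 0 < err (Pt x0 x1 x2) := lt_le_trans ex h.
move: h; rewrite E -[leRHS]mul1r ler_pM2r // -intr_norm lerz1 gtr0_norm //; lia.
Qed.

(** Let g be the gcd of the minors N0, N1, N2. The vectors z_k x - x_k z have the minors, up to
    sign, as coordinates, so they are divisible by g; by [lattice_dvd] g divides each x_k. As [x] is
    primitive, g = 1, and Bezout coefficients give v. *)
Lemma det_one : exists v, det3 x z v = 1.
Proof.
pose N0 := p1 x * p2 z - p2 x * p1 z.
pose N1 := p2 x * p0 z - p0 x * p2 z.
pose N2 := p0 x * p1 z - p1 x * p0 z.
have Ed v : det3 x z v = N0 * p0 v + N1 * p1 v + N2 * p2 v.
  by rewrite /det3 /N0 /N1 /N2; ring.
have [a [b Eab]] := Bezoutz N0 N1.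
have [c [d Ecd]] := Bezoutz (gcdz N0 N1) N2.
set g := gcdz (gcdz N0 N1) N2 in Ecd.
have g_ge0 : 0 <= g by [].
have /dvdzP[n2 En2] : (g %| N2)%Z := dvdz_gcdr _ _.
have gd : (g %| gcdz N0 N1)%Z := dvdz_gcdl _ _.
have /dvdzP[n0 En0] : (g %| N0)%Z := dvdz_trans gd (dvdz_gcdl _ _).
have /dvdzP[n1 En1] : (g %| N1)%Z := dvdz_trans gd (dvdz_gcdr _ _).
exists (Pt (c * a) (c * b) d).
rewrite Ed /=; transitivity g; first by rewrite -Ecd -Eab; ring.
have gn0 : g != 0.
  apply: contraTneq (next_minor bx nxz) => g0.
  have -> : p0 x * p2 z - p2 x * p0 z = - N1 by rewrite /N1; ring.
  by rewrite -/N2 En1 En2 g0 !mulr0 oppr0 eqxx.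
have g0 : 0 < g by rewrite lt0r gn0.
apply: best_primitive => //; rewrite -rpredN.
- apply: (@lattice_dvd g (p0 z) _ (Pt 0 (- n2) n1) gn0) => /=.
  + by rewrite mulr0; ring.
  + by rewrite mulrN mulrC -En2 /N2; ring.
  + by rewrite mulrC -En1 /N1; ring.
- apply: (@lattice_dvd g (p1 z) _ (Pt n2 0 (- n0)) gn0) => /=.
  + by rewrite mulrC -En2 /N2; ring.
  + by rewrite mulr0; ring.
  + by rewrite mulrN mulrC -En0 /N0; ring.
apply: (@lattice_dvd g (p2 z) _ (Pt (- n1) n0 0) gn0) => /=.
- by rewrite mulrN mulrC -En1 /N1; ring.
- by rewrite mulrC -En0 /N0; ring.
- by rewrite mulr0; ring.
Qed.

Let X0 : 0 < X. Proof. by rewrite ltr0z; case: bx. Qed.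
Let XB : X < B. Proof. by rewrite ltr_int; case: nxz. Qed.
Let B0 : 0 < B. Proof. exact: lt_trans XB. Qed.
Let Lz : err z <= L. Proof. by apply: ltW; case: nxz. Qed.
Let Lz0 : 0 <= err z. Proof. exact: err_ge0. Qed.

(* For each coordinate the minor is [B d(x) - X d(z)]; one of them is at least
   [(B - X) L], and since [z - x] is too short to beat [x], one of them is at
   least [X L]. *)
Lemma minor_large : B * L / 2 <= `|X * d1 xi z - B * d1 xi x| \/
  B * L / 2 <= `|X * d2 xi z - B * d2 xi x|.
Proof.
have [h|h] := leP X (B / 2).
  have key (f : pt -> R) : `|f z| <= err z -> `|f x| = L ->
      B * L / 2 <= `|X * f z - B * f x|.
    move=> fz fx; have := ler_normB (B * f x + (X * f z - B * f x)) (X * f z - B * f x).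
    have -> : B * f x + (X * f z - B * f x) = X * f z by ring.
    have -> : X * f z - (X * f z - B * f x) = B * f x by ring.
    rewrite !normrM fx (gtr0_norm B0) (gtr0_norm X0) => h1.
    have h2 : X * `|f z| <= B / 2 * L by rewrite ler_pM ?(ltW X0) // (le_trans fz).
    by lra.
  have [le|le] := leP `|d2 xi x| `|d1 xi x|; [left|right]; apply: key;
    rewrite ?d1_le ?d2_le // /err; apply/esym.
    exact/max_idPl.
  by apply/max_idPr; exact: ltW.
have key (f : pt -> R) : `|f z| <= err z -> `|f x| <= L -> L <= `|f z - f x| ->
    B * L / 2 <= `|X * f z - B * f x|.
  move=> fz fx fzx.
  have := ler_normD (X * f z - B * f x) ((B - X) * f z).
  have -> : X * f z - B * f x + (B - X) * f z = B * (f z - f x) by ring.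
  rewrite !normrM (gtr0_norm B0) [`|B - X|]gtr0_norm ?subr_gt0 // => h1.
  have BX0 : 0 <= B - X by rewrite subr_ge0 ltW.
  have h2 := ler_wpM2l BX0 (le_trans fz Lz); have h3 := ler_wpM2l (ltW B0) fzx.
  have h4 := ler_wpM2r (ltW ex) (ltW h).
  by lra.
pose w := lin 1 z (-1) x.
have w0 : 0 < p0 w by rewrite /w /=; case: nxz => h1 *; lia.
have : L <= err w.
  case: nxz => h1 _; apply; first exact: nz_p0.
  by rewrite gtr0_norm // /w /=; have [x0 _] := bx; lia.
have E1 : d1 xi w = d1 xi z - d1 xi x by rewrite d1_lin mul1r rmorphN mulN1r.
have E2 : d2 xi w = d2 xi z - d2 xi x by rewrite d2_lin mul1r rmorphN mulN1r.
have -> : err w = Num.max `|d1 xi w| `|d2 xi w| by [].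
rewrite le_max E1 E2.
case/orP => le; [left|right]; apply: key; rewrite ?d1_le ?d2_le //.
Qed.

Let reduce (v : pt) (q1 q2 : R) : det3 x z v = 1 -> `|q1| <= 2 / (B * L) ->
  `|q2| <= 2 / (B * L) -> (exists a b, [/\ (p0 v)%:~R = a * X + b * B,
   (p1 v)%:~R = q1 + a * (p1 x)%:~R + b * (p1 z)%:~R &
   (p2 v)%:~R = q2 + a * (p2 x)%:~R + b * (p2 z)%:~R]) ->
  exists v, [/\ det3 x z v = 1, `|(p0 v)%:~R| <= B & err v <= 2 / (B * L) + L].
Proof.
move=> dv q1s q2s [a [b [e0 e1 e2]]].
have [s hs] := near_int a; have [t ht] := near_int b.
exists (lin 1 v (-1) (lin s x t z)).
have hs' : `|a - s%:~R| <= 1 / 2 by rewrite distrC.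
have ht' : `|b - t%:~R| <= 1 / 2 by rewrite distrC.
split; first by transitivity (det3 x z v); rewrite // /det3 /=; ring.
  have -> : (p0 (lin 1 v (-1) (lin s x t z)))%:~R = (a - s%:~R) * X + (b - t%:~R) * B.
    by rewrite /= !(rmorphD, rmorphM, rmorphN) /= e0; ring.
  have := norm_add_le (norm_mul_le hs' (lexx `|X|)) (norm_mul_le ht' (lexx `|B|)).
  by rewrite (gtr0_norm X0) (gtr0_norm B0); have := XB; lra.
have key (f : pt -> R) q : `|f x| <= L -> `|f z| <= L -> `|q| <= 2 / (B * L) ->
    f (lin 1 v (-1) (lin s x t z)) = q + (a - s%:~R) * f x + (b - t%:~R) * f z ->
    `|f (lin 1 v (-1) (lin s x t z))| <= 2 / (B * L) + L.
  by move=> fx fz hq ->; have := norm_add_le (norm_add_le hq (norm_mul_le hs' fx)) (norm_mul_le ht' fz); lra.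
have z1 := le_trans (d1_le xi z) Lz; have z2 := le_trans (d2_le xi z) Lz.
apply: err_le.
  apply: (key _ q1) => //; first exact: d1_le.
  by rewrite /d1 /= !(rmorphD, rmorphM, rmorphN) /= e0 e1; ring.
apply: (key _ q2) => //; first exact: d2_le.
by rewrite /d2 /= !(rmorphD, rmorphM, rmorphN) /= e0 e2; ring.
Qed.

(** Modulo the real plane of [x] and [z], v is a coordinate vector divided, up to sign, by a minor
    of absolute value at least B L / 2. Subtracting the nearest integral combination of [x] and [z]
    keeps the determinant. *)
Lemma det_one_short :
  exists v, [/\ det3 x z v = 1, `|(p0 v)%:~R| <= B & err v <= 2 / (B * L) + L].
Proof.
have [v dv] := det_one.
have dvR : (det3 x z v)%:~R = 1 :> R by rewrite dv.
move: dvR; rewrite /det3 !(rmorphD, rmorphB, rmorphM) /= => dvR.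
have BL0 : 0 < B * L by rewrite mulr_gt0.
have z0 : `|0 : R| <= 2 / (B * L) by rewrite normr0 divr_ge0 // ltW.
have inv_le (n : R) : B * L / 2 <= `|n| -> n != 0 /\ `|n^-1| <= 2 / (B * L).
  move=> h; have n0 : 0 < `|n| by apply: lt_le_trans h; rewrite divr_gt0.
  split; first by rewrite -normr_gt0.
  rewrite normfV -[2 / _]invf_div lef_pV2 ?posrE // divr_gt0 //.
case: minor_large => /inv_le[].
  have -> : X * d1 xi z - B * d1 xi x = X * (p1 z)%:~R - (p1 x)%:~R * B.
    by rewrite /d1; ring.
  set n := _ - _ => n0 hn; apply: (reduce dv z0 hn).
  exists (((p0 v)%:~R * (p1 z)%:~R - (p1 v)%:~R * B) / n),
    ((X * (p1 v)%:~R - (p1 x)%:~R * (p0 v)%:~R) / n).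
  split; apply: (mulIf n0); rewrite !mulrDl ?mul0r ![_ / n * _ * n]mulrAC ?divfK // ?mulVf //.
  - by rewrite /n; ring.
  - by rewrite /n; ring.
  - by rewrite /n; move: dvR; lra.
have -> : X * d2 xi z - B * d2 xi x = X * (p2 z)%:~R - (p2 x)%:~R * B.
  by rewrite /d2; ring.
set n := _ - _ => n0 hn; apply: (@reduce v (- n^-1) 0 dv _ z0); first by rewrite normrN.
exists (((p0 v)%:~R * (p2 z)%:~R - (p2 v)%:~R * B) / n),
  ((X * (p2 v)%:~R - (p2 x)%:~R * (p0 v)%:~R) / n).
split; apply: (mulIf n0); rewrite !mulrDl ?mul0r ![_ / n * _ * n]mulrAC ?divfK // ?mulNr ?mulVf //.
- by rewrite /n; ring.
- by rewrite /n; move: dvR; lra.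
- by rewrite /n; ring.
Qed.

(** Rounding the values of the form c at [x], [z], [v] determines an integral form u, because the
    determinant is 1. On the dual basis, u - c has coefficients at most 1/2, and the minors are
    bounded by means of the errors. *)
Lemma transfer (c0 c1 c2 : R) : B * L ^+ 2 <= 4 -> exists u0 u1 u2 : int,
  [/\ `|u1%:~R - c1| <= 14 / L, `|u2%:~R - c2| <= 14 / L &
   `|(u0%:~R - c0) + xi * (u1%:~R - c1) + xi ^+ 3 * (u2%:~R - c2)| <= 16 / B].
Proof.
move=> BLL; have [v [dv v0 ev]] := det_one_short.
pose c w : R := c0 * (p0 w)%:~R + c1 * (p1 w)%:~R + c2 * (p2 w)%:~R.
have [nx hx] := near_int (c x); have [nz hz] := near_int (c z).
have [nv hv] := near_int (c v).
have dvR : (det3 x z v)%:~R = 1 :> R by rewrite dv.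
move: dvR; rewrite /det3 !(rmorphD, rmorphB, rmorphM) /=; set D := (X in X = 1) => dvR.
exists (nx * (p1 z * p2 v - p2 z * p1 v) + nz * (p1 v * p2 x - p2 v * p1 x)
  + nv * (p1 x * p2 z - p2 x * p1 z)).
exists (nx * (p2 z * p0 v - p0 z * p2 v) + nz * (p2 v * p0 x - p0 v * p2 x)
  + nv * (p2 x * p0 z - p0 x * p2 z)).
exists (nx * (p0 z * p1 v - p1 z * p0 v) + nz * (p0 v * p1 x - p1 v * p0 x)
  + nv * (p0 x * p1 z - p1 x * p0 z)).
rewrite !(rmorphD, rmorphB, rmorphM) /=.
have -> : c0 = c0 * D by rewrite dvR mulr1.
have -> : c1 = c1 * D by rewrite dvR mulr1.
have -> : c2 = c2 * D by rewrite dvR mulr1.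
have Lp : 0 < L^-1 by rewrite invr_gt0.
have BV : B * L <= 4 / L by rewrite ler_pdivlMr // -mulrA -expr2.
have BBL : 2 / (B * L) * B = 2 / L by field; rewrite !gt_eqF.
have Bev : B * err v <= 6 / L.
  by have := ler_wpM2l (ltW B0) ev; rewrite mulrDr [B * (_ / _)]mulrC BBL; lra.
have ev0 := err_ge0 xi v.
have nX : `|X| <= B by rewrite gtr0_norm // ltW.
have nBz : `|B| <= B by rewrite gtr0_norm.
have dx := d1_le xi x; have dx2 := d2_le xi x.
have dz := le_trans (d1_le xi z) Lz; have dz2 := le_trans (d2_le xi z) Lz.
have dw := d1_le xi v; have dw2 := d2_le xi v.
have LL : L * L <= 4 / B by rewrite ler_pdivlMr // mulrC -expr2.
have Lev : L * err v <= 6 / B.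
  have := ler_wpM2l (ltW ex) ev; rewrite mulrDr.
  have -> : L * (2 / (B * L)) = 2 / B by field; rewrite !gt_eqF.
  by lra.
have Bp : 0 < B^-1 by rewrite invr_gt0.
split.
- set w := (X in `|X| <= _).
  have -> : w = (nx%:~R - c x) * ((p0 v)%:~R * d2 xi z - B * d2 xi v)
      + (nz%:~R - c z) * (X * d2 xi v - (p0 v)%:~R * d2 xi x)
      + (nv%:~R - c v) * (B * d2 xi x - X * d2 xi z).
    by rewrite /w /D /c /d2; ring.
  have := norm_add_le (norm_add_le (norm_mul_le hx (norm_sub_le (norm_mul_le v0 dz2) (norm_mul_le nBz dw2))) (norm_mul_le hz (norm_sub_le (norm_mul_le nX dw2) (norm_mul_le v0 dx2))))
    (norm_mul_le hv (norm_sub_le (norm_mul_le nBz dx2) (norm_mul_le nX dz2))).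
  by lra.
- set w := (X in `|X| <= _).
  have -> : w = (nx%:~R - c x) * (B * d1 xi v - (p0 v)%:~R * d1 xi z)
      + (nz%:~R - c z) * ((p0 v)%:~R * d1 xi x - X * d1 xi v)
      + (nv%:~R - c v) * (X * d1 xi z - B * d1 xi x).
    by rewrite /w /D /c /d1; ring.
  have := norm_add_le (norm_add_le (norm_mul_le hx (norm_sub_le (norm_mul_le nBz dw) (norm_mul_le v0 dz))) (norm_mul_le hz (norm_sub_le (norm_mul_le v0 dx) (norm_mul_le nX dw))))
    (norm_mul_le hv (norm_sub_le (norm_mul_le nX dz) (norm_mul_le nBz dx))).
  by lra.
set w := (X in `|X| <= _).
have -> : w = (nx%:~R - c x) * (d1 xi z * d2 xi v - d2 xi z * d1 xi v)
    + (nz%:~R - c z) * (d1 xi v * d2 xi x - d2 xi v * d1 xi x)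
    + (nv%:~R - c v) * (d1 xi x * d2 xi z - d2 xi x * d1 xi z).
  by rewrite /w /D /c /d1 /d2; ring.
have := norm_add_le (norm_add_le (norm_mul_le hx (norm_sub_le (norm_mul_le dz dw2) (norm_mul_le dz2 dw))) (norm_mul_le hz (norm_sub_le (norm_mul_le dw dx2) (norm_mul_le dw2 dx))))
  (norm_mul_le hv (norm_sub_le (norm_mul_le dx dz2) (norm_mul_le dx2 dz))).
by lra.
Qed.
End Transference.

(** The integral form of [transfer] gives a quartic small at [xi] with a large derivative there, and
    a sign change locates the root. The last clause bounds the coefficients from below, which will
    make the heights unbounded. *)
Lemma quartic_root (R : realType) (xi : R) : exists2 K : R, 1 <= K &
  forall x z : pt, best xi x -> next_best xi x z -> 0 < err xi x ->
  (p0 z)%:~R * err xi x ^+ 2 <= 4 ->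
  exists (u0 u1 u2 : int) (alpha : R),
  [/\ alpha ^+ 4 + (4 * u2)%:~R * alpha ^+ 3 + (4 * u1)%:~R * alpha + (4 * u0 + 2)%:~R = 0,
    `|xi - alpha| <= err xi x / (p0 z)%:~R,
    [/\ `|(4 * u0 + 2)%:~R| <= K / err xi x, `|(4 * u1)%:~R| <= K / err xi x
     & `|(4 * u2)%:~R| <= K / err xi x] &
    (err xi x)^-1 <= K * (`|(4 * u1)%:~R| + `|(4 * u2)%:~R|)].
Proof.
pose y := `|xi|; have y0 : 0 <= y := normr_ge0 xi.
have hx : `|xi| <= y by [].
pose K1 := 6 * y ^+ 2 + 4 * y + 1 + 56 * (3 * y + 1).
pose K2 := 65 + K1 + 4 * y ^+ 3.
pose T := K2 + 56 + 168 * y ^+ 2 + 4 * y ^+ 3.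
pose K := 65 + y ^+ 4 + 56 * y ^+ 3 + (T + 56) * y + (T + 56) + 3 * y ^+ 2.
have y2 := exprn_ge0 2 y0; have y3 := exprn_ge0 3 y0; have y4 := exprn_ge0 4 y0.
have K10 : 0 <= K1 by rewrite /K1; lra.
have K20 : 65 <= K2 by rewrite /K2; lra.
have T0 : 65 <= T by rewrite /T; lra.
have Ty : 0 <= T * y by rewrite mulr_ge0 //; lra.
exists K; first by rewrite /K; lra.
move=> x z bx nxz ex BLL.
set L := err xi x in ex BLL *; set B := (p0 z)%:~R : R in BLL *.
have L1 : L <= 1 by have := best_half bx; rewrite -/L; lra.
have B1 : 1 <= B by rewrite ler1z -gtz0_ge1; case: nxz => h _ _; case: bx => h' _; exact: lt_trans h.
have B0 : 0 < B := lt_le_trans ltr01 B1.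
(* This target makes the quartic O(1 / B) at [xi] and puts 4 u1 near T / L, with T chosen so that
   the derivative at [xi] is at least K2 / L. *)
have [u0 [u1 [u2]]] := @transfer R xi x z bx nxz ex
  (- (xi ^+ 4 + 2) / 4 - xi * (T / 4 / L)) (T / 4 / L) 0 BLL.
rewrite -/L -/B subr0 => -[t1 t2 t3].
have Li1 : 1 <= L^-1 by rewrite invf_ge1.
have Bi1 : B^-1 <= 1 by rewrite invf_le1.
have Bi0 : 0 < B^-1 by rewrite invr_gt0.
exists u0, u1, u2.
set a := (4 * u2)%:~R : R; set b := (4 * u1)%:~R : R; set c := (4 * u0 + 2)%:~R : R.
have a_le : `|a| <= 56 / L by rewrite /a rmorphM normrM normr_nat /=; lra.
have b_le : `|b - T / L| <= 56 / L.
  have -> : b - T / L = 4 * (u1%:~R - T / 4 / L) by rewrite /b rmorphM /=; field; rewrite gt_eqF.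
  by rewrite normrM normr_nat; lra.
have q_le : `|xi ^+ 4 + a * xi ^+ 3 + b * xi + c| <= 64 / B.
  have -> : xi ^+ 4 + a * xi ^+ 3 + b * xi + c = 4 * (u0%:~R -
    (- (xi ^+ 4 + 2) / 4 - xi * (T / 4 / L)) + xi * (u1%:~R - T / 4 / L) + xi ^+ 3 * u2%:~R).
    by rewrite /a /b /c rmorphD !rmorphM /=; field; rewrite gt_eqF.
  by rewrite normrM normr_nat; lra.
have nX2 : `|xi ^+ 2| <= y ^+ 2 by rewrite normrX.
have nX3 : `|xi ^+ 3| <= y ^+ 3 by rewrite normrX.
have nX4 : `|xi ^+ 4| <= y ^+ 4 by rewrite normrX.
set D := 4 * xi ^+ 3 + 3 * (a * xi ^+ 2) + b.
have y3L : y ^+ 3 <= y ^+ 3 / L by rewrite ler_peMr.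
have D_le : `|T / L - D| <= (56 + 168 * y ^+ 2 + 4 * y ^+ 3) / L.
  have -> : T / L - D = - (b - T / L) - (4 * xi ^+ 3 + 3 * (a * xi ^+ 2)) by rewrite /D; ring.
  have b' : `|- (b - T / L)| <= 56 / L by rewrite normrN.
  have := norm_sub_le b' (norm_add_le (norm_mul_le (norm_nat_le R 4) nX3) (norm_mul_le (norm_nat_le R 3) (norm_mul_le a_le nX2))).
  lra.
have D_ge : K2 / L <= D.
  have := ler_norm (T / L - D); move: D_le; rewrite /T; lra.
pose h := L / B.
have h0 : 0 < h by rewrite divr_gt0.
have h1' : h <= 1 by rewrite /h ler_pdivrMr //; lra.
(* [e * e * S e] is the Taylor remainder of the quartic at [xi] beyond its linear term. *)
pose S e := 6 * xi ^+ 2 + 4 * (xi * e) + e * e + a * (3 * xi + e).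
have S_le e : `|e| <= 1 -> `|S e| <= K1 / L.
  move=> e1; have := norm_add_le (norm_add_le (norm_add_le (norm_mul_le (norm_nat_le R 6) nX2) (norm_mul_le (norm_nat_le R 4) (norm_mul_le hx e1))) (norm_mul_le e1 e1))
    (norm_mul_le a_le (norm_add_le (norm_mul_le (norm_nat_le R 3) hx) e1)).
  rewrite -/(S e) => h3; apply: le_trans h3 _; rewrite /K1.
  have : 6 * y ^+ 2 + 4 * y + 1 <= (6 * y ^+ 2 + 4 * y + 1) / L by rewrite ler_peMr //; lra.
  lra.
have hD : K2 / B <= h * D.
  have := ler_wpM2l (ltW h0) D_ge.
  by have -> : h * (K2 / L) = K2 / B by rewrite /h; field; rewrite !gt_eqF.
have hS e : `|e| = h -> `|e * e * S e| <= K1 / B.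
  move=> eh; have e1 : `|e| <= 1 by rewrite eh.
  rewrite normrM; apply: le_trans (ler_wpM2l (normr_ge0 _) (S_le e e1)) _.
  rewrite normrM eh.
  have -> : h * h * (K1 / L) = h * (K1 / B) by rewrite /h; field; rewrite !gt_eqF.
  by rewrite ler_piMl // divr_ge0 // ltW.
set f := 'X^4 + a *: 'X^3 + b *: 'X + c%:P.
have fE t : f.[t] = t ^+ 4 + a * t ^+ 3 + b * t + c by rewrite /f !hornerE.
have f_shift e : f.[xi + e] = (xi ^+ 4 + a * xi ^+ 3 + b * xi + c) + e * D + e * e * S e.
  by rewrite fE /D /S; ring.
(* At distance h the linear term is at least K2 / B, and K2 is at least 65 + K1. It outweighs the
   value at [xi], at most 64 / B, and the remainder, at most K1 / B. *)
have [alpha /andP[l1 l2] ralpha] : exists2 x, xi - h <= x <= xi + h & root f x.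
  apply: poly_ivt; first by lra.
  rewrite !f_shift.
  have hn : `|- h| = h by rewrite normrN gtr0_norm.
  have hp : `|h| = h by rewrite gtr0_norm.
  have S1 := hS _ hn; have S2 := hS _ hp.
  move: q_le S1 S2; rewrite !ler_norml => /andP[q1 q2] /andP[s1 s2] /andP[s3 s4].
  rewrite mulNr; rewrite /K2 in hD.
  have y3B : 0 <= y ^+ 3 / B by rewrite mulr_ge0 // ltW.
  by apply/andP; split; lra.
exists alpha; split.
- by move/rootP: ralpha; rewrite fE.
- by rewrite ler_norml -/h; apply/andP; split; lra.
- split.
  + have -> : c = (xi ^+ 4 + a * xi ^+ 3 + b * xi + c) - (xi ^+ 4 + a * xi ^+ 3
      + ((b - T / L) * xi + T / L * xi)) by ring.
    have nT : `|T / L| <= T / L by rewrite ger0_norm // divr_ge0 ?ltW //; lra.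
    have := norm_sub_le q_le (norm_add_le (norm_add_le nX4 (norm_mul_le a_le nX3)) (norm_add_le (norm_mul_le b_le hx) (norm_mul_le nT hx))).
    move/le_trans; apply; rewrite /K.
    have : y ^+ 4 <= y ^+ 4 / L by rewrite ler_peMr.
    have : 0 <= y ^+ 2 / L by rewrite mulr_ge0 // ltW // invr_gt0.
    have : 0 <= T / L by rewrite divr_ge0 ?ltW //; lra.
    lra.
  + have := ler_normD (b - T / L) (T / L); rewrite subrK.
    have nT : `|T / L| <= T / L by rewrite ger0_norm // divr_ge0 ?ltW //; lra.
    rewrite /K.
    have : 0 <= (65 + y ^+ 4 + 56 * y ^+ 3 + (T + 56) * y + 3 * y ^+ 2) / L.
      by rewrite divr_ge0 ?ltW //; lra.
    lra.
  + apply: le_trans a_le _; rewrite ler_pM2r ?invr_gt0 // /K; lra.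
have D3 : `|D| <= 4 * y ^+ 3 + 3 * y ^+ 2 * `|a| + `|b|.
  have := norm_add_le (norm_add_le (norm_mul_le (norm_nat_le R 4) nX3) (norm_mul_le (norm_nat_le R 3) (norm_mul_le (lexx `|a|) nX2))) (lexx `|b|).
  by rewrite /D; lra.
have K2L : 65 / L + 4 * y ^+ 3 <= D.
  apply: le_trans D_ge; rewrite /K2.
  have : 0 <= K1 / L by rewrite divr_ge0 // ltW.
  lra.
have a0 : 0 <= `|a| by []. have b0 : 0 <= `|b| by [].
have Kl : 1 + 3 * y ^+ 2 <= K by rewrite /K; lra.
apply: le_trans (ler_wpM2r (addr_ge0 b0 a0) Kl).
have : 0 <= y ^+ 2 * `|b| by rewrite mulr_ge0.
by have := ler_norm D; lra.
Qed.

(** * Eisenstein quartics and heights *)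

Definition quartic (a b c : int) : {poly int} :=
  'X^4 + a *: 'X^3 + b *: 'X + c%:P.

Lemma coef_quartic a b c i : (quartic a b c)`_i =
  (i == 4%N)%:R + a * (i == 3%N)%:R + b * (i == 1%N)%:R + (if i == 0%N then c else 0).
Proof. by rewrite /quartic !coefD !coefZ !coefXn coefX coefC. Qed.

Lemma quartic_size_lead a b c :
  size (quartic a b c) = 5%N /\ quartic a b c \is monic.
Proof.
have sz : (size (a *: 'X^3 + b *: 'X + c%:P)%R < size ('X^4 : {poly int})%R)%N.
  rewrite size_polyXn ltnS; apply: leq_trans (size_polyD _ _) _.
  rewrite geq_max (leq_trans (size_polyC_leq1 _)) // andbT.
  apply: leq_trans (size_polyD _ _) _; rewrite geq_max.
  rewrite (leq_trans (size_scale_leq _ _)) ?size_polyXn //=.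
  by rewrite (leq_trans (size_scale_leq _ _)) ?size_polyX.
have -> : quartic a b c = 'X^4 + (a *: 'X^3 + b *: 'X + c%:P).
  by rewrite /quartic !addrA.
split; first by rewrite size_polyDl // size_polyXn.
by rewrite monicE lead_coefDl // lead_coefXn.
Qed.

Lemma quartic_eisenstein u0 u1 u2 :
  irreducible_poly (quartic (4 * u2) (4 * u1) (4 * u0 + 2)).
Proof.
have [sz mon] := quartic_size_lead (4 * u2) (4 * u1) (4 * u0 + 2).
apply: (@eisenstein_crit 2%N) => //; rewrite ?sz //.
- by rewrite (monicP mon).
- rewrite coef_quartic /= !mulr0 !add0r; apply/negP => /dvdzP[e]; lia.
move=> i; rewrite coef_quartic /= => i4.
have -> : (i == 4%N) = false by apply/eqP; lia.
rewrite add0r !rpredD //.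
- by rewrite -mulrA dvdz_mulr.
- by rewrite -mulrA dvdz_mulr.
case: eqP => // _; apply/dvdzP; exists (2 * u0 + 1); lia.
Qed.

(** A constant factor of a monic polynomial is a unit, since the leading coefficients of the factors
    multiply to 1. *)
Lemma monic_irreducible_elt (p : {poly int}) : p \is monic ->
  irreducible_poly p -> irreducible_elt p.
Proof.
move=> mon [s1 irr].
have unitE (q r : {poly int}) : p = q * r -> size q = 1%N -> q \is a GRing.unit.
  move=> E sq; rewrite poly_unitE sq eqxx /=.
  have := congr1 lead_coef E; rewrite lead_coefM (monicP mon).
  have -> : lead_coef q = q`_0 by rewrite /lead_coef sq.
  by move=> h; apply/unitrP; exists (lead_coef r); rewrite [_ * q`_0]mulrC -h.
split; first exact: monic_neq0.
  by rewrite poly_unitE gtn_eqF.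
move=> q r E; have [sq|sq] := eqVneq (size q) 1%N; first by left; apply: unitE E sq.
right; apply: (unitE r q); first by rewrite mulrC.
have qp : q %= p by apply: irr => //; rewrite E dvdp_mulr.
have p0 : p != 0 := monic_neq0 mon.
have q0 : q != 0 by apply: contraNneq p0 => q0; rewrite E q0 mul0r.
have r0 : r != 0 by apply: contraNneq p0 => r0; rewrite E r0 mulr0.
have := congr1 (size \o polyseq) E; rewrite /= size_mul // (eqp_size qp).
by have := size_poly_gt0 p; rewrite p0; move: (size p) (size r) => m n; lia.
Qed.

Section Height.
Variables (R : realType) (p : {poly int}) (alpha : R[i]).
Hypotheses (mon : p \is monic) (irr : irreducible_poly p).
Hypothesis pa : intpoly_root p alpha.

(** [p] stays irreducible over the rationals; were it coprime to [q] there, the two would have no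
    common complex root. *)
Lemma minpoly_dvd (q : {poly int}) : intpoly_root q alpha -> p %| q.
Proof.
move=> qa; rewrite -dvdp_rat_int.
have irr' := iffRL (irreducible_rat_int p) irr.
rewrite -[_ %| _]negbK -irreducible_poly_coprime //; apply/negP => cop.
move: cop; rewrite -(coprimep_map (ratr : {rmorphism rat -> R[i]})) => cop.
have E (r : {poly int}) : map_poly ratr (map_poly intr r) = map_poly intr r :> {poly R[i]}.
  by rewrite -map_poly_comp; apply: eq_map_poly => n /=; rewrite ratr_int.
have := coprimep_root cop (x := alpha); rewrite !E => /(_ pa).
by move: qa; rewrite /intpoly_root /root => ->.
Qed.

(** The polynomial chosen by [xget] is a multiple of [p] and irreducible, so the cofactor is 1 or
    -1. *)
Lemma height_root : height alpha = poly_height p.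
Proof.
rewrite /height; set S := (X in xget _ X).
have [/= irrq qa] : S (xget 0 S).
  by apply: (@xgetI _ 0 S p); split => //; exact: monic_irreducible_elt.
move: (xget 0 S) irrq qa => q [q0 _ irrq] qa.
have [r] := dvdpP_int (minpoly_dvd qa); rewrite zprimitive_monic // => E.
have [pu|] := irrq _ _ E.
  by case: irr => s1 _; move: pu; rewrite poly_unitE gtn_eqF.
rewrite poly_unitE => /andP[sr ur].
have Er : r = (r`_0)%:P by apply: size1_polyC; rewrite (eqP sr).
have r1 : `|(r`_0)%R|%N = 1%N by move: ur => /orP[] /eqP ->.
have r00 : r`_0 != 0 by apply: contraTneq isT => h; rewrite h in r1.
rewrite /poly_height E Er mulrC mul_polyC size_scale //.
by apply: eq_bigr => i _; rewrite coefZ abszM r1 mul1n.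
Qed.
End Height.

Lemma coef_le_height (p : {poly int}) i : (`|(p`_i)%R| <= poly_height p)%N.
Proof.
have [lt|le] := ltnP i (size p); first exact: (leq_bigmax (F := fun i : 'I_(size p) => `|(p`_i)%R|%N) (Ordinal lt)).
by rewrite nth_default.
Qed.

Lemma poly_height_le (p : {poly int}) n :
  (forall i, (`|(p`_i)%R| <= n)%N) -> (poly_height p <= n)%N.
Proof. by move=> h; apply/bigmax_leqP. Qed.

Local Open Scope classical_set_scope.
Local Open Scope ring_scope.
Local Open Scope complex_scope.

Lemma quartic_height_bounds (R : realType) (a b c : int) (M : R) : 1 <= M ->
  `|a%:~R| <= M -> `|b%:~R| <= M -> `|c%:~R| <= M ->
  [/\ (0 < poly_height (quartic a b c))%N, (poly_height (quartic a b c))%:R <= M &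
   `|b%:~R| + `|a%:~R| <= 2 * (poly_height (quartic a b c))%:R :> R].
Proof.
move=> M1 ha hb hc; have M0 : 0 <= M := le_trans ler01 M1.
have nE (n : int) : `|n%:~R| = `|n|%N%:R :> R by rewrite -intr_norm -abszE.
split.
- by apply: leq_trans (coef_le_height _ 4); rewrite coef_quartic /= !mulr0 !addr0.
- apply: le_trans (_ : (Num.truncn M)%:R <= _); last by rewrite truncn_le.
  rewrite ler_nat; apply: poly_height_le => i; rewrite truncn_ge_nat // -nE.
  rewrite coef_quartic; case: i => [|[|[|[|[|i]]]]] //=;
    by rewrite ?mulr0 ?mulr1 ?addr0 ?add0r // ?normr1 ?normr0.
have := coef_le_height (quartic a b c) 3; have := coef_le_height (quartic a b c) 1.
rewrite !coef_quartic /= !mulr0 !mulr1 ?addr0 ?add0r.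
by rewrite -!(ler_nat R) -!nE; lra.
Qed.

Lemma quartic_root_complex (R : realType) (a b c : int) (alpha : R) :
  alpha ^+ 4 + a%:~R * alpha ^+ 3 + b%:~R * alpha + c%:~R = 0 ->
  intpoly_root (quartic a b c) alpha%:C.
Proof.
move=> E; rewrite /intpoly_root.
have -> : map_poly (intr : int -> R[i]) (quartic a b c) =
    map_poly (real_complex R) (map_poly intr (quartic a b c)).
  by rewrite -map_poly_comp; apply: eq_map_poly => n /=; rewrite rmorph_int.
rewrite fmorph_root /root /quartic !rmorphD /= !map_polyZ /= !map_polyXn map_polyX map_polyC /=.
by rewrite !hornerD !hornerZ !hornerXn hornerX hornerC E.
Qed.

Lemma lin_indep_int (R : realType) (xi : R) : lin_indep_rat [:: 1; xi; xi ^+ 3] ->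
  forall n0 n1 n2 : int, n0%:~R + n1%:~R * xi + n2%:~R * xi ^+ 3 = 0 ->
  [/\ n0 = 0, n1 = 0 & n2 = 0].
Proof.
move=> h n0 n1 n2 E; pose q (i : 'I_3) : rat := nth 0 [:: n0%:~R; n1%:~R; n2%:~R] i.
have := h q; rewrite /= !big_ord_recl big_ord0 /q /= !ratr_int mulr1 addr0 addrA.
move=> /(_ E) q0; have int0 (n : int) : n%:~R = 0 :> rat -> n = 0.
  by move/eqP; rewrite intr_eq0 => /eqP.
split; apply: int0.
- exact: (q0 (@Ordinal 3 0 isT)).
- exact: (q0 (@Ordinal 3 1 isT)).
exact: (q0 (@Ordinal 3 2 isT)).
Qed.

(** * The critical exponent and the conclusion *)

Lemma threshold (R : rcfType) (tau : R) :
  let mu : R := 2 * (9 + Num.sqrt 11) / 35 in tau < 1 + 1 / mu ->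
  exists p : R, [/\ 142 / 100 <= p, p <= 1421 / 1000,
    0 < 8 * p ^+ 2 - 36 * p + 35 & tau < 1 + p].
Proof.
move=> mu; set s := Num.sqrt 11 : R in mu *.
have s0 : 0 <= s by apply: sqrtr_ge0.
have s2 : s ^+ 2 = 11 by rewrite sqr_sqrtr // ler0n.
have s_lt : s < 332 / 100.
  rewrite ltNge; apply/negP => h.
  have : 0 <= (s - 332 / 100) * (s + 332 / 100) by apply: mulr_ge0; lra.
  by move: s2; rewrite expr2; lra.
have s_ge : 3316 / 1000 <= s.
  rewrite leNgt; apply/negP => h.
  have : 0 <= (3316 / 1000 - s) * (s + 3316 / 1000) by apply: mulr_ge0; lra.
  by move: s2; rewrite expr2; lra.
have -> : 1 / mu = (9 - s) / 4.
  have m0 : 9 + s != 0 by rewrite gt_eqF //; lra.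
  rewrite /mu; apply: (mulfI m0); have -> : (9 + s) * ((9 - s) / 4) = (81 - s ^+ 2) / 4 by ring.
  by rewrite s2; field.
(* [P] is the smaller root of 8 p^2 - 36 p + 35, the larger being (9 + s) / 4; any p below [P] and
   above both 1.42 and tau - 1 would serve. *)
set P := (9 - s) / 4 => tauP.
exists (Num.max (142 / 100) ((tau - 1 + P) / 2)).
set p := Num.max _ _.
have p_lt : p < P by rewrite /p gt_max /P; apply/andP; split; rewrite -/P; [rewrite /P|]; lra.
have p_ge : 142 / 100 <= p by rewrite le_max lexx.
have p_tau : (tau - 1 + P) / 2 <= p by rewrite le_max lexx orbT.
split=> //.
- by move: p_lt; rewrite /P; lra.
- have -> : 8 * p ^+ 2 - 36 * p + 35 = 8 * ((P - p) * ((9 + s) / 4 - p)).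
    transitivity (8 * p ^+ 2 - 36 * p + (81 - s ^+ 2) / 2); first by rewrite s2; field.
    by rewrite /P; field.
  by rewrite mulr_gt0 // mulr_gt0 ?subr_gt0 // (lt_le_trans p_lt) // /P; lra.
lra.
Qed.

Theorem corollary1p3 (R : realType) (xi tau : R) :
  let mu : R := 2 * (9 + Num.sqrt 11) / 35 in
  lin_indep_rat [:: 1; xi; xi ^+ 3] ->
  tau < 1 + 1 / mu ->
  infinite_set [set alpha : R[i] |
    [/\ integralOver (intr : int -> R[i]) alpha,
        exists a b c : int,
          intpoly_root ('X^4 + a *: 'X^3 + b *: 'X + c%:P) alpha &
        `|xi%:C - alpha| <= (((height alpha)%:R : R) `^ (- tau))%:C]].
Proof.
move=> mu ind htau fin.
have irr := lin_indep_int ind.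
have [p [p1 p2 e0 tp]] := threshold htau.
have [X [bX nX]] := best_sequence irr.
have [K K1 HK] := quartic_root xi.
have [s Es] := iffLR (finite_seqP _) fin.
pose n := (\max_(a <- s) height a)%N.
have K0 : 0 < K := lt_le_trans ltr01 K1.
(* Only an upper bound for the height is inserted in its power, so the exponent is made
   nonnegative. *)
pose q := Num.max tau 0.
have q0 : 0 <= q by rewrite le_max lexx orbT.
have tq : tau <= q by rewrite le_max lexx.
have qp : q < 1 + p by rewrite gt_max tp /=; lra.
(* Once log(1 / L) exceeds [M1], the gap 1 + p - q absorbs the factor K^q; once it exceeds [M2], the
   height of the new root is larger than [n]. *)
pose M1 := q * ln K / (1 + p - q).
pose M2 := ln (2 * K * n%:R + 1).
(* By [best_dirichlet], log X_(i+1) is at most 2 log(1 / L_i) + log 4, so this makes log(1 / L_i)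
   exceed |M1| + |M2| + 1. *)
have [N HN] := lX_large bX nX (2 * (`|M1| + `|M2| + 1) + ln 4).
have [i Ni hi] : exists2 i, (N <= i)%N & p * lK xi X i < lX R X i.+1.
  apply: contrapT => h; apply: (exponent_absurd irr bX nX p1 p2 e0 (N0 := N)) => i Ni.
  by rewrite leNgt; apply/negP => hi; apply: h; exists i.
have ex := errX_gt0 nX i.
have BL := best_dirichlet irr (bX i) (nX i).
have B0 : 0 < (p0 (X i.+1))%:~R :> R by rewrite ltr0z (p0_gt0 bX).
have kl : `|M1| + `|M2| + 1 <= lK xi X i.
  have := HN _ (leqW Ni); have := BL.
  rewrite -ler_ln ?posrE ?mulr_gt0 ?exprn_gt0 ?ltr0n // lnM ?posrE ?exprn_gt0 //.
  by rewrite (lnXn 2 ex) mulr2n /lX /lK; lra.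
have [u0 [u1 [u2 [alpha [Ea da [hc hb ha] hL]]]]] := HK _ _ (bX i) (nX i) ex BL.
have KL1 : 1 <= K / err xi (X i).
  by rewrite ler_pdivlMr // mul1r; apply: le_trans (errX_le1 bX i) K1.
set Q := quartic (4 * u2) (4 * u1) (4 * u0 + 2).
have [H0 H1 H2] := quartic_height_bounds KL1 ha hb hc; rewrite -/Q in H0 H1 H2.
have rQ : intpoly_root Q alpha%:C := quartic_root_complex Ea.
have [_ monQ] := quartic_size_lead (4 * u2) (4 * u1) (4 * u0 + 2).
have hQ : height alpha%:C = poly_height Q.
  exact: height_root monQ (quartic_eisenstein u0 u1 u2) rQ.
have H0' : 0 < (poly_height Q)%:R :> R by rewrite ltr0n.
have kE : ln (K / err xi (X i)) = ln K + lK xi X i.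
  by rewrite lnM ?posrE ?invr_gt0 // lnV.
have : [set` s] alpha%:C.
  rewrite -Es; split=> /=.
  - by exists Q.
  - by exists (4 * u2), (4 * u1), (4 * u0 + 2).
  rewrite hQ -rmorphB normc_def /= expr0n addr0 sqrtr_sqr lecR.
  apply: le_trans da _.
  rewrite -ler_ln ?posrE ?powR_gt0 ?divr_gt0 // ln_powR lnM ?posrE ?invr_gt0 // lnV //.
  have lH0 : 0 <= ln (poly_height Q)%:R :> R by rewrite ln_ge0 // ler1n.
  have lH : ln (poly_height Q)%:R <= ln K + lK xi X i.
    by rewrite -kE ler_ln ?posrE ?divr_gt0.
  have h1 := ler_wpM2r lH0 tq; have h2 := ler_wpM2l q0 lH.
  have h3 : q * ln K <= lK xi X i * (1 + p - q).
    rewrite -ler_pdivrMr ?subr_gt0 // -/M1.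
    by have := ler_norm M1; have := normr_ge0 M2; lra.
  by move: hi; rewrite {1 2}/lK in h2 h3 *; rewrite /lX /lK; lra.
(* Membership in the finite list bounds the height by [n], whereas 1 / L is at most 2 K times the
   height. *)
move=> /= ins; have : (height alpha%:C <= n)%N by exact: leq_bigmax_seq.
rewrite hQ -(ler_nat R) => Hn.
have : (err xi (X i))^-1 < 2 * K * n%:R + 1.
  apply: le_lt_trans hL _.
  have := ler_wpM2l (ltW K0) (le_trans H2 (ler_wpM2l (ler0n R 2) Hn)); lra.
have Kn : 0 <= 2 * K * n%:R by rewrite !mulr_ge0 // ltW.
rewrite -ltr_ln ?posrE ?invr_gt0 //; last by lra.
rewrite lnV // -/M2 -[- ln _]/(lK xi X i).
by have := ler_norm M2; have := normr_ge0 M1; lra.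
Qed.
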